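(* For every $b\in\mathbb{R}$, $$\min_{z\in\mathbb{H}}\big(\zeta(6,z)-b\zeta(3,z)\big)=\min_{z\in\Gamma}\big(\zeta(6,z)-b\zeta(3,z)\big).$$
   Context: $\mathbb{H}=\{z: \Im z>0\}$. For $s>1$, $\zeta(s,z)=\sum_{(m,n)\in\mathbb{Z}^2\setminus\{0\}}\frac{(\Im z)^s}{|mz+n|^{2s}}$. $\Gamma_a=\{z\in\mathbb{H}:\Re z=0,\ \Im z\ge1\}$, $\Gamma_b=\{z\in\mathbb{H}: |z|=1,\ \Im z\in[\frac{\sqrt3}{2},1]\}$, $\Gamma=\Gamma_a\cup\Gamma_b$. *)

(* Defs.v *)
From Stdlib Require Import Reals ZArith List.
From Coquelicot Require Import Coquelicot.
Import ListNotations.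
Open Scope R_scope.

Definition upper_half (z : C) : Prop := 0 < Im z.

Definition zrange (N : nat) : list Z :=
  map (fun k => (Z.of_nat k - Z.of_nat N)%Z) (seq 0 (2 * N + 1)).

Definition eps_term (s : R) (z : C) (mn : Z * Z) : R :=
  let (m, n) := mn in
  if (Z.eqb m 0 && Z.eqb n 0)%bool then 0
  else Rpower (Im z) s / Rpower (Cmod (IZR m * z + IZR n)%C) (2 * s).

Definition eps_partial (s : R) (z : C) (N : nat) : R :=
  fold_right Rplus 0 (map (eps_term s z) (list_prod (zrange N) (zrange N))).

(* zeta(s,z) = sum_{(m,n) in Z^2 \ {0}} (Im z)^s / |m z + n|^(2s).
   The terms are nonnegative, so the series over Z^2 equals the limit of
   the (nondecreasing) square partial sums; it converges for s > 1, z in H. *)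
Definition zeta (s : R) (z : C) : R := real (Lim_seq (eps_partial s z)).

Definition Gamma_a (z : C) : Prop := Re z = 0 /\ 1 <= Im z.
Definition Gamma_b (z : C) : Prop :=
  upper_half z /\ Cmod z = 1 /\ sqrt 3 / 2 <= Im z <= 1.
Definition Gamma (z : C) : Prop := Gamma_a z \/ Gamma_b z.

Definition is_min_on (S : C -> Prop) (f : C -> R) (m : R) : Prop :=
  (exists z, S z /\ f z = m) /\ (forall z, S z -> m <= f z).

(* Main.v *)
(* Write [T = 13/4] and [h = zeta 6 - T zeta 3], so that the function is [h + (T - b) zeta 3]. By modular
   invariance it suffices to consider [z = x + i y] in the half fundamental domain
   [0 <= x <= 1/2, |z| >= 1].

   If [b >= T], move [z] to the left until it meets [Gamma]: on the half domain [zeta 3] decreases and [h]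
   increases in [x]. Indeed the [x]-derivatives of the summands are eigenfunctions of the hyperbolic
   Laplacian with positive eigenvalue, so a minimum principle reduces both signs to the boundary. The
   derivatives vanish on the vertical sides by symmetry, and on the unit arc the claim is an
   inequality in one variable, which interval arithmetic decides.

   If [b <= T], there are moves into [Gamma] lowering both [zeta 3] and [h]. First lower [y] to [3/2] when it
   is larger. Then write [|m z + n|^2 / y = p (m+n)^2 + q n^2 + r m^2], where [p q + q r + r p = 1], keep
   [e = p + q + r] and lower [p q r] until [z] is on the arc or on the axis. Permuting the roles of
   [m+n, -n, -m] splits the summands into triples [A^-s + B^-s + C^-s] with [A + B + C] and
   [A B + B C + C A] fixed and [A B C] depending on the position on a circle about the hexagonal point,
   and the six vectors with [m^2 + m n + n^2 = 1] dominate the change of all the others.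

   On [Gamma] the minimum exists by continuity, as the function tends to infinity along the axis. *)
Require Import Defs.
From Stdlib Require Import Reals ZArith List Permutation Lra Lia Psatz.
From Coquelicot Require Import Coquelicot.
Import ListNotations.
Open Scope R_scope.

(** The splitting removes [b]: along a move only [zeta 3] and [h] have to be controlled. The value
    [13/4] is a compromise, as the horizontal move favours a large [T] and the circular move a small
    one. At the ends of the arc the derivatives vanish, so no enclosure of values can decide their
    sign there; slopes are used instead, and truncation errors need small Lipschitz constants. The
    minimum principle is applied to partial sums over square boxes: they are exact combinations of
    eigenfunctions, so no series is ever differentiated, and their boundary values are right up to
    an error that tends to zero. On a circle [p + q + r = e] the natural coordinate is the product
    [p q r], but the conjugate coordinate has a square root singularity in it where two of [p, q, r]
    agree; pairing each triple with its mirror image cancels the singularity, and every term becomes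
    Lipschitz in the product. The height [3/2] bounds the circles by [e <= 13/6], which confines the
    derivative bounds to a compact region in two variables. *)

(** * Unordered sums over the lattice *)

Definition lsum (f : Z * Z -> R) (L : list (Z * Z)) : R :=
  fold_right Rplus 0 (map f L).

(** Convergence along the net of finite sets is invariant under every bijection of the lattice, so
    symmetries need no rearrangement theorem. Square partial sums reappear only through
    [has_sum_box]. *)
Definition has_sum (f : Z * Z -> R) (l : R) : Prop :=
  forall eps, 0 < eps -> exists L0, forall L, NoDup L -> incl L0 L ->
  Rabs (lsum f L - l) < eps.

Definition pair_eq_dec (u v : Z * Z) : {u = v} + {u <> v}.
Proof. decide equality; apply Z.eq_dec. Defined.

Lemma lsum_app f L M : lsum f (L ++ M) = lsum f L + lsum f M.
Proof.
  unfold lsum; rewrite map_app. induction (map f L); simpl; lra.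
Qed.

Lemma lsum_perm f L M : Permutation L M -> lsum f L = lsum f M.
Proof.
  unfold lsum; induction 1; simpl in *; lra.
Qed.

Lemma lsum_plus f g L : lsum (fun v => f v + g v) L = lsum f L + lsum g L.
Proof. unfold lsum; induction L; simpl; lra. Qed.

Lemma lsum_scal c f L : lsum (fun v => c * f v) L = c * lsum f L.
Proof. unfold lsum; induction L; simpl; [ring|rewrite IHL; ring]. Qed.

Lemma lsum_ext_in f g L : (forall v, In v L -> f v = g v) -> lsum f L = lsum g L.
Proof.
  unfold lsum; intro H; induction L as [|a L IH]; simpl; [reflexivity|].
  rewrite H by (left; reflexivity). rewrite IH; [reflexivity|].
  intros; apply H; right; assumption.
Qed.

Lemma lsum_le_in f g L : (forall v, In v L -> f v <= g v) -> lsum f L <= lsum g L.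
Proof.
  unfold lsum; intro H; induction L as [|a L IH]; simpl; [lra|].
  apply Rplus_le_compat; [apply H; left; reflexivity|].
  apply IH; intros; apply H; right; assumption.
Qed.

Lemma lsum_nonneg f L : (forall v, In v L -> 0 <= f v) -> 0 <= lsum f L.
Proof.
  intro H; replace 0 with (lsum (fun _ => 0) L).
  - apply lsum_le_in; assumption.
  - unfold lsum; induction L; simpl; [reflexivity|]. rewrite IHL; [ring|].
    intros; apply H; right; assumption.
Qed.

Lemma lsum_Rabs_le f g L :
  (forall v, In v L -> Rabs (f v) <= g v) -> Rabs (lsum f L) <= lsum g L.
Proof.
  intro H; apply Rabs_le; split.
  - replace (- lsum g L) with (lsum (fun v => -1 * g v) L) by (rewrite lsum_scal; ring).
    apply lsum_le_in; intros v Hv; specialize (H v Hv).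
    apply Rabs_le_between in H; lra.
  - apply lsum_le_in; intros v Hv; specialize (H v Hv).
    apply Rabs_le_between in H; lra.
Qed.

Lemma lsum_map f (s : Z * Z -> Z * Z) L : lsum f (map s L) = lsum (fun v => f (s v)) L.
Proof. unfold lsum; rewrite map_map; reflexivity. Qed.

Definition lminus (L M : list (Z * Z)) : list (Z * Z) :=
  filter (fun v => if in_dec pair_eq_dec v M then false else true) L.

Lemma In_lminus v L M : In v (lminus L M) <-> In v L /\ ~ In v M.
Proof.
  unfold lminus; rewrite filter_In.
  destruct (in_dec pair_eq_dec v M); intuition congruence.
Qed.

Lemma NoDup_lminus L M : NoDup L -> NoDup (lminus L M).
Proof. apply NoDup_filter. Qed.

Lemma NoDup_join L M : NoDup L -> NoDup M -> NoDup (M ++ lminus L M).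
Proof.
  intros HL HM; apply NoDup_app; auto using NoDup_lminus.
  intros v Hv H; apply In_lminus in H; tauto.
Qed.

Lemma incl_join L M : incl L (M ++ lminus L M).
Proof.
  intros v Hv; apply in_or_app.
  destruct (in_dec pair_eq_dec v M); [left|right; apply In_lminus]; auto.
Qed.

Lemma Permutation_join L M :
  NoDup L -> NoDup M -> incl M L -> Permutation L (M ++ lminus L M).
Proof.
  intros HL HM HML; apply NoDup_Permutation; auto using NoDup_join.
  intro v; split; [apply incl_join|].
  intro H; apply in_app_or in H; destruct H as [H|H]; auto.
  apply In_lminus in H; tauto.
Qed.

(* The net of finite sums is directed. *)
Lemma common_list (L M : list (Z * Z)) :
  exists K, NoDup K /\ incl L K /\ incl M K.
Proof.
  exists (nodup pair_eq_dec (L ++ M)); split; [apply NoDup_nodup|].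
  split; intros v Hv; apply nodup_In, in_or_app; auto.
Qed.

Lemma has_sum_unique f l l' : has_sum f l -> has_sum f l' -> l = l'.
Proof.
  intros H H'. apply cond_eq; intros eps He.
  destruct (H (eps / 2)) as [L HL]; [lra|].
  destruct (H' (eps / 2)) as [L' HL']; [lra|].
  destruct (common_list L L') as (K & HK & H1 & H2).
  specialize (HL K HK H1); specialize (HL' K HK H2).
  apply Rabs_def2 in HL; apply Rabs_def2 in HL'. apply Rabs_def1; lra.
Qed.

Lemma has_sum_plus f g l m :
  has_sum f l -> has_sum g m -> has_sum (fun v => f v + g v) (l + m).
Proof.
  intros H H' eps He.
  destruct (H (eps / 2)) as [L HL]; [lra|].
  destruct (H' (eps / 2)) as [L' HL']; [lra|].
  exists (L ++ L'); intros K HK Hi; rewrite lsum_plus.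
  assert (H1 : incl L K) by (intros v Hv; apply Hi, in_or_app; auto).
  assert (H2 : incl L' K) by (intros v Hv; apply Hi, in_or_app; auto).
  specialize (HL K HK H1); specialize (HL' K HK H2).
  apply Rabs_def2 in HL; apply Rabs_def2 in HL'. apply Rabs_def1; lra.
Qed.

Lemma has_sum_scal c f l : has_sum f l -> has_sum (fun v => c * f v) (c * l).
Proof.
  intros H eps He.
  assert (Hc : 0 < Rabs c + 1) by (pose proof (Rabs_pos c); lra).
  destruct (H (eps / (Rabs c + 1))) as [L HL].
  { apply Rdiv_lt_0_compat; lra. }
  exists L; intros K HK Hi; specialize (HL K HK Hi).
  rewrite lsum_scal. replace (c * lsum f K - c * l) with (c * (lsum f K - l)) by ring.
  rewrite Rabs_mult.
  apply Rle_lt_trans with ((Rabs c) * (eps / (Rabs c + 1))).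
  - apply Rmult_le_compat_l; [apply Rabs_pos|lra].
  - replace eps with ((Rabs c + 1) * (eps / (Rabs c + 1))) at 2 by (field; lra).
    apply Rmult_lt_compat_r; [apply Rdiv_lt_0_compat; lra|lra].
Qed.

Lemma has_sum_ext f g l : (forall v, f v = g v) -> has_sum f l -> has_sum g l.
Proof.
  intros E H eps He; destruct (H eps He) as [L HL]; exists L; intros K HK Hi.
  rewrite <- (lsum_ext_in f g); auto.
Qed.

Lemma has_sum_minus f g l m :
  has_sum f l -> has_sum g m -> has_sum (fun v => f v - g v) (l - m).
Proof.
  intros H H'. apply (has_sum_scal (-1)) in H'.
  replace (l - m) with (l + -1 * m) by ring.
  eapply has_sum_ext; [|apply (has_sum_plus _ _ _ _ H H')].
  intro v; simpl; ring.
Qed.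

Lemma has_sum_ge f l c L0 :
  has_sum f l -> (forall L, NoDup L -> incl L0 L -> c <= lsum f L) -> c <= l.
Proof.
  intros H Hc. apply Rnot_lt_le; intro Hlt.
  destruct (H (c - l)) as [L HL]; [lra|].
  destruct (common_list L0 L) as (K & HK & H1 & H2).
  specialize (HL K HK H2); specialize (Hc K HK H1).
  apply Rabs_def2 in HL; lra.
Qed.

Lemma has_sum_le_bound f l c L0 :
  has_sum f l -> (forall L, NoDup L -> incl L0 L -> lsum f L <= c) -> l <= c.
Proof.
  intros H Hc. apply (has_sum_scal (-1)) in H.
  cut (- c <= -1 * l); [lra|].
  apply (has_sum_ge _ _ _ L0 H); intros L HL Hi.
  rewrite lsum_scal; specialize (Hc L HL Hi); lra.
Qed.

Lemma has_sum_le f g l m :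
  (forall v, f v <= g v) -> has_sum f l -> has_sum g m -> l <= m.
Proof.
  intros E H H'. cut (0 <= m - l); [lra|].
  apply (has_sum_ge _ _ _ [] (has_sum_minus _ _ _ _ H' H)).
  intros L _ _; apply lsum_nonneg; intros v _; specialize (E v); lra.
Qed.

Lemma has_sum_tail f l L0 B :
  NoDup L0 -> has_sum f l ->
  (forall L, NoDup L -> (forall v, In v L -> ~ In v L0) -> Rabs (lsum f L) <= B) ->
  Rabs (l - lsum f L0) <= B.
Proof.
  intros H0 H HB.
  assert (D : forall L, NoDup L -> incl L0 L -> Rabs (lsum f L - lsum f L0) <= B).
  { intros L HL Hi. rewrite (lsum_perm f L _ (Permutation_join L L0 HL H0 Hi)).
    rewrite lsum_app.
    replace (lsum f L0 + lsum f (lminus L L0) - lsum f L0) with (lsum f (lminus L L0)) by ring.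
    apply HB; [apply NoDup_lminus; assumption|].
    intros v Hv; apply In_lminus in Hv; tauto. }
  apply Rabs_le; split.
  - cut (lsum f L0 - B <= l); [lra|].
    apply (has_sum_ge _ _ _ L0 H); intros L HL Hi.
    specialize (D L HL Hi); apply Rabs_le_between in D; lra.
  - cut (l <= lsum f L0 + B); [lra|].
    apply (has_sum_le_bound _ _ _ L0 H); intros L HL Hi.
    specialize (D L HL Hi); apply Rabs_le_between in D; lra.
Qed.

Lemma has_sum_reindex (s t : Z * Z -> Z * Z) f l :
  (forall v, s (t v) = v) -> (forall v, t (s v) = v) ->
  has_sum f l -> has_sum (fun v => f (s v)) l.
Proof.
  intros st ts H eps He; destruct (H eps He) as [L HL].
  exists (map t L); intros K HK Hi. rewrite <- lsum_map. apply HL.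
  - apply FinFun.Injective_map_NoDup; auto.
    intros u v E; rewrite <- (ts u), <- (ts v), E; reflexivity.
  - intros v Hv. rewrite <- (st v). apply in_map, Hi, in_map, Hv.
Qed.

Lemma summable_nonneg f B :
  (forall v, 0 <= f v) -> (forall L, NoDup L -> lsum f L <= B) -> exists l, has_sum f l.
Proof.
  intros Hf HB.
  destruct (completeness (fun x => exists L, NoDup L /\ x = lsum f L)) as [l [Hub Hlub]].
  - exists B; intros x (L & HL & ->); auto.
  - exists (lsum f []), []; split; [constructor|reflexivity].
  - exists l; intros eps He.
    destruct (Classical_Prop.classic (exists L, NoDup L /\ l - eps < lsum f L)) as [(L & HL & Hlt)|Hno].
    + exists L; intros K HK Hi.
      assert (lsum f L <= lsum f K).
      { rewrite (lsum_perm f K _ (Permutation_join K L HK HL Hi)), lsum_app.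
        pose proof (lsum_nonneg f (lminus K L) (fun v _ => Hf v)); lra. }
      assert (lsum f K <= l) by (apply Hub; exists K; auto).
      apply Rabs_def1; lra.
    + exfalso. cut (l <= l - eps); [lra|].
      apply Hlub; intros x (L & HL & ->).
      apply Rnot_lt_le; intro Hlt; apply Hno; exists L; auto.
Qed.

(** Write [f] as the difference of the nonnegative functions [f + g] and [g]. *)
Lemma summable_dominated f g B :
  (forall v, Rabs (f v) <= g v) -> (forall L, NoDup L -> lsum g L <= B) ->
  exists l, has_sum f l.
Proof.
  intros Hf HB.
  assert (Hb : forall v, - g v <= f v <= g v) by (intro v; apply Rabs_le_between, Hf).
  destruct (summable_nonneg g B) as [lg Hg]; auto.
  { intro v; specialize (Hb v); lra. }
  destruct (summable_nonneg (fun v => f v + g v) (2 * B)) as [lh Hh].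
  { intro v; specialize (Hb v); lra. }
  { intros L HL. apply Rle_trans with (lsum (fun v => 2 * g v) L).
    - apply lsum_le_in; intros v _; specialize (Hb v); lra.
    - rewrite lsum_scal; specialize (HB L HL); lra. }
  exists (lh - lg). eapply has_sum_ext; [|apply (has_sum_minus _ _ _ _ Hh Hg)].
  intro v; simpl; ring.
Qed.

(** * Square boxes *)

Definition nrm (v : Z * Z) : Z := Z.max (Z.abs (fst v)) (Z.abs (snd v)).
Definition box (N : nat) : list (Z * Z) := list_prod (zrange N) (zrange N).

Lemma In_zrange N k : In k (zrange N) <-> (Z.abs k <= Z.of_nat N)%Z.
Proof.
  unfold zrange; rewrite in_map_iff; split.
  - intros (i & <- & Hi); apply in_seq in Hi; lia.
  - intro H; exists (Z.to_nat (k + Z.of_nat N)); split; [lia|apply in_seq; lia].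
Qed.

Lemma NoDup_zrange N : NoDup (zrange N).
Proof.
  apply FinFun.Injective_map_NoDup; [intros i j; lia|apply seq_NoDup].
Qed.

Lemma In_box N v : In v (box N) <-> (nrm v <= Z.of_nat N)%Z.
Proof.
  destruct v as [m n]; unfold box, nrm; rewrite in_prod_iff, !In_zrange; simpl; lia.
Qed.

Lemma NoDup_box N : NoDup (box N).
Proof.
  cut (forall A : list Z, NoDup A -> NoDup (list_prod A (zrange N))); [intro H; apply H, NoDup_zrange|].
  intros A HA. induction HA as [|a A Ha HA IH]; simpl; [constructor|].
  apply NoDup_app; auto.
  - apply FinFun.Injective_map_NoDup; [intros i j E; congruence|apply NoDup_zrange].
  - intros v Hv Hv'; apply in_map_iff in Hv; destruct Hv as (b & <- & _).
    apply in_prod_iff in Hv'; tauto.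
Qed.

Lemma length_box N : length (box N) = ((2 * N + 1) * (2 * N + 1))%nat.
Proof. unfold box, zrange; rewrite length_prod, !length_map, !length_seq; reflexivity. Qed.

Lemma incl_box L : exists N, forall M, (N <= M)%nat -> incl L (box M).
Proof.
  induction L as [|v L [N IH]].
  - exists 0%nat; intros M _ v [].
  - exists (Nat.max N (Z.to_nat (nrm v))); intros M HM u [<-|Hu].
    + apply In_box; lia.
    + apply (IH M); [lia|assumption].
Qed.

Lemma has_sum_box f l : has_sum f l -> is_lim_seq (fun N => lsum f (box N)) l.
Proof.
  intro H; apply is_lim_seq_spec; intros eps.
  destruct (H eps (cond_pos eps)) as [L HL].
  destruct (incl_box L) as [N HN].
  exists N; intros M HM; apply HL; auto using NoDup_box.
Qed.

Lemma ring_perm N :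
  Permutation (box (S N)) (box N ++ lminus (box (S N)) (box N)).
Proof.
  apply Permutation_join; auto using NoDup_box.
  intros v Hv; apply In_box in Hv; apply In_box; lia.
Qed.

Lemma length_ring N : INR (length (lminus (box (S N)) (box N))) = 8 * INR (S N).
Proof.
  assert (H : (length (lminus (box (S N)) (box N)) = 8 * S N)%nat).
  { pose proof (Permutation_length (ring_perm N)) as H.
    rewrite length_app, !length_box in H; lia. }
  rewrite H, mult_INR; simpl; ring.
Qed.

Lemma lsum_const_le f L c : (forall v, In v L -> f v <= c) -> lsum f L <= INR (length L) * c.
Proof.
  intro H; induction L as [|a L IH]; [simpl; unfold lsum; simpl; lra|].
  replace (INR (length (a :: L))) with (1 + INR (length L)) by (simpl length; rewrite S_INR; ring).
  change (lsum f (a :: L)) with (f a + lsum f L).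
  assert (f a <= c) by (apply H; left; reflexivity).
  assert (lsum f L <= INR (length L) * c) by (apply IH; intros; apply H; right; assumption).
  lra.
Qed.

(* Comparison with a telescoping series over the rings [nrm v = k], each having [8 k] points. *)
Lemma lsum_tail_le (f : Z * Z -> R) (w W : nat -> R) (M : nat) (L : list (Z * Z)) :
  (forall k, 0 <= w k) -> (forall k, 0 <= W k) ->
  (forall k, (M <= k)%nat -> 8 * INR (S k) * w (S k) <= W k - W (S k)) ->
  (forall v, 0 <= f v) ->
  (forall v, ~ In v (box M) -> f v <= w (Z.to_nat (nrm v))) ->
  NoDup L -> (forall v, In v L -> ~ In v (box M)) -> lsum f L <= W M.
Proof.
  intros Hw HW Hk Hf Hfw HL Hd.
  assert (G : forall j, lsum f (lminus (box (M + j)) (box M)) <= W M - W (M + j)%nat).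
  { assert (F : forall j, lsum f (box (M + j)) <= lsum f (box M) + (W M - W (M + j)%nat)).
    { induction j as [|j IH]; [rewrite Nat.add_0_r; lra|].
      rewrite Nat.add_succ_r.
      rewrite (lsum_perm f _ _ (ring_perm (M + j))), lsum_app.
      pose proof (lsum_const_le f (lminus (box (S (M + j))) (box (M + j))) (w (S (M + j)))) as C.
      rewrite length_ring in C.
      specialize (Hk (M + j)%nat ltac:(lia)).
      cut (lsum f (lminus (box (S (M + j))) (box (M + j))) <= 8 * INR (S (M + j)) * w (S (M + j))); [lra|].
      apply C; intros v Hv; apply In_lminus in Hv; destruct Hv as [H1 H2].
      rewrite In_box in H1. rewrite In_box in H2.
      replace (S (M + j)) with (Z.to_nat (nrm v)) by lia.
      apply Hfw; rewrite In_box; lia. }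
    intro j; specialize (F j).
    rewrite (lsum_perm f _ _ (Permutation_join (box (M + j)) (box M) (NoDup_box _) (NoDup_box _)
      ltac:(intros v Hv; apply In_box in Hv; apply In_box; lia))), lsum_app in F.
    lra. }
  destruct (incl_box L) as [N HN].
  assert (incl L (lminus (box (M + N)) (box M))).
  { intros v Hv; apply In_lminus; split; [apply HN; [lia|assumption]|auto]. }
  rewrite <- (Rplus_0_r (lsum f L)).
  apply Rle_trans with (lsum f (lminus (box (M + N)) (box M))).
  - rewrite (lsum_perm f _ _ (Permutation_join _ L (NoDup_lminus _ _ (NoDup_box _)) HL H)), lsum_app.
    apply Rplus_le_compat_l, lsum_nonneg; auto.
  - specialize (G N); specialize (HW (M + N)%nat); lra.
Qed.

(** [2 / k^4] is the integral of [8 / t^5] over [t >= k], the ring of norm [t] having [8 t] points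
    of size [t^-6]. In the same way [4 / k^2] below comes from [8 / t^3]. *)
Lemma tail6 (k M : nat) : (1 <= M)%nat -> (M <= k)%nat ->
  8 * INR (S k) * / INR (S k) ^ 6 <= 2 / INR k ^ 4 - 2 / INR (S k) ^ 4.
Proof.
  intros HM Hk. assert (1 <= INR k) by (apply (le_INR 1); lia).
  rewrite S_INR. set (a := INR k) in *.
  cut (0 <= 2 / a ^ 4 - 2 / (a + 1) ^ 4 - 8 * (a + 1) * / (a + 1) ^ 6); [lra|].
  replace (2 / a ^ 4 - 2 / (a + 1) ^ 4 - 8 * (a + 1) * / (a + 1) ^ 6)
    with ((2 * (a + 1) ^ 5 - 2 * (a + 1) * a ^ 4 - 8 * a ^ 4) / (a ^ 4 * (a + 1) ^ 5)) by (field; lra).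
  apply Rdiv_le_0_compat.
  - replace (2 * (a + 1) ^ 5 - 2 * (a + 1) * a ^ 4 - 8 * a ^ 4) with
      (20 * a ^ 3 + 20 * a ^ 2 + 10 * a + 2) by ring.
    assert (0 <= a ^ 3) by (apply pow_le; lra). nra.
  - apply Rmult_lt_0_compat; apply pow_lt; lra.
Qed.

Lemma tail4 (k M : nat) : (1 <= M)%nat -> (M <= k)%nat ->
  8 * INR (S k) * / INR (S k) ^ 4 <= 4 / INR k ^ 2 - 4 / INR (S k) ^ 2.
Proof.
  intros HM Hk. assert (1 <= INR k) by (apply (le_INR 1); lia).
  rewrite S_INR. set (a := INR k) in *.
  cut (0 <= 4 / a ^ 2 - 4 / (a + 1) ^ 2 - 8 * (a + 1) * / (a + 1) ^ 4); [lra|].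
  replace (4 / a ^ 2 - 4 / (a + 1) ^ 2 - 8 * (a + 1) * / (a + 1) ^ 4)
    with ((12 * a + 4) / (a ^ 2 * (a + 1) ^ 3)) by (field; lra).
  apply Rdiv_le_0_compat; [lra|].
  apply Rmult_lt_0_compat; apply pow_lt; lra.
Qed.

Lemma lsum_tail6 f C M L :
  (1 <= M)%nat -> 0 <= C -> (forall v, 0 <= f v) ->
  (forall v, ~ In v (box M) -> f v <= C / IZR (nrm v) ^ 6) ->
  NoDup L -> (forall v, In v L -> ~ In v (box M)) -> lsum f L <= C * (2 / INR M ^ 4).
Proof.
  intros HM HC Hf Hb HL Hd.
  apply (lsum_tail_le f (fun k => C * / INR k ^ 6) (fun k => C * (2 / INR k ^ 4)) M); auto.
  (* At [k = 0] the weight is [/ 0 = 0]. *)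
  - intro k; apply Rmult_le_pos; auto. destruct k; [simpl; rewrite !Rmult_0_l, Rinv_0; lra|].
    left; apply Rinv_0_lt_compat, pow_lt, lt_0_INR; lia.
  - intro k; apply Rmult_le_pos; auto. unfold Rdiv. destruct k; [simpl; rewrite !Rmult_0_l, Rinv_0; lra|].
    apply Rmult_le_pos; [lra|]. left; apply Rinv_0_lt_compat, pow_lt, lt_0_INR; lia.
  - intros k Hk; pose proof (tail6 k M HM Hk). nra.
  - intros v Hv; specialize (Hb v Hv). rewrite INR_IZR_INZ, Z2Nat.id; [exact Hb|unfold nrm; lia].
Qed.

Lemma lsum_tail4 f C M L :
  (1 <= M)%nat -> 0 <= C -> (forall v, 0 <= f v) ->
  (forall v, ~ In v (box M) -> f v <= C / IZR (nrm v) ^ 4) ->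
  NoDup L -> (forall v, In v L -> ~ In v (box M)) -> lsum f L <= C * (4 / INR M ^ 2).
Proof.
  intros HM HC Hf Hb HL Hd.
  apply (lsum_tail_le f (fun k => C * / INR k ^ 4) (fun k => C * (4 / INR k ^ 2)) M); auto.
  - intro k; apply Rmult_le_pos; auto. destruct k; [simpl; rewrite !Rmult_0_l, Rinv_0; lra|].
    left; apply Rinv_0_lt_compat, pow_lt, lt_0_INR; lia.
  - intro k; apply Rmult_le_pos; auto. unfold Rdiv. destruct k; [simpl; rewrite !Rmult_0_l, Rinv_0; lra|].
    apply Rmult_le_pos; [lra|]. left; apply Rinv_0_lt_compat, pow_lt, lt_0_INR; lia.
  - intros k Hk; pose proof (tail4 k M HM Hk). nra.
  - intros v Hv; specialize (Hb v Hv). rewrite INR_IZR_INZ, Z2Nat.id; [exact Hb|unfold nrm; lia].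
Qed.

(** The decay shared by the series [tm], [wt] and [ut] below. The origin, where nothing is assumed,
    lies in [box 1], which is counted apart from the tail. *)
Lemma summable4 f C :
  0 <= C -> (forall v, v <> (0, 0)%Z -> Rabs (f v) <= C / IZR (nrm v) ^ 4) -> exists l, has_sum f l.
Proof.
  intros HC H.
  apply (summable_dominated f (fun v => Rabs (f v)) (lsum (fun v => Rabs (f v)) (box 1) + C * (4 / INR 1 ^ 2))).
  { intro; lra. }
  intros L HL.
  apply Rle_trans with (lsum (fun v => Rabs (f v)) (box 1 ++ lminus L (box 1))).
  - rewrite (lsum_perm _ (box 1 ++ lminus L (box 1)) _
      (Permutation_join _ L (NoDup_join _ _ HL (NoDup_box 1)) HL (incl_join L (box 1)))), lsum_app.
    rewrite <- (Rplus_0_r (lsum _ L)) at 1.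
    apply Rplus_le_compat_l, lsum_nonneg; intros; apply Rabs_pos.
  - rewrite lsum_app; apply Rplus_le_compat_l.
    apply lsum_tail4; auto using NoDup_lminus.
    + intro; apply Rabs_pos.
    + intros v Hv; apply H; intros ->; apply Hv, In_box; unfold nrm; simpl; lia.
    + intros v Hv; apply In_lminus in Hv; tauto.
Qed.

(** * Interval arithmetic *)

(** One syntax with three readings: real numbers, intervals, and intervals paired with derivatives.
    [ELet] shares subterms, so that recursively built symmetric functions are evaluated once. *)
Inductive rexpr : Type :=
| EVar (i : nat)
| EInt (n : Z)
| ECst (n d : Z)
| EAdd (a b : rexpr)
| EOpp (a : rexpr)
| EMul (a b : rexpr)
| EInv (a : rexpr)
| EPow (a : rexpr) (n : nat)
| ELet (a b : rexpr).

Fixpoint eval (env : list R) (e : rexpr) : R :=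
  match e with
  | EVar i => nth i env 0
  | EInt n => IZR n
  | ECst n d => IZR n / IZR d
  | EAdd a b => eval env a + eval env b
  | EOpp a => - eval env a
  | EMul a b => eval env a * eval env b
  | EInv a => / eval env a
  | EPow a n => eval env a ^ n
  | ELet a b => eval (eval env a :: env) b
  end.

(* The pair [(a, b)] stands for the interval [[a / 2^20, b / 2^20]]. *)
Definition itv : Type := Z * Z.
Definition scale : Z := (2 ^ 20)%Z.
Definition encl (I : itv) (x : R) : Prop :=
  IZR (fst I) <= x * IZR scale <= IZR (snd I).

Definition ipt (n : Z) : itv := (n * scale, n * scale)%Z.
Definition rdown (n d : Z) : Z := (n / d)%Z.
Definition rup (n d : Z) : Z := (- ((- n) / d))%Z.

Definition iadd (I J : itv) : itv := (fst I + fst J, snd I + snd J)%Z.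
Definition iopp (I : itv) : itv := (- snd I, - fst I)%Z.
(** A product carries the scale [2^40]; the shift returns to [2^20] and rounds both ends outward. *)
Definition ishift (u : itv) : itv :=
  (Z.shiftr (fst u) 20, - Z.shiftr (- snd u) 20)%Z.
Definition imul (I J : itv) : itv :=
  let (a, b) := I in let (c, d) := J in
  ishift
    (if (0 <=? c)%Z then
       ((if (0 <=? a)%Z then a * c else a * d), (if (0 <=? b)%Z then b * d else b * c))%Z
     else
       let p := (a * c)%Z in let q := (a * d)%Z in
       let r := (b * c)%Z in let s := (b * d)%Z in
       (Z.min (Z.min p q) (Z.min r s), Z.max (Z.max p q) (Z.max r s))).
Definition iinv (I : itv) : option itv :=
  if (0 <? fst I)%Z
  then Some (rdown (scale * scale) (snd I), rup (scale * scale) (fst I))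
  else None.
Definition icst (n d : Z) : option itv :=
  if (0 <? d)%Z then Some (rdown (n * scale) d, rup (n * scale) d) else None.
Fixpoint ipow (I : itv) (n : nat) : itv :=
  match n with O => (scale, scale) | 1%nat => I | S n => imul I (ipow I n) end.

Definition ilift2 (f : itv -> itv -> itv) (a b : option itv) : option itv :=
  match a, b with Some u, Some w => Some (f u w) | _, _ => None end.

Fixpoint ieval (env : list itv) (e : rexpr) : option itv :=
  match e with
  | EVar i => Some (nth i env (0, 0)%Z)
  | EInt n => Some (ipt n)
  | ECst n d => icst n d
  | EAdd a b => ilift2 iadd (ieval env a) (ieval env b)
  | EOpp a => option_map iopp (ieval env a)
  | EMul a b => ilift2 imul (ieval env a) (ieval env b)
  | EInv a => match ieval env a with Some u => iinv u | None => None end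
  | EPow a n => option_map (fun I => ipow I n) (ieval env a)
  | ELet a b => match ieval env a with Some u => ieval (u :: env) b | None => None end
  end.

Lemma scale_pos : 0 < IZR scale.
Proof. apply IZR_lt; reflexivity. Qed.

Lemma rdown_le n d : (0 < d)%Z -> IZR (rdown n d) * IZR d <= IZR n.
Proof.
  intro Hd; rewrite <- mult_IZR; apply IZR_le; unfold rdown.
  rewrite Z.mul_comm; apply Z.mul_div_le, Hd.
Qed.

Lemma rup_ge n d : (0 < d)%Z -> IZR n <= IZR (rup n d) * IZR d.
Proof.
  intro Hd; rewrite <- mult_IZR; apply IZR_le; unfold rup.
  pose proof (Z.mul_div_le (- n) d Hd); lia.
Qed.

Lemma mul_between a b c d x y :
  a <= x <= b -> c <= y <= d ->
  Rmin (Rmin (a * c) (a * d)) (Rmin (b * c) (b * d)) <= x * y <=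
  Rmax (Rmax (a * c) (a * d)) (Rmax (b * c) (b * d)).
Proof.
  intros Hx Hy.
  assert (L : forall u v w, Rmin u v <= w <-> u <= w \/ v <= w).
  { intros u v w; unfold Rmin; destruct (Rle_dec u v); intuition lra. }
  assert (U : forall u v w, w <= Rmax u v <-> w <= u \/ w <= v).
  { intros u v w; unfold Rmax; destruct (Rle_dec u v); intuition lra. }
  assert (Ea : (a * c <= a * y <= a * d) \/ (a * d <= a * y <= a * c)) by (destruct (Rle_dec 0 a); nra).
  assert (Eb : (b * c <= b * y <= b * d) \/ (b * d <= b * y <= b * c)) by (destruct (Rle_dec 0 b); nra).
  assert (Ey : (a * y <= x * y <= b * y) \/ (b * y <= x * y <= a * y)) by (destruct (Rle_dec 0 y); nra).
  rewrite !L, !U.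
  generalize dependent (a * c); generalize dependent (a * d).
  generalize dependent (b * c); generalize dependent (b * d).
  generalize dependent (a * y); generalize dependent (b * y); generalize dependent (x * y).
  clear. intros. split; destruct Ea, Eb, Ey;
    first [left; left; lra|left; right; lra|right; left; lra|right; right; lra].
Qed.

Lemma IZR_min a b : IZR (Z.min a b) = Rmin (IZR a) (IZR b).
Proof.
  destruct (Z.le_ge_cases a b).
  - rewrite Z.min_l, Rmin_left; auto; apply IZR_le; assumption.
  - rewrite Z.min_r, Rmin_right; auto; apply IZR_le; assumption.
Qed.

Lemma IZR_max a b : IZR (Z.max a b) = Rmax (IZR a) (IZR b).
Proof.
  destruct (Z.le_ge_cases a b).
  - rewrite Z.max_r, Rmax_right; auto; apply IZR_le; assumption.
  - rewrite Z.max_l, Rmax_left; auto; apply IZR_le; assumption.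
Qed.

Lemma ishift_correct u x :
  IZR (fst u) <= x * IZR scale * IZR scale <= IZR (snd u) -> encl (ishift u) x.
Proof.
  destruct u as [a b]; unfold encl, ishift; cbn [fst snd]; intro H.
  pose proof scale_pos as Hs.
  rewrite !Z.shiftr_div_pow2 by lia. change (2 ^ 20)%Z with scale.
  pose proof (rdown_le a scale ltac:(reflexivity)) as D.
  pose proof (rup_ge b scale ltac:(reflexivity)) as U.
  unfold rdown, rup in *.
  split; apply Rmult_le_reg_r with (IZR scale); lra.
Qed.

Lemma imul_correct I J x y : encl I x -> encl J y -> encl (imul I J) (x * y).
Proof.
  destruct I as [a b], J as [c d]; unfold encl at 1 2, imul; cbn [fst snd]; intros Hx Hy.
  apply ishift_correct.
  replace (x * y * IZR scale * IZR scale) with (x * IZR scale * (y * IZR scale)) by ring.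
  generalize dependent (x * IZR scale); generalize dependent (y * IZR scale); clear.
  intros y Hy x Hx.
  destruct (Z.leb_spec 0 c) as [Hc|Hc].
  - cbn [fst snd]; apply IZR_le in Hc. split.
    + destruct (Z.leb_spec 0 a) as [Ha|Ha]; [apply IZR_le in Ha|apply IZR_lt in Ha];
        rewrite mult_IZR; nra.
    + destruct (Z.leb_spec 0 b) as [Hb|Hb]; [apply IZR_le in Hb|apply IZR_lt in Hb];
        rewrite mult_IZR; nra.
  - cbn [fst snd]. rewrite !IZR_min, !IZR_max, !mult_IZR. apply mul_between; assumption.
Qed.

Lemma ipow_correct I x n : encl I x -> encl (ipow I n) (x ^ n).
Proof.
  intro H; induction n as [|[|n] IH].
  - unfold encl; cbn [ipow pow fst snd]; lra.
  - cbn [ipow]; rewrite pow_1; assumption.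
  - change (ipow I (S (S n))) with (imul I (ipow I (S n))).
    rewrite <- tech_pow_Rmult; apply imul_correct; assumption.
Qed.

Lemma iinv_correct I J x : encl I x -> iinv I = Some J -> encl J (/ x).
Proof.
  destruct I as [a b]; unfold iinv, encl; cbn [fst snd]; intros Hx.
  destruct (Z.ltb_spec 0 a) as [Ha|]; [|discriminate].
  intro E; assert (EJ : J = (rdown (scale * scale) b, rup (scale * scale) a)) by congruence.
  rewrite EJ; cbn [fst snd].
  pose proof scale_pos as Hs.
  assert (Ha' : 0 < IZR a) by (apply IZR_lt; assumption).
  assert (Hx0 : 0 < x) by nra.
  assert (Hb' : 0 < IZR b) by lra.
  assert (Hb : (0 < b)%Z) by (apply lt_IZR; assumption).
  pose proof (rdown_le (scale * scale) b Hb) as H1.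
  pose proof (rup_ge (scale * scale) a Ha) as H2.
  rewrite mult_IZR in H1, H2.
  set (s := IZR scale) in *.
  clear E EJ; assert (E : / x * s * (x * s) = s * s) by (field; lra).
  assert (Hp : 0 < / x * s) by (apply Rmult_lt_0_compat; [apply Rinv_0_lt_compat|]; assumption).
  generalize dependent (/ x * s); intros p E Hp.
  split.
  - apply Rmult_le_reg_r with (IZR b); [assumption|].
    pose proof (Rmult_le_compat_l _ _ _ (Rlt_le _ _ Hp) (proj2 Hx)); lra.
  - apply Rmult_le_reg_r with (IZR a); [assumption|].
    pose proof (Rmult_le_compat_l _ _ _ (Rlt_le _ _ Hp) (proj1 Hx)); lra.
Qed.

Lemma icst_correct n d J : icst n d = Some J -> encl J (IZR n / IZR d).
Proof.
  unfold icst, encl; destruct (Z.ltb_spec 0 d) as [Hd|]; [|discriminate].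
  intro E; assert (EJ : J = (rdown (n * scale) d, rup (n * scale) d)) by congruence.
  rewrite EJ; clear E EJ; cbn [fst snd].
  assert (Hd' : 0 < IZR d) by (apply IZR_lt; assumption).
  pose proof (rdown_le (n * scale) d Hd) as H1.
  pose proof (rup_ge (n * scale) d Hd) as H2.
  rewrite mult_IZR in H1, H2.
  assert (E : IZR n / IZR d * IZR scale * IZR d = IZR n * IZR scale) by (field; lra).
  split; apply Rmult_le_reg_r with (IZR d); lra.
Qed.

Lemma nth_encl B env i : Forall2 encl B env -> encl (nth i B (0, 0)%Z) (nth i env 0).
Proof.
  intro H; revert i; induction H; intros [|i]; cbn [nth]; auto;
    unfold encl; cbn [fst snd]; lra.
Qed.

Lemma ipt_correct n : encl (ipt n) (IZR n).
Proof. unfold encl, ipt; cbn [fst snd]; rewrite mult_IZR; lra. Qed.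

Lemma iadd_correct I J x y : encl I x -> encl J y -> encl (iadd I J) (x + y).
Proof. unfold encl, iadd; cbn [fst snd]; rewrite !plus_IZR; lra. Qed.

Lemma iopp_correct I x : encl I x -> encl (iopp I) (- x).
Proof. unfold encl, iopp; cbn [fst snd]; rewrite !opp_IZR; lra. Qed.

Lemma ieval_correct B env e I :
  Forall2 encl B env -> ieval B e = Some I -> encl I (eval env e).
Proof.
  revert B env I; induction e as [i|n|n d|e1 IH1 e2 IH2|e1 IH1|e1 IH1 e2 IH2|e1 IH1|e1 IH1 n|e1 IH1 e2 IH2];
    cbn [ieval eval]; intros B env I HB E.
  - injection E as <-; apply nth_encl, HB.
  - replace I with (ipt n) by congruence. apply ipt_correct.
  - apply icst_correct; assumption.
  - destruct (ieval B e1) as [I1|] eqn:E1, (ieval B e2) as [I2|] eqn:E2; try discriminate.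
    replace I with (iadd I1 I2) by (unfold ilift2 in E; congruence). apply iadd_correct; eauto.
  - destruct (ieval B e1) as [I1|] eqn:E1; try discriminate.
    replace I with (iopp I1) by (unfold option_map in E; congruence). apply iopp_correct; eauto.
  - destruct (ieval B e1) as [I1|] eqn:E1, (ieval B e2) as [I2|] eqn:E2; try discriminate.
    replace I with (imul I1 I2) by (unfold ilift2 in E; congruence). apply imul_correct; eauto.
  - destruct (ieval B e1) as [I1|] eqn:E1; try discriminate.
    eapply iinv_correct; eauto.
  - destruct (ieval B e1) as [I1|] eqn:E1; try discriminate.
    replace I with (ipow I1 n) by (unfold option_map in E; congruence). apply ipow_correct; eauto.
  - destruct (ieval B e1) as [I1|] eqn:E1; try discriminate.
    eapply IH2; [constructor; eauto|assumption].
Qed.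

Definition ipositive (B : list itv) (e : rexpr) : bool :=
  match ieval B e with Some u => (0 <? fst u)%Z | None => false end.

Definition imid (I : itv) : Z := ((fst I + snd I) / 2)%Z.

Definition itv2 : Type := itv * itv.

(** Forward differentiation: the second component encloses the derivative in the direction set by
    the environment, with [ipt 1] for a moving variable and [ipt 0] for a frozen one. *)
Fixpoint ideval (B : list itv2) (e : rexpr) : option itv2 :=
  match e with
  | EVar i => Some (nth i B (ipt 0, ipt 0))
  | EInt n => Some (ipt n, ipt 0)
  | ECst n d => match icst n d with Some u => Some (u, ipt 0) | None => None end
  | EAdd a b =>
      match ideval B a, ideval B b with
      | Some (u, u'), Some (w, w') => Some (iadd u w, iadd u' w')
      | _, _ => None end
  | EOpp a =>
      match ideval B a with Some (u, u') => Some (iopp u, iopp u') | None => None end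
  | EMul a b =>
      match ideval B a, ideval B b with
      | Some (u, u'), Some (w, w') => Some (imul u w, iadd (imul u' w) (imul u w'))
      | _, _ => None end
  | EInv a =>
      match ideval B a with
      | Some (u, u') =>
          match iinv u with
          | Some w => Some (w, iopp (imul u' (imul w w)))
          | None => None end
      | None => None end
  | EPow a n =>
      match ideval B a with
      | Some (u, u') =>
          Some (ipow u n, imul (ipt (Z.of_nat n)) (imul (ipow u (pred n)) u'))
      | None => None end
  | ELet a b => match ideval B a with Some w => ideval (w :: B) b | None => None end
  end.

Definition encl_jet (t : R) (w : itv2) (f : R -> R) : Prop :=
  encl (fst w) (f t) /\ exists d, is_derive f t d /\ encl (snd w) d.

Lemma encl_jet_const t u c : encl u c -> encl_jet t (u, ipt 0) (fun _ => c).
Proof.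
  split; [assumption|]. exists 0; split; [evar_last; [apply is_derive_const|reflexivity]|].
  apply (ipt_correct 0).
Qed.

Lemma ideval_correct e : forall (B : list itv2) (F : list (R -> R)) t w,
  Forall2 (encl_jet t) B F -> ideval B e = Some w ->
  encl_jet t w (fun s => eval (map (fun f => f s) F) e).
Proof.
  induction e as [i|n|n d|e1 IH1 e2 IH2|e1 IH1|e1 IH1 e2 IH2|e1 IH1|e1 IH1 n|e1 IH1 e2 IH2];
    cbn [ideval eval]; intros B F t w HF E;
    try (destruct (ideval B e1) as [[u1 u1']|] eqn:E1; [|discriminate];
      destruct (IH1 _ _ _ _ HF E1) as (A1 & d1 & A2 & A3); cbn [fst snd] in A1, A3);
    try (destruct (ideval B e2) as [[u2 u2']|] eqn:E2; [|discriminate];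
      destruct (IH2 _ _ _ _ HF E2) as (B1 & d2 & B2 & B3); cbn [fst snd] in B1, B3).
  - replace w with (nth i B (ipt 0, ipt 0)) by congruence.
    assert (HN : forall s, nth i F (fun _ => 0) s = nth i (map (fun f => f s) F) 0).
    { intro s. symmetry. exact (map_nth (fun f => f s) F (fun _ => 0) i). }
    assert (HJ : encl_jet t (nth i B (ipt 0, ipt 0)) (nth i F (fun _ => 0))).
    { clear E HN; revert i; induction HF; intros [|i]; cbn [nth]; auto;
        apply encl_jet_const, (ipt_correct 0). }
    destruct HJ as (J1 & d & J2 & J3). split; [rewrite <- HN; exact J1|].
    exists d; split; [eapply is_derive_ext; [exact HN|exact J2]|exact J3].
  - replace w with (ipt n, ipt 0) by congruence. apply encl_jet_const, ipt_correct.
  - destruct (icst n d) as [u|] eqn:Ec; [|discriminate].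
    replace w with (u, ipt 0) by congruence. apply encl_jet_const, icst_correct, Ec.
  - replace w with (iadd u1 u2, iadd u1' u2') by congruence.
    split; [apply iadd_correct; assumption|]. exists (d1 + d2).
    split; [exact (is_derive_plus _ _ _ _ _ A2 B2)|apply iadd_correct; assumption].
  - replace w with (iopp u1, iopp u1') by congruence.
    split; [apply iopp_correct; assumption|]. exists (- d1).
    split; [exact (is_derive_opp _ _ _ A2)|apply iopp_correct; assumption].
  - replace w with (imul u1 u2, iadd (imul u1' u2) (imul u1 u2')) by congruence.
    split; [apply imul_correct; assumption|].
    eexists; split; [exact (is_derive_mult _ _ _ _ _ A2 B2 Rmult_comm)|].
    apply iadd_correct; apply imul_correct; assumption.
  - destruct (iinv u1) as [z|] eqn:Ez; try discriminate.
    replace w with (z, iopp (imul u1' (imul z z))) by congruence.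
    pose proof (iinv_correct _ _ _ A1 Ez) as Hz. split; [assumption|].
    set (x := eval (map (fun f => f t) F) e1) in *.
    assert (Hnz : x <> 0).
    { destruct u1 as [a b]; unfold iinv in Ez; cbn [fst snd] in Ez.
      destruct (Z.ltb_spec 0 a) as [Ha|]; [|discriminate].
      apply IZR_lt in Ha; destruct A1 as [A1 _]; cbn [fst] in A1. pose proof scale_pos.
      intro Z0; rewrite Z0 in A1; lra. }
    exists (- (d1 * (/ x * / x))); split.
    + evar_last; [exact (is_derive_inv _ _ _ A2 Hnz)|]. cbv beta. fold x. field; assumption.
    + apply iopp_correct; repeat apply imul_correct; assumption.
  - replace w with (ipow u1 n, imul (ipt (Z.of_nat n)) (imul (ipow u1 (pred n)) u1')) by congruence.
    split; [apply ipow_correct; assumption|].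
    exists (INR n * (eval (map (fun f => f t) F) e1 ^ pred n * d1)); split.
    + evar_last; [exact (is_derive_pow _ n _ _ A2)|]. cbv beta. ring.
    + rewrite INR_IZR_INZ. repeat apply imul_correct; auto using ipt_correct, ipow_correct.
  - apply (IH2 ((u1, u1') :: B) ((fun s => eval (map (fun f => f s) F) e1) :: F) t w);
      [|assumption].
    constructor; [|assumption]. split; [assumption|exists d1; split; assumption].
Qed.

Definition icentre (B : list itv) : list R := map (fun u => IZR (imid u) / IZR scale) B.

Definition iconst (B : list itv) : list itv2 := map (fun u => (u, ipt 0)) B.

(* Lower bound for the change of [e] when the coordinates in [B] are moved one after the other
   from the centre of their intervals, those in [pre] having been moved before. *)
Fixpoint ispread (e : rexpr) (pre B : list itv) : option Z :=
  match B with
  | [] => Some 0%Z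
  | u :: B' =>
      match ideval (iconst pre ++ (u, ipt 1) :: iconst B') e, ispread e (pre ++ [u]) B' with
      | Some (_, w), Some r => Some (fst (imul w (iadd u (iopp (imid u, imid u)))) + r)%Z
      | _, _ => None end
  end.

(** Mean value form. Its overestimation is quadratic in the width of the box, whereas direct
    evaluation loses linearly whenever a variable is repeated. *)
Definition icentered (B : list itv) (e : rexpr) : bool :=
  match ieval (map (fun u => (imid u, imid u)) B) e, ispread e [] B with
  | Some u, Some w => (0 <? fst u + w)%Z
  | _, _ => false
  end.

Lemma imid_between a b : (a <= b)%Z -> (a <= imid (a, b) <= b)%Z.
Proof.
  intro H; unfold imid; cbn [fst snd].
  pose proof (Z.mul_div_le (a + b) 2 ltac:(lia)).
  pose proof (Z.mul_succ_div_gt (a + b) 2 ltac:(lia)). lia.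
Qed.

Lemma icentre_correct B env : Forall2 encl B env ->
  Forall2 encl B (icentre B) /\ Forall2 encl (map (fun u => (imid u, imid u)) B) (icentre B).
Proof.
  pose proof scale_pos as Hs.
  induction 1 as [|u x B env Hu HB [IH1 IH2]]; [split; constructor|].
  assert (Hc : IZR (imid u) / IZR scale * IZR scale = IZR (imid u)) by (field; lra).
  split; constructor; auto; unfold encl in *; rewrite Hc; [|split; apply Rle_refl].
  destruct u as [a b]; cbn [fst snd] in *.
  destruct (imid_between a b); [apply le_IZR; lra|]. split; apply IZR_le; assumption.
Qed.

(** Jets only assert, point by point, that some derivative exists in the enclosure [D]; [Derive]
    makes it the function that the mean value theorem asks for. *)
Lemma mean_value (f : R -> R) (D : R -> Prop) x y :
  (forall t, Rmin x y <= t <= Rmax x y -> exists d, is_derive f t d /\ D d) ->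
  exists d, D d /\ f y - f x = d * (y - x).
Proof.
  intro H.
  assert (HD : forall t, Rmin x y <= t <= Rmax x y -> is_derive f t (Derive f t) /\ D (Derive f t)).
  { intros t Ht. destruct (H t Ht) as (d & Hd & HD).
    rewrite (is_derive_unique _ _ _ Hd). split; assumption. }
  destruct (MVT_gen f x y (Derive f)) as (t & Ht & E).
  - intros t Ht; apply HD; lra.
  - intros t Ht. apply continuity_pt_filterlim, (ex_derive_continuous f). eexists; apply HD, Ht.
  - exists (Derive f t); split; [apply HD, Ht|exact E].
Qed.

Lemma encl_convex u x y t : encl u x -> encl u y -> Rmin x y <= t <= Rmax x y -> encl u t.
Proof.
  unfold encl, Rmin, Rmax; pose proof scale_pos. destruct (Rle_dec x y); nra.
Qed.

Lemma iconst_jets t B env : Forall2 encl B env ->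
  Forall2 (encl_jet t) (iconst B) (map (fun x _ => x) env).
Proof. induction 1; constructor; auto. apply encl_jet_const; assumption. Qed.

Lemma ispread_correct e B env : Forall2 encl B env -> forall pre epre w,
  Forall2 encl pre epre -> ispread e pre B = Some w ->
  eval (epre ++ icentre B) e * IZR scale + IZR w <= eval (epre ++ env) e * IZR scale.
Proof.
  induction 1 as [|u x B env Hu HB IH]; intros pre epre r Hpre E; cbn [ispread icentre map] in *.
  - replace r with 0%Z by congruence. lra.
  - destruct (ideval _ e) as [[w0 w]|] eqn:Ew; [|discriminate].
    destruct (ispread e (pre ++ [u]) B) as [r'|] eqn:Er; [|discriminate].
    set (c := IZR (imid u) / IZR scale). fold (icentre B).
    destruct (icentre_correct (u :: B) (x :: env) ltac:(constructor; assumption)) as [HC _].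
    inversion_clear HC as [|? ? ? ? Hc HC']. fold c in Hc. change (map _ B) with (icentre B) in HC'.
    specialize (IH (pre ++ [u]) (epre ++ [x]) r' ltac:(apply Forall2_app; auto) Er).
    rewrite <- !app_assoc in IH; cbn [app] in IH.
    set (F := map (fun x (_ : R) => x) epre ++ (fun s => s) :: map (fun x (_ : R) => x) (icentre B)).
    assert (HF : forall s, map (fun f => f s) F = epre ++ s :: icentre B).
    { intro s. unfold F. rewrite map_app. cbn [map]. rewrite !map_map, !map_id. reflexivity. }
    destruct (mean_value (fun s => eval (map (fun f => f s) F) e) (encl w) c x) as (d & Hd & M).
    { intros t Ht.
      assert (HJ : Forall2 (encl_jet t) (iconst pre ++ (u, ipt 1) :: iconst B) F).
      { apply Forall2_app; [apply iconst_jets, Hpre|]. constructor; [|apply iconst_jets, HC'].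
        split; [exact (encl_convex _ _ _ _ Hc Hu Ht)|].
        exists 1; split; [apply (is_derive_id t)|apply (ipt_correct 1)]. }
      destruct (ideval_correct e _ F t (w0, w) HJ Ew) as [_ J]; exact J. }
    rewrite !HF in M. pose proof scale_pos as Hs.
    assert (W : encl (imul w (iadd u (iopp (imid u, imid u)))) (d * (x - c))).
    { apply imul_correct; [assumption|]. apply iadd_correct; [assumption|]. apply iopp_correct.
      unfold encl, c; cbn [fst snd].
      replace (IZR (imid u) / IZR scale * IZR scale) with (IZR (imid u)) by (field; lra). lra. }
    rewrite <- M in W. destruct W as [W _].
    replace r with (fst (imul w (iadd u (iopp (imid u, imid u)))) + r')%Z by congruence.
    rewrite plus_IZR. lra.
Qed.

Lemma icentered_correct B env e :
  icentered B e = true -> Forall2 encl B env -> 0 < eval env e.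
Proof.
  unfold icentered; intros H HB.
  destruct (ieval _ e) as [u|] eqn:Eu; [|discriminate].
  destruct (ispread e [] B) as [w|] eqn:Ew; [|discriminate].
  apply Z.ltb_lt, IZR_lt in H. rewrite plus_IZR in H. pose proof scale_pos as Hs.
  apply (ieval_correct _ _ _ _ (proj2 (icentre_correct B env HB))) in Eu.
  pose proof (ispread_correct e B env HB [] [] w (Forall2_nil _) Ew) as D.
  unfold encl in Eu; cbn [app] in D. nra.
Qed.

Fixpoint isplit (k : nat) (B : list itv) : list itv * list itv :=
  match B with
  | [] => ([], [])
  | u :: B' =>
      match k with
      | O => ((fst u, imid u) :: B', (imid u, snd u) :: B')
      | S k => let (B1, B2) := isplit k B' in (u :: B1, u :: B2)
      end
  end.

Fixpoint bisect (test : list itv -> bool) (fuel k : nat) (B : list itv) : bool :=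
  if test B then true else
  match fuel with
  | O => false
  | S fuel =>
      let k' := if (S k <? length B)%nat then S k else O in
      let (B1, B2) := isplit k B in
      if bisect test fuel k' B1 then bisect test fuel k' B2 else false
  end.

(** The region of interest is where all of [es] are nonpositive; a box on which one of them is
    positive lies outside it and needs no bound for [g]. *)
Definition positive_test (es : list rexpr) (g : rexpr) (B : list itv) : bool :=
  if existsb (ipositive B) es then true else icentered B g.

(** For intervals that end at a zero of the sum, where positivity cannot be certified. *)
Definition slope_test (c : Z) (g : rexpr) (B : list itv) : bool :=
  match ideval (map (fun u => (u, ipt 1)) B) g with
  | Some (_, u) => (c * scale <=? fst u)%Z
  | None => false
  end.

Lemma isplit_correct k B env :
  Forall2 encl B env ->
  Forall2 encl (fst (isplit k B)) env \/ Forall2 encl (snd (isplit k B)) env.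
Proof.
  intro H; revert k; induction H as [|I x B env Hx HB IH]; intro k; simpl.
  - left; destruct k; constructor.
  - destruct k as [|k].
    + unfold encl in Hx. destruct (Rle_dec (x * IZR scale) (IZR (imid I))).
      * left; constructor; auto; unfold encl; simpl; lra.
      * right; constructor; auto; unfold encl; simpl; lra.
    + specialize (IH k). cbn [isplit]. destruct (isplit k B) as [B1 B2]; cbn [fst snd] in *.
      destruct IH; [left|right]; constructor; auto.
Qed.

Lemma bisect_correct test fuel k B env :
  bisect test fuel k B = true -> Forall2 encl B env ->
  exists B', test B' = true /\ Forall2 encl B' env.
Proof.
  revert k B; induction fuel as [|fuel IH]; intros k B H HB;
    cbn [bisect] in H; destruct (test B) eqn:E.
  1, 3: exists B; split; assumption.
  - discriminate.
  - pose proof (isplit_correct k B env HB) as Hs.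
    destruct (isplit k B) as [B1 B2]; cbn [fst snd] in Hs.
    destruct (bisect test fuel _ B1) eqn:E1; [|discriminate].
    destruct Hs; eauto.
Qed.

Lemma bisect_positive fuel es g B env :
  bisect (positive_test es g) fuel 0 B = true -> Forall2 encl B env ->
  (forall e, In e es -> eval env e <= 0) -> 0 < eval env g.
Proof.
  intros H HB Hes. destruct (bisect_correct _ _ _ _ _ H HB) as (B' & HT & HB').
  unfold positive_test in HT. destruct (existsb (ipositive B') es) eqn:E.
  - exfalso; apply existsb_exists in E; destruct E as (e & He & Hp); specialize (Hes e He).
    unfold ipositive in Hp; destruct (ieval B' e) as [I|] eqn:EI; [|discriminate].
    apply (ieval_correct _ env) in EI; auto; apply Z.ltb_lt, IZR_lt in Hp.
    pose proof scale_pos; unfold encl in EI; nra.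
  - apply (icentered_correct B'); assumption.
Qed.

Lemma bisect_slope fuel c g u x y :
  bisect (slope_test c g) fuel 0 [u] = true -> encl u x -> encl u y -> x <= y ->
  IZR c * (y - x) <= eval [y] g - eval [x] g.
Proof.
  intros H Hx Hy Hxy.
  destruct (mean_value (fun s => eval [s] g) (fun d => IZR c <= d) x y) as (d & Hd & E).
  - intros t Ht.
    assert (Hu : Forall2 encl [u] [t]) by (constructor; [exact (encl_convex _ _ _ _ Hx Hy Ht)|constructor]).
    destruct (bisect_correct _ _ _ _ _ H Hu) as (B' & HT & HB').
    unfold slope_test in HT. destruct (ideval _ g) as [[w w']|] eqn:E; [|discriminate].
    apply Z.leb_le, IZR_le in HT; rewrite mult_IZR in HT.
    assert (HJ : Forall2 (encl_jet t) (map (fun u => (u, ipt 1)) B') [fun s => s]).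
    { inversion_clear HB' as [|u' ? l ? Hu' HN]; inversion_clear HN. constructor; [|constructor].
      split; [exact Hu'|]. exists 1; split; [apply (is_derive_id t)|apply (ipt_correct 1)]. }
    destruct (ideval_correct g _ _ t _ HJ E) as (_ & d & D1 & D2).
    exists d; split; [exact D1|]. pose proof scale_pos; unfold encl in D2; cbn [snd] in D2; nra.
  - rewrite E. apply Rmult_le_compat_r; lra.
Qed.

Definition irat (a b c d : Z) : itv := (rdown (a * scale) b, rup (c * scale) d).

Lemma encl_irat a b c d x :
  (0 < b)%Z -> (0 < d)%Z -> IZR a / IZR b <= x <= IZR c / IZR d -> encl (irat a b c d) x.
Proof.
  intros Hb Hd [H1 H2]; unfold encl, irat; cbn [fst snd].
  pose proof (rdown_le (a * scale) b Hb) as D.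
  pose proof (rup_ge (c * scale) d Hd) as U.
  rewrite mult_IZR in D, U.
  apply IZR_lt in Hb; apply IZR_lt in Hd. pose proof scale_pos.
  assert (E1 : IZR a / IZR b * IZR b = IZR a) by (field; lra).
  assert (E2 : IZR c / IZR d * IZR d = IZR c) by (field; lra).
  pose proof (Rmult_le_compat_r (IZR b) _ _ ltac:(lra) H1) as G1.
  pose proof (Rmult_le_compat_r (IZR d) _ _ ltac:(lra) H2) as G2.
  rewrite E1 in G1; rewrite E2 in G2.
  split.
  - apply Rmult_le_reg_r with (IZR b); auto. eapply Rle_trans; [apply D|]. nra.
  - apply Rmult_le_reg_r with (IZR d); auto. eapply Rle_trans; [|apply U]. nra.
Qed.

Definition esum (t : Z * Z -> rexpr) (L : list (Z * Z)) : rexpr :=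
  fold_right EAdd (EInt 0) (map t L).

Lemma eval_esum env t L : eval env (esum t L) = lsum (fun v => eval env (t v)) L.
Proof.
  unfold esum, lsum; induction L; simpl; [lra|rewrite IHL; reflexivity].
Qed.

Definition esub (a b : rexpr) : rexpr := EAdd a (EOpp b).

(** * The lattice sums in real coordinates *)

Definition qf (x y : R) (v : Z * Z) : R :=
  (IZR (fst v) * x + IZR (snd v)) ^ 2 + (IZR (fst v) * y) ^ 2.

(* At [v = (0, 0)] the junk value [/ 0 = 0] makes the term vanish, as in [eps_term]. *)
Definition tm (s : nat) (x y : R) (v : Z * Z) : R := (y / qf x y v) ^ s.

Definition zs (s : nat) (x y : R) : R :=
  real (Lim_seq (fun N => lsum (tm s x y) (box N))).

Lemma has_sum_zs_unique s x y l : has_sum (tm s x y) l -> zs s x y = l.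
Proof.
  intro H; unfold zs; apply has_sum_box in H.
  rewrite (is_lim_seq_unique _ _ H); reflexivity.
Qed.

Lemma nrm_pos v : v <> (0, 0)%Z -> 1 <= IZR (nrm v).
Proof.
  intro H; apply IZR_le; destruct v as [m n]; unfold nrm; cbn [fst snd].
  assert (m <> 0 \/ n <> 0)%Z by (destruct (Z.eq_dec m 0), (Z.eq_dec n 0); subst; intuition congruence).
  lia.
Qed.

Lemma sqr_IZR_abs m : IZR (Z.abs m) ^ 2 = IZR m ^ 2.
Proof. rewrite abs_IZR, RPow_abs, Rabs_pos_eq; [reflexivity|apply pow2_ge_0]. Qed.

Lemma nrm_sqr_le v : IZR (nrm v) ^ 2 <= IZR (fst v) ^ 2 + IZR (snd v) ^ 2.
Proof.
  destruct v as [m n]; unfold nrm; cbn [fst snd].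
  pose proof (pow2_ge_0 (IZR m)); pose proof (pow2_ge_0 (IZR n)).
  destruct (Z.max_spec (Z.abs m) (Z.abs n)) as [[_ ->]|[_ ->]]; rewrite sqr_IZR_abs; lra.
Qed.

Lemma nrm_abs_le v : Rabs (IZR (fst v)) <= IZR (nrm v) /\ Rabs (IZR (snd v)) <= IZR (nrm v).
Proof.
  destruct v as [m n]; unfold nrm; cbn [fst snd].
  rewrite <- !abs_IZR; split; apply IZR_le; lia.
Qed.

(** A lower bound for [qf] on the unit circle of [(m, n)]: from [n = (m x + n) - m x] follows
    [n^2 <= 2 (m x + n)^2 + 2 x^2 m^2], and [m^2] is [(m y)^2 / y^2]. *)
Definition qmin (x y : R) : R := / (2 + (2 * x ^ 2 + 1) / y ^ 2).

Lemma qmin_pos x y : 0 < y -> 0 < qmin x y.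
Proof.
  intro Hy; apply Rinv_0_lt_compat.
  assert (0 < (2 * x ^ 2 + 1) / y ^ 2); [|lra].
  apply Rdiv_lt_0_compat; [pose proof (pow2_ge_0 x); lra|apply pow_lt, Hy].
Qed.

Lemma qf_ge_nrm x y v : 0 < y -> qmin x y * IZR (nrm v) ^ 2 <= qf x y v.
Proof.
  intro Hy. eapply Rle_trans.
  { apply Rmult_le_compat_l; [left; apply qmin_pos, Hy|apply nrm_sqr_le]. }
  destruct v as [m n]; unfold qf, qmin; cbn [fst snd].
  set (a := IZR m); set (b := IZR n).
  assert (Hp : 0 < 2 + (2 * x ^ 2 + 1) / y ^ 2).
  { pose proof (qmin_pos x y Hy) as H; unfold qmin in H.
    rewrite <- Rinv_inv; apply Rinv_0_lt_compat, H. }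
  apply Rmult_le_reg_l with (2 + (2 * x ^ 2 + 1) / y ^ 2); [assumption|].
  rewrite <- Rmult_assoc, Rinv_r, Rmult_1_l by lra.
  assert (E : (2 + (2 * x ^ 2 + 1) / y ^ 2) * ((a * x + b) ^ 2 + (a * y) ^ 2) =
    2 * (a * x + b) ^ 2 + (2 * x ^ 2 + 1) * a ^ 2 + 2 * (a * y) ^ 2
    + (2 * x ^ 2 + 1) / y ^ 2 * (a * x + b) ^ 2) by (field; lra).
  rewrite E.
  assert (0 <= (2 * x ^ 2 + 1) / y ^ 2 * (a * x + b) ^ 2).
  { apply Rmult_le_pos; [apply Rdiv_le_0_compat|]; try apply pow2_ge_0;
      [pose proof (pow2_ge_0 x); lra|apply pow_lt, Hy]. }
  pose proof (pow2_ge_0 (2 * a * x + b)). pose proof (pow2_ge_0 (a * y)). nra.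
Qed.

Lemma qf_pos x y v : 0 < y -> v <> (0, 0)%Z -> 0 < qf x y v.
Proof.
  intros Hy Hv; eapply Rlt_le_trans; [|apply (qf_ge_nrm x y v Hy)].
  apply Rmult_lt_0_compat; [apply qmin_pos, Hy|].
  apply pow_lt; pose proof (nrm_pos v Hv); lra.
Qed.

Lemma qf_nonneg x y v : 0 <= qf x y v.
Proof. unfold qf; pose proof (pow2_ge_0 (IZR (fst v) * x + IZR (snd v))); pose proof (pow2_ge_0 (IZR (fst v) * y)); lra. Qed.

Lemma div_nonneg a b : 0 <= a -> 0 <= b -> 0 <= a / b.
Proof.
  intros Ha [Hb|<-]; [apply Rdiv_le_0_compat; assumption|].
  unfold Rdiv; rewrite Rinv_0; lra.
Qed.

Lemma tm_nonneg s x y v : 0 < y -> 0 <= tm s x y v.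
Proof. intro Hy; apply pow_le, div_nonneg; [lra|apply qf_nonneg]. Qed.

Lemma tm_zero s x y : tm (S s) x y (0, 0)%Z = 0.
Proof.
  unfold tm, qf; cbn [fst snd].
  replace ((0 * x + 0) ^ 2 + (0 * y) ^ 2) with 0 by ring.
  unfold Rdiv; rewrite Rinv_0, Rmult_0_r; apply pow_ne_zero; lia.
Qed.

Lemma inv_pow_le_4 a s : 1 <= a -> / (a ^ 2) ^ S (S s) <= / a ^ 4.
Proof.
  intro Ha; apply Rinv_le_contravar; [apply pow_lt; lra|].
  rewrite <- pow_mult; apply Rle_pow; [assumption|lia].
Qed.

Lemma tm_le s x y v : 0 < y -> v <> (0, 0)%Z ->
  tm (S (S s)) x y v <= (y / qmin x y) ^ S (S s) / IZR (nrm v) ^ 4.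
Proof.
  intros Hy Hv; unfold tm.
  pose proof (nrm_pos v Hv) as Hn. pose proof (qmin_pos x y Hy) as Hc.
  apply Rle_trans with ((y / (qmin x y * IZR (nrm v) ^ 2)) ^ S (S s)).
  - apply pow_incr; split; [apply div_nonneg; [lra|apply qf_nonneg]|].
    apply Rmult_le_compat_l; [lra|].
    apply Rinv_le_contravar; [|apply qf_ge_nrm, Hy].
    apply Rmult_lt_0_compat; [assumption|apply pow_lt; lra].
  - replace (y / (qmin x y * IZR (nrm v) ^ 2)) with (y / qmin x y * / (IZR (nrm v) ^ 2))
      by (field; split; lra).
    rewrite Rpow_mult_distr, pow_inv.
    apply Rmult_le_compat_l; [apply pow_le, div_nonneg; lra|].
    apply inv_pow_le_4, Hn.
Qed.

Lemma zs_sum s x y : 0 < y -> has_sum (tm (S (S s)) x y) (zs (S (S s)) x y).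
Proof.
  intro Hy.
  destruct (summable4 (tm (S (S s)) x y) ((y / qmin x y) ^ S (S s))) as [l Hl].
  - apply pow_le, div_nonneg; [lra|left; apply qmin_pos, Hy].
  - intros v Hv; rewrite Rabs_pos_eq by (apply tm_nonneg, Hy). apply tm_le; assumption.
  - rewrite (has_sum_zs_unique _ _ _ _ Hl); assumption.
Qed.

Lemma zs_nonneg s x y : 0 < y -> 0 <= zs (S (S s)) x y.
Proof.
  intro Hy; apply (has_sum_ge _ _ _ [] (zs_sum s x y Hy)).
  intros L _ _; apply lsum_nonneg; intros; apply tm_nonneg, Hy.
Qed.

Lemma Cmod_qf (z : C) m n :
  Cmod (IZR m * z + IZR n)%C ^ 2 = qf (Re z) (Im z) (m, n).
Proof.
  unfold qf, Cmod. rewrite <- Rsqr_pow2, Rsqr_sqrt.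
  - destruct z as [x y]; cbn; ring.
  - apply Rplus_le_le_0_compat; apply pow2_ge_0.
Qed.

Lemma zeta_zs s (z : C) : 0 < Im z ->
  zeta (INR (S (S s))) z = zs (S (S s)) (Re z) (Im z).
Proof.
  intro Hy. unfold zeta. apply (f_equal real), Lim_seq_ext.
  intro N. change (lsum (eps_term (INR (S (S s))) z) (box N) = lsum (tm (S (S s)) (Re z) (Im z)) (box N)).
  apply lsum_ext_in; intros [m n] _. unfold eps_term.
  destruct ((m =? 0)%Z && (n =? 0)%Z)%bool eqn:E.
  - apply andb_prop in E; destruct E as [E1 E2].
    apply Z.eqb_eq in E1; apply Z.eqb_eq in E2; subst. symmetry; apply tm_zero.
  - assert (Hv : (m, n) <> (0, 0)%Z) by (intro H; injection H as -> ->; discriminate).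
    pose proof (Cmod_qf z m n) as Hq. pose proof (qf_pos (Re z) (Im z) (m, n) Hy Hv) as Hp.
    set (w := Cmod _) in *.
    assert (Hw : 0 < w).
    { destruct (Cmod_ge_0 (IZR m * z + IZR n)%C) as [H|H]; [assumption|].
      fold w in H; rewrite <- H in Hq; lra. }
    replace (2 * INR (S (S s))) with (INR (2 * S (S s))) by (rewrite mult_INR; reflexivity).
    rewrite !Rpower_pow by assumption. rewrite pow_mult, Hq; unfold tm, Rdiv.
    rewrite Rpow_mult_distr, pow_inv; reflexivity.
Qed.

(** * Invariance under the modular group *)

Definition fm (x y : R) (v : Z * Z) : R := qf x y v / y.

Lemma tm_fm s x y v : tm s x y v = (/ fm x y v) ^ s.
Proof. unfold tm, fm; f_equal. rewrite Rinv_div; reflexivity. Qed.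

(** Linearity of the bijection is not recorded: equality of the forms after reindexing is all that
    the sums see. *)
Definition equivalent (x y x' y' : R) : Prop :=
  exists sg ta, (forall v, sg (ta v) = v) /\ (forall v, ta (sg v) = v) /\
    forall v, fm x' y' v = fm x y (sg v).

Lemma equivalent_trans x y x1 y1 x2 y2 :
  equivalent x y x1 y1 -> equivalent x1 y1 x2 y2 -> equivalent x y x2 y2.
Proof.
  intros (s & t & A & B & E) (s' & t' & A' & B' & E').
  exists (fun v => s (s' v)), (fun v => t' (t v)); split; [|split].
  - intro v; rewrite A'; apply A.
  - intro v; rewrite B; apply B'.
  - intro v; rewrite E'; apply E.
Qed.

Lemma zs_equivalent s x y x' y' : 0 < y -> equivalent x y x' y' ->
  zs (S (S s)) x' y' = zs (S (S s)) x y.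
Proof.
  intros Hy (sg & ta & A & B & E). apply has_sum_zs_unique.
  eapply has_sum_ext; [|apply (has_sum_reindex sg ta _ _ A B (zs_sum s x y Hy))].
  intro v; cbv beta; rewrite !tm_fm, E; reflexivity.
Qed.

Lemma equivalent_opp x y : equivalent x y (- x) y.
Proof.
  exists (fun v => (fst v, - snd v)%Z), (fun v => (fst v, - snd v)%Z); split; [|split].
  1, 2: intros [m n]; cbn; f_equal; lia.
  intros [m n]; unfold fm, qf; cbn [fst snd]; rewrite opp_IZR; f_equal; ring.
Qed.

Lemma equivalent_shift x y k : equivalent x y (x + IZR k) y.
Proof.
  exists (fun v => (fst v, snd v + k * fst v)%Z), (fun v => (fst v, snd v - k * fst v)%Z);
    split; [|split].
  1, 2: intros [m n]; cbn; f_equal; lia.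
  intros [m n]; unfold fm, qf; cbn [fst snd]; rewrite plus_IZR, mult_IZR; f_equal; ring.
Qed.

Lemma equivalent_mobius x y a b c d : 0 < y -> (a * d - b * c = 1)%Z ->
  let q := qf x y (c, d) in
  equivalent x y
    (((IZR a * x + IZR b) * (IZR c * x + IZR d) + IZR a * IZR c * y ^ 2) / q) (y / q).
Proof.
  intros Hy Hdet q.
  assert (Hq : 0 < q).
  { apply qf_pos; [assumption|]. intro E; injection E as -> ->; lia. }
  exists (fun v => (fst v * a + snd v * c, fst v * b + snd v * d)%Z),
    (fun v => (fst v * d - snd v * c, snd v * a - fst v * b)%Z); split; [|split].
  1, 2: intros [m n]; cbn [fst snd]; f_equal;
    [transitivity (m * (a * d - b * c))%Z|transitivity (n * (a * d - b * c))%Z];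
    (ring || (rewrite Hdet; ring)).
  intros [m n]; unfold fm, qf; cbn [fst snd].
  rewrite !plus_IZR, !mult_IZR.
  assert (D : IZR a * IZR d - IZR b * IZR c = 1) by (rewrite <- !mult_IZR, <- minus_IZR, Hdet; reflexivity).
  assert (Eq : q = (IZR c * x + IZR d) ^ 2 + (IZR c * y) ^ 2) by reflexivity.
  revert D Eq Hq; generalize q, (IZR a), (IZR b), (IZR c), (IZR d), (IZR m), (IZR n).
  clear - Hy; intros q a b c d m n D Eq Hq.
  (* [|a z + b|^2 |c z + d|^2] is [w^2 + y^2], where [w] is the real part of [a z + b] times the
     conjugate of [c z + d]; the imaginary part is [y] because the determinant is one. *)
  assert (I : (a * x + b) ^ 2 + (a * y) ^ 2 =
    ((((a * x + b) * (c * x + d) + a * c * y ^ 2)) ^ 2 + y ^ 2) / q).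
  { apply Rmult_eq_reg_r with q; [|lra]. unfold Rdiv; rewrite Rmult_assoc, Rinv_l, Rmult_1_r by lra.
    rewrite Eq. transitivity (((a * x + b) * (c * x + d) + a * c * y ^ 2) ^ 2 + (a * d - b * c) ^ 2 * y ^ 2);
      [ring|rewrite D; ring]. }
  set (w := (a * x + b) * (c * x + d) + a * c * y ^ 2) in *.
  replace (((m * a + n * c) * x + (m * b + n * d)) ^ 2 + ((m * a + n * c) * y) ^ 2)
    with (m ^ 2 * ((a * x + b) ^ 2 + (a * y) ^ 2) + 2 * m * n * w + n ^ 2 * q)
    by (rewrite Eq; unfold w; ring).
  rewrite I; field; lra.
Qed.

Definition reduced (x y : R) : Prop := 0 < y /\ 0 <= x <= 1 / 2 /\ 1 <= x ^ 2 + y ^ 2.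

Lemma list_argmin (f : Z * Z -> R) (L : list (Z * Z)) u :
  exists w, In w (u :: L) /\ forall v, In v (u :: L) -> f w <= f v.
Proof.
  revert u; induction L as [|a L IH]; intro u.
  - exists u; split; [left; reflexivity|]. intros v [<-|[]]; lra.
  - destruct (IH a) as (w & Hw & Hm).
    destruct (Rle_dec (f u) (f w)) as [H|H].
    + exists u; split; [left; reflexivity|]. intros v [<-|Hv]; [lra|].
      specialize (Hm v Hv); lra.
    + exists w; split; [right; assumption|]. intros v [<-|Hv]; [lra|auto].
Qed.

(** Outside a large box the form is at least its value [1] at [(0, 1)], so the search is finite. *)
Lemma qf_minimum x y : 0 < y ->
  exists w, w <> (0, 0)%Z /\ forall v, v <> (0, 0)%Z -> qf x y w <= qf x y v.
Proof.
  intro Hy. pose proof (qmin_pos x y Hy) as Hc.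
  destruct (archimed_cor1 (qmin x y) Hc) as (N & HN & HN0).
  destruct (list_argmin (qf x y) (lminus (box N) [(0, 0)%Z]) (0, 1)%Z) as (w & Hw & Hm).
  exists w; split.
  - destruct Hw as [<-|Hw]; [congruence|]. apply In_lminus in Hw.
    intro E; apply (proj2 Hw); left; auto.
  - intros v Hv. destruct (Z_le_gt_dec (nrm v) (Z.of_nat N)) as [H|H].
    + apply Hm; right; apply In_lminus; split; [apply In_box, H|].
      intros [E|[]]; congruence.
    + apply Rle_trans with 1.
      { replace 1 with (qf x y (0, 1)%Z) by (unfold qf; cbn [fst snd]; ring).
        apply Hm; left; reflexivity. }
      eapply Rle_trans; [|apply (qf_ge_nrm x y v Hy)].
      assert (H1 : INR N <= IZR (nrm v)) by (rewrite INR_IZR_INZ; apply IZR_le; lia).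
      assert (H2 : 1 <= INR N) by (apply (le_INR 1); lia).
      assert (1 <= qmin x y * INR N).
      { apply Rmult_le_reg_r with (/ INR N); [apply Rinv_0_lt_compat; lra|].
        rewrite Rmult_assoc, Rinv_r by lra; lra. }
      simpl. nra.
Qed.

Lemma qf_scale x y g v : qf x y (g * fst v, g * snd v)%Z = IZR g ^ 2 * qf x y v.
Proof. unfold qf; cbn [fst snd]; rewrite !mult_IZR; ring. Qed.

(** A shortest vector serves as the bottom row [(c, d)]; it is primitive, since division by the gcd
    would shorten it. Translation and reflection put the real part into [[0, 1/2]], and [|z| >= 1]
    is the minimality of [(c, d)] against the vector that corresponds to [(1, 0)]. *)
Lemma equivalent_reduced x y : 0 < y ->
  exists x' y', reduced x' y' /\ equivalent x y x' y'.
Proof.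
  intro Hy. destruct (qf_minimum x y Hy) as ([c d] & Hw & Hm).
  assert (Hg : Z.gcd c d = 1%Z).
  { pose proof (Z.gcd_nonneg c d) as G0.
    destruct (Z.gcd_divide_l c d) as [c' Hc], (Z.gcd_divide_r c d) as [d' Hd].
    set (g := Z.gcd c d) in *.
    assert (Hg0 : g <> 0%Z) by (intro E; rewrite E in Hc, Hd; apply Hw; f_equal; lia).
    assert (Hv : (c', d') <> (0, 0)%Z) by (intro E; injection E as -> ->; apply Hw; f_equal; lia).
    pose proof (Hm _ Hv) as H. pose proof (qf_pos x y _ Hy Hv) as Hp.
    replace (c, d) with (g * fst (c', d'), g * snd (c', d'))%Z in H by (cbn; f_equal; lia).
    rewrite qf_scale in H.
    assert (IZR g < 2) by (apply Rnot_le_lt; intro; assert (4 <= IZR g ^ 2) by nra; nra).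
    apply lt_IZR in H0. lia. }
  destruct (Z.gcd_bezout c d 1 Hg) as (u & t & Hut).
  assert (Hdet : (t * d - (- u) * c = 1)%Z) by lia.
  pose proof (equivalent_mobius x y t (- u) c d Hy Hdet) as E1; cbv zeta in E1.
  set (q := qf x y (c, d)) in *.
  assert (Hq : 0 < q) by (apply qf_pos; assumption).
  set (x1 := _ / q) in E1.
  set (k := (- up (x1 - 1 / 2))%Z).
  assert (Hk : -1 / 2 <= x1 + IZR k <= 1 / 2).
  { unfold k; rewrite opp_IZR. destruct (archimed (x1 - 1 / 2)); lra. }
  pose proof (equivalent_trans _ _ _ _ _ _ E1 (equivalent_shift x1 (y / q) k)) as E2.
  assert (Hy' : 0 < y / q) by (apply Rdiv_lt_0_compat; assumption).
  assert (N : forall x', equivalent x y x' (y / q) -> 1 <= x' ^ 2 + (y / q) ^ 2).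
  { intros x' (sg & ta & A & B & E).
    assert (Hs : sg (1, 0)%Z <> (0, 0)%Z).
    { intro Z0. assert (F : fm x' (y / q) (1, 0)%Z = 0).
      { rewrite E, Z0; unfold fm, qf; cbn [fst snd]; unfold Rdiv; ring. }
      assert (0 < fm x' (y / q) (1, 0)%Z); [|lra].
      apply Rdiv_lt_0_compat; [apply qf_pos; [assumption|congruence]|assumption]. }
    specialize (E (1, 0)%Z). specialize (Hm _ Hs).
    assert (F : fm x' (y / q) (1, 0)%Z = (x' ^ 2 + (y / q) ^ 2) * (q / y)).
    { unfold fm, qf; cbn [fst snd]; field; lra. }
    rewrite F in E. unfold fm in E.
    assert (H1 : q / y <= (x' ^ 2 + (y / q) ^ 2) * (q / y)).
    { rewrite E; apply Rmult_le_compat_r; [left; apply Rinv_0_lt_compat, Hy|exact Hm]. }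
    assert (H2 : 0 < q / y) by (apply Rdiv_lt_0_compat; assumption). nra. }
  destruct (Rle_dec 0 (x1 + IZR k)) as [H0|H0].
  - exists (x1 + IZR k), (y / q); split; [|assumption].
    split; [assumption|]. split; [lra|]. apply N; assumption.
  - exists (- (x1 + IZR k)), (y / q).
    pose proof (equivalent_trans _ _ _ _ _ _ E2 (equivalent_opp (x1 + IZR k) (y / q))) as E3.
    split; [|assumption]. split; [assumption|]. split; [lra|]. apply N; assumption.
Qed.

(** * Continuity *)

(** The relative error is uniform in [v], so every term of the series, and with it the sum, changes
    at most by a common factor near one. *)
Lemma qf_close x y eta : 0 < y -> 0 < eta ->
  exists delta, 0 < delta /\ forall x' y', Rabs (x' - x) < delta -> Rabs (y' - y) < delta ->
  forall v, Rabs (qf x' y' v - qf x y v) <= eta * qf x y v.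
Proof.
  intros Hy He. pose proof (qmin_pos x y Hy) as Hc.
  set (K := 2 * Rabs x + 2 * y + 4).
  assert (HK : 0 < K) by (unfold K; pose proof (Rabs_pos x); lra).
  exists (Rmin 1 (eta * qmin x y / K)); split.
  { apply Rmin_pos; [lra|]. apply Rdiv_lt_0_compat; [apply Rmult_lt_0_compat|]; assumption. }
  intros x' y' Hx' Hy' v.
  set (e := Rmin 1 (eta * qmin x y / K)) in *.
  assert (He1 : e <= 1) by apply Rmin_l.
  assert (He2 : e * K <= eta * qmin x y).
  { apply Rmult_le_reg_r with (/ K); [apply Rinv_0_lt_compat, HK|].
    rewrite Rmult_assoc, Rinv_r, Rmult_1_r by lra. apply Rmin_r. }
  pose proof (qf_ge_nrm x y v Hy) as Hq.
  destruct (nrm_abs_le v) as [Hm Hn].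
  destruct v as [m n]; unfold qf at 1 2; cbn [fst snd] in *.
  set (a := IZR m) in *; set (b := IZR n) in *; set (r := IZR (nrm (m, n))) in *.
  replace ((a * x' + b) ^ 2 + (a * y') ^ 2 - ((a * x + b) ^ 2 + (a * y) ^ 2)) with
    (a * (x' - x) * (a * (x' + x) + 2 * b) + a * (a * ((y' - y) * (y' + y)))) by ring.
  assert (Hr : 0 <= r) by (pose proof (Rabs_pos a); lra).
  assert (B1 : Rabs (x' + x) <= 2 * Rabs x + 1).
  { replace (x' + x) with ((x' - x) + (x + x)) by ring.
    pose proof (Rabs_triang (x' - x) (x + x)); pose proof (Rabs_triang x x); lra. }
  assert (B2 : Rabs (y' + y) <= 2 * y + 1).
  { replace (y' + y) with ((y' - y) + (y + y)) by ring.
    pose proof (Rabs_triang (y' - y) (y + y)).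
    rewrite (Rabs_pos_eq (y + y)) in H by lra. lra. }
  eapply Rle_trans; [apply Rabs_triang|]. rewrite !Rabs_mult.
  assert (B3 : Rabs (a * (x' + x) + 2 * b) <= r * (2 * Rabs x + 3)).
  { eapply Rle_trans; [apply Rabs_triang|]. rewrite !Rabs_mult, (Rabs_pos_eq 2) by lra.
    pose proof (Rmult_le_compat _ _ _ _ (Rabs_pos a) (Rabs_pos (x' + x)) Hm B1). lra. }
  assert (C1 : Rabs a * Rabs (x' - x) <= r * e) by (apply Rmult_le_compat; try apply Rabs_pos; lra).
  assert (C2 : Rabs a * Rabs (x' - x) * Rabs (a * (x' + x) + 2 * b) <= r * e * (r * (2 * Rabs x + 3))).
  { apply Rmult_le_compat; auto; [apply Rmult_le_pos|]; apply Rabs_pos. }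
  assert (C3 : Rabs (y' - y) * Rabs (y' + y) <= e * (2 * y + 1)) by (apply Rmult_le_compat; try apply Rabs_pos; lra).
  assert (C4 : Rabs a * (Rabs (y' - y) * Rabs (y' + y)) <= r * (e * (2 * y + 1))).
  { apply Rmult_le_compat; auto; [apply Rabs_pos|apply Rmult_le_pos; apply Rabs_pos]. }
  assert (C5 : Rabs a * (Rabs a * (Rabs (y' - y) * Rabs (y' + y))) <= r * (r * (e * (2 * y + 1)))).
  { apply Rmult_le_compat; auto; [apply Rabs_pos|].
    apply Rmult_le_pos; [apply Rabs_pos|apply Rmult_le_pos; apply Rabs_pos]. }
  apply Rle_trans with (e * K * r ^ 2); [unfold K; nra|].
  apply Rle_trans with (eta * qmin x y * r ^ 2).
  - apply Rmult_le_compat_r; [apply pow2_ge_0|assumption].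
  - rewrite Rmult_assoc; apply Rmult_le_compat_l; [lra|]. exact Hq.
Qed.

Lemma zs_continuous s x y eps : 0 < y -> 0 < eps ->
  exists delta, 0 < delta /\ forall x' y', Rabs (x' - x) < delta -> Rabs (y' - y) < delta ->
  Rabs (zs (S (S s)) x' y' - zs (S (S s)) x y) < eps.
Proof.
  intros Hy He. set (k := S (S s)). set (Z := zs k x y).
  assert (HZ : 0 <= Z) by (apply zs_nonneg, Hy).
  (* [(1 + eta) / (1 - eta)] is the factor gained when both [y] and the form vary by the relative
     amount [eta]. *)
  assert (HR : exists eta, 0 < eta < 1 /\ ((1 + eta) / (1 - eta)) ^ k < 1 + eps / (Z + 1)).
  { assert (C : continuity_pt (fun t => ((1 + t) / (1 - t)) ^ k) 0).
    { apply derivable_continuous_pt. apply ex_derive_Reals_0. auto_derive. lra. }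
    destruct (C (eps / (Z + 1))) as (d & Hd & HC); [apply Rdiv_lt_0_compat; lra|].
    exists (Rmin (1 / 2) (d / 2)).
    assert (Hm : 0 < Rmin (1 / 2) (d / 2)) by (apply Rmin_pos; lra).
    assert (Hm1 := Rmin_l (1 / 2) (d / 2)). assert (Hm2 := Rmin_r (1 / 2) (d / 2)).
    split; [lra|].
    specialize (HC (Rmin (1 / 2) (d / 2))). simpl in HC. unfold Rdist in HC.
    cut (Rabs (((1 + Rmin (1 / 2) (d / 2)) / (1 - Rmin (1 / 2) (d / 2))) ^ k - ((1 + 0) / (1 - 0)) ^ k) < eps / (Z + 1)).
    - replace (((1 + 0) / (1 - 0)) ^ k) with 1.
      + intro H; apply Rabs_def2 in H; lra.
      + replace ((1 + 0) / (1 - 0)) with 1 by field. symmetry; apply pow1.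
    - apply HC; split; [split; [exact I|lra]|].
      rewrite Rminus_0_r, Rabs_pos_eq; lra. }
  destruct HR as (eta & Heta & HR).
  set (r := (1 + eta) / (1 - eta)) in *.
  assert (Hr : 1 <= r).
  { unfold r; apply Rmult_le_reg_r with (1 - eta); [lra|].
    unfold Rdiv; rewrite Rmult_assoc, Rinv_l; lra. }
  destruct (qf_close x y eta Hy ltac:(lra)) as (d & Hd & Hclose).
  exists (Rmin d (eta * y)); split.
  { apply Rmin_pos; [assumption|apply Rmult_lt_0_compat; lra]. }
  intros x' y' Hx' Hy'.
  assert (Hx1 : Rabs (x' - x) < d) by (eapply Rlt_le_trans; [exact Hx'|apply Rmin_l]).
  assert (Hy1 : Rabs (y' - y) < d) by (eapply Rlt_le_trans; [exact Hy'|apply Rmin_l]).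
  assert (Hy2 : Rabs (y' - y) < eta * y) by (eapply Rlt_le_trans; [exact Hy'|apply Rmin_r]).
  apply Rabs_def2 in Hy2. assert (Hyp : 0 < y') by nra.
  specialize (Hclose x' y' Hx1 Hy1).
  assert (T : forall v, tm k x' y' v <= r ^ k * tm k x y v /\ tm k x y v <= r ^ k * tm k x' y' v).
  { intro v. destruct (pair_eq_dec v (0, 0)%Z) as [->|Hv].
    { unfold k; rewrite !tm_zero; lra. }
    pose proof (qf_pos x y v Hy Hv) as Q. pose proof (qf_pos x' y' v Hyp Hv) as Q'.
    specialize (Hclose v). apply Rabs_le_between in Hclose.
    unfold tm; rewrite <- !Rpow_mult_distr; split; apply pow_incr;
      (split; [apply div_nonneg; lra|]).
    - apply Rmult_le_reg_r with (qf x' y' v); [assumption|].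
      apply Rmult_le_reg_r with (qf x y v * (1 - eta)); [nra|].
      replace (y' / qf x' y' v * qf x' y' v * (qf x y v * (1 - eta))) with (y' * (qf x y v * (1 - eta))) by (field; lra).
      replace (r * (y / qf x y v) * qf x' y' v * (qf x y v * (1 - eta))) with ((1 + eta) * y * qf x' y' v)
        by (unfold r; field; lra).
      apply Rmult_le_compat; nra.
    - apply Rmult_le_reg_r with (qf x' y' v); [assumption|].
      apply Rmult_le_reg_r with (qf x y v * (1 - eta)); [nra|].
      replace (y / qf x y v * qf x' y' v * (qf x y v * (1 - eta))) with (y * (1 - eta) * qf x' y' v) by (field; lra).
      replace (r * (y' / qf x' y' v) * qf x' y' v * (qf x y v * (1 - eta))) with (y' * ((1 + eta) * qf x y v))
        by (unfold r; field; lra).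
      apply Rmult_le_compat; nra. }
  assert (U1 : zs k x' y' <= r ^ k * Z).
  { apply (has_sum_le (tm k x' y') (fun v => r ^ k * tm k x y v)); [apply T|apply zs_sum, Hyp|].
    apply has_sum_scal, zs_sum, Hy. }
  assert (U2 : Z <= r ^ k * zs k x' y').
  { apply (has_sum_le (tm k x y) (fun v => r ^ k * tm k x' y' v)); [apply T|apply zs_sum, Hy|].
    apply has_sum_scal, zs_sum, Hyp. }
  assert (Hrk : 1 <= r ^ k) by (apply pow_R1_Rle, Hr).
  assert (HZ' : 0 <= zs k x' y') by (apply zs_nonneg, Hyp).
  assert (W : (r ^ k - 1) * Z < eps).
  { apply Rle_lt_trans with (eps / (Z + 1) * Z).
    - apply Rmult_le_compat_r; lra.
    - replace eps with (eps / (Z + 1) * (Z + 1)) at 2 by (field; lra).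
      apply Rmult_lt_compat_l; [apply Rdiv_lt_0_compat; lra|lra]. }
  fold Z. apply Rabs_def1; nra.
Qed.

(** * Halving by the symmetry [v -> - v], and expressions for the arc sums *)

Definition pos_half (v : Z * Z) : bool :=
  let (m, n) := v in ((0 <? m)%Z || ((m =? 0)%Z && (0 <? n)%Z))%bool.
Definition half (N : nat) : list (Z * Z) := filter pos_half (box N).

Definition ex : rexpr := EVar 0.
Definition eW_num (v : Z * Z) (x : rexpr) : rexpr :=
  let (m, n) := v in EAdd (EMul (EInt (m * m + n * n)) x) (EInt (2 * m * n)).
Definition eW_den (v : Z * Z) (x : rexpr) : rexpr :=
  let (m, n) := v in EAdd (EInt (m * m + n * n)) (EMul (EInt (2 * m * n)) x).
Definition eW (s : nat) (v : Z * Z) : rexpr :=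
  ELet (EInv (eW_den v (EVar 0)))
    (EMul (EMul (eW_num v (EVar 1)) (EVar 0)) (EPow (EVar 0) s)).
Definition ep : rexpr :=
  EMul (EMul (esub (EInt 1) (EPow ex 2)) (esub (ECst 18649 10000) (EPow ex 2))) (ECst 100 186).
(** Half of [wgap] below, truncated to boxes of radius [6] for the exponent [3] and of radius [2]
    for the rapidly decaying exponent [6]. *)
Definition eG : rexpr :=
  EAdd (EMul (ECst 13 4) (esum (eW 3) (half 6)))
    (EMul (EMul (EInt (-2)) ep) (esum (eW 6) (half 2))).

Definition zopp (v : Z * Z) : Z * Z := (- fst v, - snd v)%Z.

Lemma lsum_half f N : f (0, 0)%Z = 0 -> (forall v, f (zopp v) = f v) ->
  lsum f (box N) = 2 * lsum f (half N).
Proof.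
  intros H0 Hf.
  assert (P : Permutation (box N) ((0, 0)%Z :: half N ++ map zopp (half N))).
  { assert (Hh : forall v, In v (half N) <-> (nrm v <= Z.of_nat N)%Z /\ pos_half v = true).
    { intro v; unfold half; rewrite filter_In, In_box; reflexivity. }
    assert (Ho : forall v, In v (map zopp (half N)) <-> In (zopp v) (half N)).
    { assert (Hinv : forall v, zopp (zopp v) = v) by (intros [m n]; unfold zopp; cbn; f_equal; lia).
      intro v; rewrite in_map_iff; split.
      - intros (u & <- & Hu); rewrite Hinv; assumption.
      - intro Hv; exists (zopp v); auto. }
    assert (Hd : forall v, pos_half v = true -> pos_half (zopp v) = true -> False).
    { intros [m n]; unfold pos_half, zopp; cbn [fst snd].
      destruct (Z.ltb_spec 0 m), (Z.ltb_spec 0 (- m)), (Z.eqb_spec m 0), (Z.eqb_spec (- m) 0),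
        (Z.ltb_spec 0 n), (Z.ltb_spec 0 (- n)); cbn; try discriminate; lia. }
    assert (Hn : forall v, nrm (zopp v) = nrm v) by (intros [m n]; unfold nrm, zopp; cbn [fst snd]; lia).
    apply NoDup_Permutation; [apply NoDup_box| |].
    - constructor.
      + intro H; apply in_app_or in H; rewrite Ho in H.
        destruct H as [H|H]; apply Hh in H; destruct H as [_ H]; discriminate.
      + apply NoDup_app.
        * apply NoDup_filter, NoDup_box.
        * apply FinFun.Injective_map_NoDup; [|apply NoDup_filter, NoDup_box].
          intros [m n] [m' n'] E; unfold zopp in E; cbn in E; injection E as E1 E2; f_equal; lia.
        * intros v Hv Hv'. apply Ho, Hh in Hv'. apply Hh in Hv. apply (Hd v); tauto.
    - intro v; cbn [In]; rewrite in_app_iff, Ho, !Hh, Hn, In_box.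
      destruct v as [m n]; unfold nrm, pos_half, zopp; cbn [fst snd].
      destruct (Z.ltb_spec 0 m), (Z.ltb_spec 0 (- m)), (Z.eqb_spec m 0), (Z.eqb_spec (- m) 0),
        (Z.ltb_spec 0 n), (Z.ltb_spec 0 (- n)); cbn; split; intro G; try lia; auto;
        try (left; f_equal; lia); destruct G as [G|[G|G]]; try (injection G as <- <-); try lia; tauto. }
  rewrite (lsum_perm f _ _ P). change (f (0, 0)%Z + lsum f (half N ++ map zopp (half N)) = 2 * lsum f (half N)).
  rewrite lsum_app, lsum_map, H0.
  rewrite (lsum_ext_in (fun v => f (zopp v)) f) by auto. ring.
Qed.

(** * The tangential derivative along the unit arc *)

Definition wnum (x : R) (v : Z * Z) : R :=
  (IZR (fst v) ^ 2 + IZR (snd v) ^ 2) * x + 2 * IZR (fst v) * IZR (snd v).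
Definition wden (x : R) (v : Z * Z) : R :=
  IZR (fst v) ^ 2 + IZR (snd v) ^ 2 + 2 * IZR (fst v) * IZR (snd v) * x.
(** For [|z| = 1] the form is [wden], and [wnum] is the sum of [m (m x + n)] and its image under
    exchange of [m] and [n]. The derivative of [y^s / wden^s] along the arc, with respect to [x], is
    [- s y^(s-2)] times this term. *)
Definition wt (s : nat) (x : R) (v : Z * Z) : R := wnum x v / wden x v * (/ wden x v) ^ s.
Definition ws (s : nat) (x : R) : R :=
  real (Lim_seq (fun N => lsum (wt s x) (box N))).

Lemma wden_ge x v : 0 <= x <= 1 / 2 -> 3 / 4 * IZR (nrm v) ^ 2 <= wden x v.
Proof.
  intro Hx. destruct v as [m n]; unfold wden, nrm; cbn [fst snd].
  set (a := IZR m); set (b := IZR n).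
  pose proof (pow2_ge_0 (a + b)); pose proof (pow2_ge_0 (a - b));
  pose proof (pow2_ge_0 (a + b / 2)); pose proof (pow2_ge_0 (b + a / 2)).
  pose proof (pow2_ge_0 a); pose proof (pow2_ge_0 b).
  destruct (Z.max_spec (Z.abs m) (Z.abs n)) as [[_ ->]|[_ ->]]; rewrite sqr_IZR_abs; fold a b;
    destruct (Rle_dec 0 (a * b)); nra.
Qed.

Lemma wden_pos x v : 0 <= x <= 1 / 2 -> v <> (0, 0)%Z -> 0 < wden x v.
Proof.
  intros Hx Hv; eapply Rlt_le_trans; [|apply wden_ge, Hx].
  pose proof (nrm_pos v Hv); assert (0 < IZR (nrm v) ^ 2) by (apply pow_lt; lra). lra.
Qed.

Lemma wnum_le x v : 0 <= x <= 1 / 2 -> Rabs (wnum x v) <= wden x v.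
Proof.
  intro Hx; unfold wnum, wden; set (a := IZR (fst v)); set (b := IZR (snd v)).
  pose proof (pow2_ge_0 (a + b)); pose proof (pow2_ge_0 (a - b)).
  apply Rabs_le; split; nra.
Qed.

Definition wbd (s : nat) (v : Z * Z) : R := (/ (3 / 4 * IZR (nrm v) ^ 2)) ^ s.

Lemma wden_inv_pow x v s : 0 <= x <= 1 / 2 -> v <> (0, 0)%Z ->
  0 <= (/ wden x v) ^ s <= wbd s v.
Proof.
  intros Hx Hv. pose proof (wden_pos x v Hx Hv) as H.
  assert (0 <= / wden x v) by (left; apply Rinv_0_lt_compat, H).
  split; [apply pow_le; assumption|].
  apply pow_incr; split; [assumption|].
  apply Rinv_le_contravar; [|apply wden_ge, Hx].
  pose proof (nrm_pos v Hv); assert (0 < IZR (nrm v) ^ 2) by (apply pow_lt; lra). lra.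
Qed.

Lemma wt_zero s x : wt s x (0, 0)%Z = 0.
Proof. unfold wt, wnum; cbn [fst snd]. unfold Rdiv; ring. Qed.

Lemma wt_le s x v : 0 <= x <= 1 / 2 -> v <> (0, 0)%Z -> Rabs (wt s x v) <= wbd s v.
Proof.
  intros Hx Hv. pose proof (wden_pos x v Hx Hv) as H.
  destruct (wden_inv_pow x v s Hx Hv) as [H1 H2].
  unfold wt; rewrite Rabs_mult, (Rabs_pos_eq _ H1).
  assert (Rabs (wnum x v / wden x v) <= 1).
  { unfold Rdiv; rewrite Rabs_mult, (Rabs_pos_eq (/ _)) by (left; apply Rinv_0_lt_compat, H).
    apply Rmult_le_reg_r with (wden x v); [assumption|].
    rewrite Rmult_assoc, Rinv_l by lra. pose proof (wnum_le x v Hx); lra. }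
  pose proof (Rabs_pos (wnum x v / wden x v)). nra.
Qed.

Lemma wt_lipschitz s x x' v : 0 <= x <= 1 / 2 -> 0 <= x' <= 1 / 2 ->
  Rabs (wt s x v - wt s x' v) <= (2 * INR s + 4) * wbd s v * Rabs (x - x').
Proof.
  intros Hx Hx'.
  assert (Hs : 0 <= INR s) by apply pos_INR.
  destruct (pair_eq_dec v (0, 0)%Z) as [->|Hv].
  { rewrite !wt_zero, Rminus_0_r, Rabs_R0. repeat apply Rmult_le_pos; try apply Rabs_pos; [lra|].
    apply pow_le. unfold nrm; cbn. rewrite !Rmult_0_l, Rmult_0_r, Rinv_0; lra. }
  set (S2 := IZR (fst v) ^ 2 + IZR (snd v) ^ 2). set (P2 := 2 * IZR (fst v) * IZR (snd v)).
  set (d := fun t => (/ wden t v) ^ s * (S2 / wden t v - (INR s + 1) * (wnum t v / wden t v) * (P2 / wden t v))).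
  assert (HD : forall t, 0 <= t <= 1 / 2 -> is_derive (fun t => wt s t v) t (d t)).
  { intros t Ht. pose proof (wden_pos t v Ht Hv) as H. unfold wt, d. revert H.
    unfold wnum, wden; fold S2 P2; intro H.
    auto_derive; [split; [lra|split; [lra|exact I]]|].
    destruct s as [|s]; [simpl; field; lra|].
    replace (Init.Nat.pred (S s)) with s by reflexivity. rewrite !S_INR. simpl pow. field; lra. }
  assert (HB : forall t, 0 <= t <= 1 / 2 -> Rabs (d t) <= (2 * INR s + 4) * wbd s v).
  { intros t Ht. pose proof (wden_pos t v Ht Hv) as H.
    destruct (wden_inv_pow t v s Ht Hv) as [H1 H2]. unfold d.
    rewrite Rabs_mult, (Rabs_pos_eq _ H1).
    assert (N : Rabs (wnum t v / wden t v) <= 1).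
    { unfold Rdiv; rewrite Rabs_mult, (Rabs_pos_eq (/ _)) by (left; apply Rinv_0_lt_compat, H).
      apply Rmult_le_reg_r with (wden t v); [assumption|].
      rewrite Rmult_assoc, Rinv_l by lra. pose proof (wnum_le t v Ht); lra. }
    assert (E1 : 0 <= S2 / wden t v <= 2 /\ Rabs (P2 / wden t v) <= 2).
    { assert (Q : 0 <= S2 <= 2 * wden t v /\ Rabs P2 <= 2 * wden t v).
      { unfold wden; fold S2 P2. unfold S2, P2. set (a := IZR (fst v)); set (b := IZR (snd v)).
        pose proof (pow2_ge_0 (a + b)); pose proof (pow2_ge_0 (a - b)).
        pose proof (pow2_ge_0 a); pose proof (pow2_ge_0 b).
        split; [nra|apply Rabs_le; nra]. }
      unfold Rdiv; rewrite Rabs_mult, (Rabs_pos_eq (/ _)) by (left; apply Rinv_0_lt_compat, H).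
      repeat split.
      - apply Rmult_le_pos; [lra|left; apply Rinv_0_lt_compat, H].
      - apply Rmult_le_reg_r with (wden t v); [assumption|]. rewrite Rmult_assoc, Rinv_l; lra.
      - apply Rmult_le_reg_r with (wden t v); [assumption|]. rewrite Rmult_assoc, Rinv_l; lra. }
    destruct E1 as [E1 E2].
    (* [2 + (s + 1) * 1 * 2 = 2 s + 4]. *)
    assert (F : Rabs (S2 / wden t v - (INR s + 1) * (wnum t v / wden t v) * (P2 / wden t v)) <= 2 * INR s + 4).
    { eapply Rle_trans; [apply Rabs_triang|]. rewrite Rabs_Ropp, !Rabs_mult.
      rewrite (Rabs_pos_eq (S2 / _)), (Rabs_pos_eq (INR s + 1)) by lra.
      pose proof (Rmult_le_compat _ _ _ _ (Rabs_pos (wnum t v / wden t v)) (Rabs_pos (P2 / wden t v)) N E2).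
      rewrite Rmult_assoc. nra. }
    rewrite Rmult_comm. apply Rmult_le_compat; auto; apply Rabs_pos. }
  destruct (MVT_gen (fun t => wt s t v) x' x d) as (c & Hc & E).
  - intros t Ht; apply HD. unfold Rmin, Rmax in Ht; destruct (Rle_dec x' x); lra.
  - intros t Ht; apply continuity_pt_filterlim, (ex_derive_continuous (fun t => wt s t v)).
    exists (d t); apply HD. unfold Rmin, Rmax in Ht; destruct (Rle_dec x' x); lra.
  - rewrite E, Rabs_mult. apply Rmult_le_compat_r; [apply Rabs_pos|].
    apply HB. unfold Rmin, Rmax in Hc; destruct (Rle_dec x' x); lra.
Qed.

Lemma wbd_nonneg s v : 0 <= wbd s v.
Proof.
  apply pow_le. destruct (Req_dec (IZR (nrm v) ^ 2) 0) as [->|H].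
  - rewrite Rmult_0_r, Rinv_0; lra.
  - left; apply Rinv_0_lt_compat. pose proof (pow2_ge_0 (IZR (nrm v))); lra.
Qed.

Lemma wbd_eq s v : v <> (0, 0)%Z -> wbd s v = (4 / 3) ^ s * / (IZR (nrm v) ^ 2) ^ s.
Proof.
  intro Hv; pose proof (nrm_pos v Hv). unfold wbd. rewrite <- pow_inv, <- Rpow_mult_distr.
  f_equal; field; lra.
Qed.

Lemma ws_sum s x : 0 <= x <= 1 / 2 -> has_sum (wt (S (S s)) x) (ws (S (S s)) x).
Proof.
  intro Hx. destruct (summable4 (wt (S (S s)) x) ((4 / 3) ^ S (S s))) as [l Hl].
  - apply pow_le; lra.
  - intros v Hv. eapply Rle_trans; [apply wt_le; assumption|].
    rewrite (wbd_eq _ _ Hv). apply Rmult_le_compat_l; [apply pow_le; lra|].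
    apply inv_pow_le_4, nrm_pos, Hv.
  - unfold ws. pose proof (has_sum_box _ _ Hl) as H.
    rewrite (is_lim_seq_unique _ _ H); assumption.
Qed.

Lemma has_sum_odd f l : has_sum f l -> forall sg ta, (forall v, sg (ta v) = v) ->
  (forall v, ta (sg v) = v) -> (forall v, f (sg v) = - f v) -> l = 0.
Proof.
  intros H sg ta A B E. pose proof (has_sum_reindex sg ta f l A B H) as H'.
  pose proof (has_sum_scal (-1) f l H) as H''.
  assert (l = -1 * l); [|lra]. apply (has_sum_unique (fun v => f (sg v))); [assumption|].
  eapply has_sum_ext; [|exact H'']. intro v; cbv beta; rewrite E; ring.
Qed.

Lemma ws_0 s : ws (S (S s)) 0 = 0.
Proof.
  pose (sg := fun v : Z * Z => (fst v, - snd v)%Z).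
  assert (I : forall v, sg (sg v) = v) by (intros [m n]; unfold sg; cbn; f_equal; lia).
  apply (has_sum_odd _ _ (ws_sum s 0 ltac:(lra)) sg sg I I).
  intros [m n]; unfold wt.
  assert (D : wden 0 (sg (m, n)) = wden 0 (m, n)).
  { unfold wden, sg; cbn [fst snd]; rewrite opp_IZR; ring. }
  assert (N : wnum 0 (sg (m, n)) = - wnum 0 (m, n)).
  { unfold wnum, sg; cbn [fst snd]; rewrite opp_IZR; ring. }
  rewrite D, N; unfold Rdiv; ring.
Qed.

(* Rotation of order three of the hexagonal lattice: the three numerators cancel. *)
Lemma ws_half s : ws (S (S s)) (1 / 2) = 0.
Proof.
  pose (r := fun v : Z * Z => (- snd v, fst v + snd v)%Z).
  pose (r' := fun v : Z * Z => (fst v + snd v, - fst v)%Z).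
  assert (I : forall v, r (r' v) = v) by (intros [m n]; unfold r, r'; cbn; f_equal; lia).
  assert (I' : forall v, r' (r v) = v) by (intros [m n]; unfold r, r'; cbn; f_equal; lia).
  pose proof (ws_sum s (1 / 2) ltac:(lra)) as H.
  pose proof (has_sum_reindex r r' _ _ I I' H) as H1.
  pose proof (has_sum_reindex r r' _ _ I I' H1) as H2.
  pose proof (has_sum_plus _ _ _ _ H (has_sum_plus _ _ _ _ H1 H2)) as H3.
  set (w := ws _ _) in *. assert (w + (w + w) = 0); [|lra].
  apply (has_sum_unique _ _ _ H3).
  pose proof (has_sum_scal 0 _ _ H) as H0. rewrite Rmult_0_l in H0.
  eapply has_sum_ext; [|exact H0]. intros [m n]; cbv beta. unfold wt.
  assert (D1 : wden (1 / 2) (r (m, n)) = wden (1 / 2) (m, n)).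
  { unfold wden, r; cbn [fst snd]; rewrite opp_IZR, plus_IZR; field. }
  assert (D2 : wden (1 / 2) (r (r (m, n))) = wden (1 / 2) (m, n)).
  { unfold wden, r; cbn [fst snd]; rewrite ?opp_IZR, ?plus_IZR, ?opp_IZR, ?plus_IZR; field. }
  rewrite D1, D2.
  assert (E : wnum (1 / 2) (m, n) + (wnum (1 / 2) (r (m, n)) + wnum (1 / 2) (r (r (m, n)))) = 0).
  { unfold wnum, r; cbn [fst snd]; rewrite ?opp_IZR, ?plus_IZR, ?opp_IZR, ?plus_IZR; field. }
  set (N := wnum (1 / 2) (m, n)) in *; set (N1 := wnum (1 / 2) (r (m, n))) in *.
  set (N2 := wnum (1 / 2) (r (r (m, n)))) in *; set (D := wden (1 / 2) (m, n)).
  transitivity ((N + (N1 + N2)) / D * (/ D) ^ S (S s)); [rewrite E|]; unfold Rdiv; ring.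
Qed.

Definition wfin (s M : nat) (x : R) : R := lsum (wt s x) (box M).

Lemma box_origin M : In (0, 0)%Z (box M).
Proof. apply In_box; unfold nrm; simpl; lia. Qed.

Lemma ws_tail s M x c : (1 <= M)%nat -> 0 <= c -> 0 <= x <= 1 / 2 ->
  (forall v, ~ In v (box M) -> wbd (S (S s)) v <= c / IZR (nrm v) ^ 6) ->
  Rabs (ws (S (S s)) x - wfin (S (S s)) M x) <= c * (2 / INR M ^ 4).
Proof.
  intros HM Hc Hx Hb. apply has_sum_tail; [apply NoDup_box|apply ws_sum, Hx|].
  intros L HL Hd.
  apply Rle_trans with (lsum (fun v => wbd (S (S s)) v) L).
  - apply lsum_Rabs_le; intros v Hv; apply wt_le; [assumption|].
    intros ->; exact (Hd _ Hv (box_origin M)).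
  - apply lsum_tail6; auto. intro; apply wbd_nonneg.
Qed.

(** Near an end of the arc the sum itself vanishes, so a constant bound for the truncation error is
    useless; the error has to be small against the distance to the end. *)
Lemma ws_tail_lipschitz s M x x' c : (1 <= M)%nat -> 0 <= c ->
  0 <= x <= 1 / 2 -> 0 <= x' <= 1 / 2 ->
  (forall v, ~ In v (box M) -> wbd (S (S s)) v <= c / IZR (nrm v) ^ 6) ->
  Rabs ((ws (S (S s)) x - wfin (S (S s)) M x) - (ws (S (S s)) x' - wfin (S (S s)) M x'))
  <= (2 * INR (S (S s)) + 4) * (c * (2 / INR M ^ 4)) * Rabs (x - x').
Proof.
  intros HM Hc Hx Hx' Hb. set (k := S (S s)) in *.
  pose proof (has_sum_minus _ _ _ _ (ws_sum s x Hx) (ws_sum s x' Hx')) as H. fold k in H.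
  assert (E : ws k x - wfin k M x - (ws k x' - wfin k M x') =
    (ws k x - ws k x') - lsum (fun v => wt k x v - wt k x' v) (box M)).
  { replace (lsum (fun v => wt k x v - wt k x' v) (box M)) with (wfin k M x - wfin k M x'); [ring|].
    unfold wfin. rewrite (lsum_ext_in (fun v => wt k x v - wt k x' v) (fun v => wt k x v + -1 * wt k x' v))
      by (intros; ring).
    rewrite lsum_plus, lsum_scal; ring. }
  rewrite E. set (K := 2 * INR k + 4).
  assert (HK : 0 <= K) by (unfold K; pose proof (pos_INR k); lra).
  apply has_sum_tail; [apply NoDup_box|exact H|].
  intros L HL Hd.
  apply Rle_trans with (lsum (fun v => (K * Rabs (x - x')) * wbd k v) L).
  - apply lsum_Rabs_le; intros v Hv. unfold K.
    replace ((2 * INR k + 4) * Rabs (x - x') * wbd k v) with ((2 * INR k + 4) * wbd k v * Rabs (x - x')) by ring.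
    apply wt_lipschitz; assumption.
  - rewrite lsum_scal.
    replace (K * (c * (2 / INR M ^ 4)) * Rabs (x - x')) with (K * Rabs (x - x') * (c * (2 / INR M ^ 4))) by ring.
    apply Rmult_le_compat_l; [apply Rmult_le_pos; [assumption|apply Rabs_pos]|].
    apply lsum_tail6; auto. intro; apply wbd_nonneg.
Qed.

Lemma eval_eW s v x : eval [x] (eW s v) = wt s x v.
Proof.
  destruct v as [m n]; unfold eW, eW_num, eW_den, wt, wnum, wden; cbn [eval nth fst snd].
  rewrite plus_IZR, !mult_IZR. unfold Rdiv.
  replace (IZR m ^ 2) with (IZR m * IZR m) by ring.
  replace (IZR n ^ 2) with (IZR n * IZR n) by ring. reflexivity.
Qed.

Lemma wt_zopp s x v : wt s x (zopp v) = wt s x v.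
Proof.
  unfold wt, wnum, wden, zopp; cbn [fst snd]; rewrite !opp_IZR.
  replace ((- IZR (fst v)) ^ 2) with (IZR (fst v) ^ 2) by ring.
  replace ((- IZR (snd v)) ^ 2) with (IZR (snd v) ^ 2) by ring.
  replace (2 * - IZR (fst v) * - IZR (snd v)) with (2 * IZR (fst v) * IZR (snd v)) by ring.
  reflexivity.
Qed.

Lemma eval_wfin s M x : 2 * eval [x] (esum (eW s) (half M)) = wfin s M x.
Proof.
  unfold wfin; rewrite lsum_half by auto using wt_zero, wt_zopp.
  rewrite eval_esum; f_equal; apply lsum_ext_in; intros; apply eval_eW.
Qed.

(* The AM-GM bound [sqrt u <= (u + c) / (2 sqrt c)] with [sqrt c = 0.93], [u = 1 - x^2]. *)
Definition pcub (x : R) : R := (1 - x ^ 2) * (18649 / 10000 - x ^ 2) * (100 / 186).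

(** [rexpr] has no square root, so [y^3 = u sqrt u] is replaced by a polynomial majorant; [0.93] is
    near the middle of the range [[sqrt 3 / 2, 1]] of [y]. *)
Lemma pcub_ge x y : 0 <= x <= 1 / 2 -> 0 < y -> x ^ 2 + y ^ 2 = 1 -> y ^ 3 <= pcub x.
Proof.
  intros Hx Hy E. unfold pcub.
  replace (1 - x ^ 2) with (y ^ 2) by lra.
  replace (18649 / 10000 - x ^ 2) with (y ^ 2 + 8649 / 10000) by lra.
  pose proof (pow2_ge_0 (y - 93 / 100)). pose proof (pow2_ge_0 y). nra.
Qed.

Lemma eval_eG x : 2 * eval [x] eG = 13 / 4 * wfin 3 6 x - 2 * pcub x * wfin 6 2 x.
Proof.
  rewrite <- !eval_wfin. unfold eG, ep, ex, esub, pcub. cbn [eval nth]. ring.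
Qed.

(** The thresholds of the six checks are chosen to beat the truncation errors. After doubling, the
    sum with exponent [3] has slope at least [20 / 512 > 37 / 1000] in modulus near the ends and
    value above [2 / 512 > 37 / 10000] between them; for the gap the figures are [1 / 6 > 16 / 100]
    and [1 / 60 > 15 / 1000]. *)
Lemma arc_check_W_left :
  bisect (slope_test 1 (EMul (ECst 512 10) (esum (eW 3) (half 6)))) 12 0 [irat 0 1 1 10] = true.
Proof. vm_cast_no_check (eq_refl true). Qed.

Lemma arc_check_W_mid :
  bisect (positive_test [] (EAdd (ECst (-1) 512) (esum (eW 3) (half 6)))) 12 0
    [irat 1 10 46 100] = true.
Proof. vm_cast_no_check (eq_refl true). Qed.

Lemma arc_check_W_right :
  bisect (slope_test 1 (EMul (ECst (-512) 10) (esum (eW 3) (half 6)))) 12 0 [irat 46 100 1 2] = true.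
Proof. vm_cast_no_check (eq_refl true). Qed.

Lemma arc_check_G_left :
  bisect (slope_test 1 (EMul (ECst 12 1) eG)) 12 0 [irat 0 1 1 10] = true.
Proof. vm_cast_no_check (eq_refl true). Qed.

Lemma arc_check_G_mid :
  bisect (positive_test [] (EAdd (ECst (-1) 120) eG)) 12 0 [irat 1 10 45 100] = true.
Proof. vm_cast_no_check (eq_refl true). Qed.

Lemma arc_check_G_right :
  bisect (slope_test 1 (EMul (ECst (-12) 1) eG)) 12 0 [irat 45 100 1 2] = true.
Proof. vm_cast_no_check (eq_refl true). Qed.

Lemma encl1 a b c d x : (0 < b)%Z -> (0 < d)%Z ->
  IZR a / IZR b <= x <= IZR c / IZR d -> Forall2 encl [irat a b c d] [x].
Proof. intros; constructor; [apply encl_irat; assumption|constructor]. Qed.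

Lemma wbd3_tail v : ~ In v (box 6) -> wbd 3 v <= (64 / 27) / IZR (nrm v) ^ 6.
Proof.
  intro Hv. rewrite wbd_eq by (intros ->; exact (Hv (box_origin 6))).
  rewrite <- pow_mult. simpl (2 * 3)%nat. right; field.
  assert (v <> (0, 0)%Z) by (intros ->; exact (Hv (box_origin 6))).
  pose proof (nrm_pos v H); lra.
Qed.

Lemma wbd6_tail v : ~ In v (box 2) -> wbd 6 v <= (8 / 1000) / IZR (nrm v) ^ 6.
Proof.
  intro Hv. assert (H : v <> (0, 0)%Z) by (intros ->; exact (Hv (box_origin 2))).
  rewrite wbd_eq by assumption. pose proof (nrm_pos v H).
  assert (3 <= IZR (nrm v)) by (rewrite In_box in Hv; apply IZR_le; lia).
  rewrite <- pow_mult. simpl (2 * 6)%nat.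
  replace (IZR (nrm v) ^ 12) with (IZR (nrm v) ^ 6 * IZR (nrm v) ^ 6) by ring.
  rewrite Rinv_mult. unfold Rdiv at 2. rewrite <- Rmult_assoc.
  assert (P : 0 < IZR (nrm v) ^ 6) by (apply pow_lt; lra).
  apply Rmult_le_compat_r; [left; apply Rinv_0_lt_compat, P|].
  assert (3 ^ 6 <= IZR (nrm v) ^ 6) by (apply pow_incr; lra).
  (* Six of the twelve powers of the norm, which is at least [3] here, are spent on the constant. *)
  apply Rle_trans with ((4 / 3) ^ 6 * / 3 ^ 6); [|lra].
  apply Rmult_le_compat_l; [lra|]. apply Rinv_le_contravar; lra.
Qed.

Lemma ws3_value x : 0 <= x <= 1 / 2 -> Rabs (ws 3 x - wfin 3 6 x) <= 37 / 10000.
Proof.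
  intro Hx. pose proof (ws_tail 1 6 x (64 / 27) ltac:(lia) ltac:(lra) Hx wbd3_tail) as H.
  simpl INR in H. lra.
Qed.

Lemma ws6_value x : 0 <= x <= 1 / 2 -> Rabs (ws 6 x - wfin 6 2 x) <= 1 / 1000.
Proof.
  intro Hx. pose proof (ws_tail 4 2 x (8 / 1000) ltac:(lia) ltac:(lra) Hx wbd6_tail) as H.
  simpl INR in H. lra.
Qed.

Lemma ws3_lipschitz x x' : 0 <= x <= 1 / 2 -> 0 <= x' <= 1 / 2 ->
  Rabs ((ws 3 x - wfin 3 6 x) - (ws 3 x' - wfin 3 6 x')) <= 37 / 1000 * Rabs (x - x').
Proof.
  intros Hx Hx'.
  pose proof (ws_tail_lipschitz 1 6 x x' (64 / 27) ltac:(lia) ltac:(lra) Hx Hx' wbd3_tail) as H.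
  simpl INR in H. pose proof (Rabs_pos (x - x')). nra.
Qed.

Lemma ws6_lipschitz x x' : 0 <= x <= 1 / 2 -> 0 <= x' <= 1 / 2 ->
  Rabs ((ws 6 x - wfin 6 2 x) - (ws 6 x' - wfin 6 2 x')) <= 16 / 1000 * Rabs (x - x').
Proof.
  intros Hx Hx'.
  pose proof (ws_tail_lipschitz 4 2 x x' (8 / 1000) ltac:(lia) ltac:(lra) Hx Hx' wbd6_tail) as H.
  simpl INR in H. pose proof (Rabs_pos (x - x')). nra.
Qed.

Lemma ws3_nonneg x : 0 <= x <= 1 / 2 -> 0 <= ws 3 x.
Proof.
  intro Hx. destruct (Rle_dec x (1 / 10)) as [H1|H1]; [|destruct (Rle_dec x (46 / 100)) as [H2|H2]].
  - pose proof (bisect_slope _ _ _ _ 0 x arc_check_W_left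
      (encl_irat 0 1 1 10 0 ltac:(lia) ltac:(lia) ltac:(lra))
      (encl_irat 0 1 1 10 x ltac:(lia) ltac:(lia) ltac:(lra)) ltac:(lra)) as S.
    cbn [eval] in S. pose proof (eval_wfin 3 6 x); pose proof (eval_wfin 3 6 0).
    pose proof (ws3_lipschitz x 0 Hx ltac:(lra)) as L. pose proof (ws_0 1) as Z.
    rewrite Rminus_0_r, (Rabs_pos_eq x) in L by lra. apply Rabs_le_between in L. lra.
  - pose proof (bisect_positive _ _ _ _ _ arc_check_W_mid (encl1 1 10 46 100 x ltac:(lia) ltac:(lia) ltac:(lra))
      ltac:(intros e [])) as S.
    cbn [eval] in S. pose proof (eval_wfin 3 6 x).
    pose proof (ws3_value x Hx) as L. apply Rabs_le_between in L. lra.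
  - pose proof (bisect_slope _ _ _ _ x (1 / 2) arc_check_W_right
      (encl_irat 46 100 1 2 x ltac:(lia) ltac:(lia) ltac:(lra))
      (encl_irat 46 100 1 2 (1 / 2) ltac:(lia) ltac:(lia) ltac:(lra)) ltac:(lra)) as S.
    cbn [eval] in S. pose proof (eval_wfin 3 6 x); pose proof (eval_wfin 3 6 (1 / 2)).
    pose proof (ws3_lipschitz (1 / 2) x ltac:(lra) Hx) as L. pose proof (ws_half 1) as Z.
    rewrite (Rabs_pos_eq (1 / 2 - x)) in L by lra. apply Rabs_le_between in L. lra.
Qed.

(** On the arc [13/4 us 3 - 2 us 6] is [y^3 / 2] times this expression with [y^3] in place of
    [pcub x]. *)
Definition wgap (x : R) : R := 13 / 4 * ws 3 x - 2 * pcub x * ws 6 x.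

Lemma pcub_bounds x : 0 <= x <= 1 / 2 -> 0 <= pcub x <= 101 / 100.
Proof.
  intro Hx; unfold pcub. assert (0 <= x ^ 2 <= 1 / 4) by nra. nra.
Qed.

Lemma pcub_lipschitz x x' : 0 <= x <= 1 / 2 -> 0 <= x' <= 1 / 2 ->
  Rabs (pcub x - pcub x') <= 2 * Rabs (x - x').
Proof.
  intros Hx Hx'; unfold pcub.
  replace ((1 - x ^ 2) * (18649 / 10000 - x ^ 2) * (100 / 186) -
    (1 - x' ^ 2) * (18649 / 10000 - x' ^ 2) * (100 / 186)) with
    (- (100 / 186) * (x + x') * (28649 / 10000 - (x ^ 2 + x' ^ 2)) * (x - x')) by field.
  rewrite Rabs_mult. apply Rmult_le_compat_r; [apply Rabs_pos|].
  apply Rabs_le. assert (0 <= x ^ 2 <= 1 / 4) by nra. assert (0 <= x' ^ 2 <= 1 / 4) by nra.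
  assert (0 <= (x + x') * (28649 / 10000 - (x ^ 2 + x' ^ 2)) <= 28649 / 10000) by nra. lra.
Qed.

Lemma wgap_lipschitz x x' : 0 <= x <= 1 / 2 -> 0 <= x' <= 1 / 2 ->
  Rabs ((wgap x - 2 * eval [x] eG) - (wgap x' - 2 * eval [x'] eG)) <= 16 / 100 * Rabs (x - x').
Proof.
  intros Hx Hx'. rewrite !eval_eG; unfold wgap.
  pose proof (ws3_lipschitz x x' Hx Hx') as L3. pose proof (ws6_lipschitz x x' Hx Hx') as L6.
  pose proof (ws6_value x' Hx') as V6. pose proof (pcub_lipschitz x x' Hx Hx') as LP.
  pose proof (pcub_bounds x Hx) as BP.
  set (r3 := ws 3 x - wfin 3 6 x) in *; set (r3' := ws 3 x' - wfin 3 6 x') in *.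
  set (r6 := ws 6 x - wfin 6 2 x) in *; set (r6' := ws 6 x' - wfin 6 2 x') in *.
  replace (13 / 4 * ws 3 x - 2 * pcub x * ws 6 x - (13 / 4 * wfin 3 6 x - 2 * pcub x * wfin 6 2 x) -
    (13 / 4 * ws 3 x' - 2 * pcub x' * ws 6 x' - (13 / 4 * wfin 3 6 x' - 2 * pcub x' * wfin 6 2 x')))
    with (13 / 4 * (r3 - r3') + (- 2 * pcub x) * (r6 - r6') + (- 2 * r6') * (pcub x - pcub x'))
    by (unfold r3, r3', r6, r6'; ring).
  set (d := Rabs (x - x')) in *. assert (0 <= d) by apply Rabs_pos.
  (* [13/4 * 0.037 + 2 * 1.01 * 0.016 + 2 * 0.001 * 2 < 0.16]. *)
  eapply Rle_trans; [apply Rabs_triang|].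
  eapply Rle_trans; [apply Rplus_le_compat_r, Rabs_triang|].
  rewrite !Rabs_mult. rewrite (Rabs_pos_eq (13 / 4)), (Rabs_pos_eq (pcub x)) by lra.
  rewrite (Rabs_left (-2)) by lra.
  pose proof (Rmult_le_compat _ _ _ _ (Rabs_pos r6') (Rabs_pos (pcub x - pcub x')) V6 LP).
  pose proof (Rmult_le_compat _ _ _ _ (proj1 BP) (Rabs_pos (r6 - r6')) (proj2 BP) L6).
  nra.
Qed.

Lemma wgap_value x : 0 <= x <= 1 / 2 -> Rabs (wgap x - 2 * eval [x] eG) <= 15 / 1000.
Proof.
  intro Hx. rewrite eval_eG; unfold wgap.
  pose proof (ws3_value x Hx) as V3. pose proof (ws6_value x Hx) as V6.
  pose proof (pcub_bounds x Hx) as BP.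
  apply Rabs_le_between in V3; apply Rabs_le_between in V6. apply Rabs_le. nra.
Qed.

Lemma wgap_nonneg x : 0 <= x <= 1 / 2 -> 0 <= wgap x.
Proof.
  intro Hx. assert (Z0 : wgap 0 = 0) by (unfold wgap; rewrite (ws_0 1), (ws_0 4); ring).
  assert (Z2 : wgap (1 / 2) = 0) by (unfold wgap; rewrite (ws_half 1), (ws_half 4); ring).
  destruct (Rle_dec x (1 / 10)) as [H1|H1]; [|destruct (Rle_dec x (45 / 100)) as [H2|H2]].
  - pose proof (bisect_slope _ _ _ _ 0 x arc_check_G_left
      (encl_irat 0 1 1 10 0 ltac:(lia) ltac:(lia) ltac:(lra))
      (encl_irat 0 1 1 10 x ltac:(lia) ltac:(lia) ltac:(lra)) ltac:(lra)) as S.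
    rewrite Rmult_1_l in S.
    change (x - 0 <= 12 / 1 * eval [x] eG - 12 / 1 * eval [0] eG) in S.
    pose proof (wgap_lipschitz x 0 Hx ltac:(lra)) as L.
    rewrite Rminus_0_r, (Rabs_pos_eq x) in L by lra. apply Rabs_le_between in L. lra.
  - pose proof (bisect_positive _ _ _ _ _ arc_check_G_mid (encl1 1 10 45 100 x ltac:(lia) ltac:(lia) ltac:(lra))
      ltac:(intros e [])) as S.
    change (0 < -1 / 120 + eval [x] eG) in S.
    pose proof (wgap_value x Hx) as L. apply Rabs_le_between in L. lra.
  - pose proof (bisect_slope _ _ _ _ x (1 / 2) arc_check_G_right
      (encl_irat 45 100 1 2 x ltac:(lia) ltac:(lia) ltac:(lra))
      (encl_irat 45 100 1 2 (1 / 2) ltac:(lia) ltac:(lia) ltac:(lra)) ltac:(lra)) as S.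
    rewrite Rmult_1_l in S.
    change (1 / 2 - x <= -12 / 1 * eval [1 / 2] eG - -12 / 1 * eval [x] eG) in S.
    pose proof (wgap_lipschitz (1 / 2) x ltac:(lra) Hx) as L.
    rewrite (Rabs_pos_eq (1 / 2 - x)) in L by lra. apply Rabs_le_between in L. lra.
Qed.

Definition second_derive (f : R -> R) (t d : R) : Prop :=
  exists f1 : R -> R, locally t (fun u => is_derive f u (f1 u)) /\ is_derive f1 t d.

Lemma second_derive_plus f g t c d :
  second_derive f t c -> second_derive g t d -> second_derive (fun u => f u + g u) t (c + d).
Proof.
  intros (f1 & F1 & F2) (g1 & G1 & G2). exists (fun u => f1 u + g1 u); split.
  - generalize (filter_and _ _ F1 G1). apply filter_imp. intros u [A B].
    exact (is_derive_plus _ _ _ _ _ A B).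
  - exact (is_derive_plus _ _ _ _ _ F2 G2).
Qed.

Lemma second_derive_scal f t k c :
  second_derive f t c -> second_derive (fun u => k * f u) t (k * c).
Proof.
  intros (f1 & F1 & F2). exists (fun u => k * f1 u); split.
  - generalize F1. apply filter_imp. intros u A. exact (is_derive_scal _ _ k _ A).
  - exact (is_derive_scal _ _ k _ F2).
Qed.

Lemma second_derive_ext f g t c :
  (forall u, f u = g u) -> second_derive f t c -> second_derive g t c.
Proof.
  intros E (f1 & F1 & F2); exists f1; split; [|assumption].
  generalize F1; apply filter_imp; intros u A; eapply is_derive_ext; eauto.
Qed.

Lemma second_derive_const t c : second_derive (fun _ => c) t 0.
Proof.
  exists (fun _ => 0); split.
  - exists (mkposreal 1 Rlt_0_1); intros u _. evar_last; [apply is_derive_const|reflexivity].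
  - evar_last; [apply is_derive_const|reflexivity].
Qed.

(** If [d < 0], the first derivative, zero at the minimum, is negative just to the right of [t], and
    [f] drops below [f t]. *)
Lemma second_derive_local_min f t d :
  second_derive f t d -> locally t (fun u => f t <= f u) -> 0 <= d.
Proof.
  intros (f1 & F1 & F2) M. apply Rnot_lt_le; intro Hd.
  destruct F1 as [e1 F1], M as [e2 M].
  assert (Hball : forall e u, Rabs (u - t) < e -> ball t e u) by (intros; assumption).
  assert (D0 : f1 t = 0).
  { pose (e := Rmin e1 e2).
    assert (He : 0 < e) by (apply Rmin_pos; apply cond_pos).
    assert (H1 := Rmin_l e1 e2); assert (H2 := Rmin_r e1 e2); fold e in H1, H2.
    pose proof (is_derive_Reals f t (f1 t)) as [_ Dt].
    assert (Dt' : derivable_pt_lim f t (f1 t)).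
    { apply is_derive_Reals, F1, ball_center. }
    pose (pr := exist (fun l => derivable_pt_abs f t l) (f1 t) Dt' : derivable_pt f t).
    pose proof (deriv_minimum f (t - e) (t + e) t pr ltac:(lra) ltac:(lra)) as Hm.
    change (derive_pt f t pr) with (f1 t) in Hm. apply Hm.
    intros u Hu1 Hu2; apply M, Hball, Rabs_def1; lra. }
  apply is_derive_Reals in F2.
  destruct (F2 (- d / 2) ltac:(lra)) as [e3 F3].
  pose (e := Rmin (Rmin e1 e2) e3).
  assert (He : 0 < e) by (repeat apply Rmin_pos; apply cond_pos).
  assert (H1 : e <= e1) by (eapply Rle_trans; [apply Rmin_l|apply Rmin_l]).
  assert (H2 : e <= e2) by (eapply Rle_trans; [apply Rmin_l|apply Rmin_r]).
  assert (H3 : e <= e3) by apply Rmin_r.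
  assert (Hn : forall u, t < u < t + e -> f1 u < 0).
  { intros u Hu. specialize (F3 (u - t) ltac:(lra) ltac:(rewrite Rabs_pos_eq; lra)).
    replace (t + (u - t)) with u in F3 by ring. rewrite D0, Rminus_0_r in F3.
    apply Rabs_def2 in F3.
    assert (E : f1 u = f1 u / (u - t) * (u - t)) by (field; lra).
    rewrite E. assert (f1 u / (u - t) < 0) by lra. nra. }
  destruct (MVT_cor2 f f1 t (t + e / 2) ltac:(lra)) as (c & E & Hc).
  - intros u Hu. apply is_derive_Reals, F1, Hball, Rabs_def1; lra.
  - assert (Ht : f t <= f (t + e / 2)) by (apply M, Hball, Rabs_def1; lra).
    specialize (Hn c ltac:(lra)). nra.
Qed.

(** * A minimum principle on the truncated fundamental domain *)

(** Minimize in [y] first; by uniform continuity the minimum over a column depends continuously on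
    [x]. *)
Lemma continuous_min_2d (f : R -> R -> R) a b c d : a <= b -> c <= d ->
  (forall x y, a <= x <= b -> c <= y <= d -> continuity_2d_pt f x y) ->
  exists x0 y0, a <= x0 <= b /\ c <= y0 <= d /\
    forall x y, a <= x <= b -> c <= y <= d -> f x0 y0 <= f x y.
Proof.
  intros Hab Hcd Hf.
  assert (Hy : forall x, exists y0, a <= x <= b -> c <= y0 <= d /\
    forall y, c <= y <= d -> f x y0 <= f x y).
  { intro x. destruct (Classical_Prop.classic (a <= x <= b)) as [Hx|Hx]; [|exists 0; tauto].
    destruct (continuity_ab_min (f x) c d Hcd) as (y0 & H1 & H2).
    - intros y Hy. apply continuity_pt_filterlim. intros P [e HP].
      destruct (Hf x y Hx Hy e) as [del Hd]. exists del; intros z Hz.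
      apply HP. apply Hd; [rewrite Rminus_diag, Rabs_R0; apply cond_pos|exact Hz].
    - exists y0; intros _; split; auto. }
  set (g := fun x => Glb_Rbar (fun r => exists y, c <= y <= d /\ r = f x y)).
  assert (Hg : forall x y0, a <= x <= b -> c <= y0 <= d ->
    (forall y, c <= y <= d -> f x y0 <= f x y) -> real (g x) = f x y0).
  { intros x y0 Hx Hy0 Hm. unfold g.
    rewrite (is_glb_Rbar_unique _ (Finite (f x y0))); [reflexivity|].
    split.
    - intros r (y & H & ->); simpl; auto.
    - intros l Hl; apply Hl; eauto. }
  pose (m := fun x => real (g x)).
  (* Continuity at the end points is two-sided, so the column minimum is extended by clamping its
     argument to [[a, b]]. *)
  assert (Hc : forall x, a <= x <= b -> continuity_pt (fun x => m (Rmin b (Rmax a x))) x).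
  { intros x Hx eps He.
    destruct (uniform_continuity_2d f a b c d Hf (mkposreal eps He)) as [del Hd]; cbn in Hd.
    exists del; split; [apply cond_pos|]. intros z [_ Hz]. simpl in *. unfold Rdist in *.
    assert (Ex : Rmin b (Rmax a x) = x) by (rewrite Rmax_right, Rmin_right; lra).
    rewrite Ex. set (w := Rmin b (Rmax a z)).
    assert (Hw : a <= w <= b /\ Rabs (w - x) < del).
    { unfold w, Rmin, Rmax; destruct (Rle_dec a z); destruct (Rle_dec b _); try lra;
        (split; [lra|]); apply Rabs_def2 in Hz; apply Rabs_def1; lra. }
    destruct Hw as [Hw1 Hw2].
    destruct (Hy x) as [y1 H1]; specialize (H1 Hx). destruct (Hy w) as [y2 H2]; specialize (H2 Hw1).
    unfold m; rewrite (Hg x y1), (Hg w y2) by tauto.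
    destruct H1 as [A1 B1], H2 as [A2 B2].
    pose proof (Hd x y1 w y1 Hx A1 Hw1 A1 Hw2 ltac:(rewrite Rminus_diag, Rabs_R0; apply cond_pos)) as D1.
    pose proof (Hd x y2 w y2 Hx A2 Hw1 A2 Hw2 ltac:(rewrite Rminus_diag, Rabs_R0; apply cond_pos)) as D2.
    specialize (B1 y2 A2); specialize (B2 y1 A1).
    apply Rabs_def2 in D1; apply Rabs_def2 in D2; apply Rabs_def1; lra. }
  destruct (continuity_ab_min _ a b Hab Hc) as (x0 & H1 & H2).
  destruct (Hy x0) as [y0 H0]; specialize (H0 H2). destruct H0 as [A0 B0].
  exists x0, y0; split; [assumption|]; split; [assumption|].
  intros x y Hx Hy'. destruct (Hy x) as [y1 H3]; specialize (H3 Hx). destruct H3 as [A1 B1].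
  specialize (H1 x Hx). cbv beta in H1.
  rewrite !Rmax_right, !Rmin_right in H1 by lra.
  unfold m in H1; rewrite (Hg x0 y0), (Hg x y1) in H1 by tauto.
  specialize (B1 y Hy'); lra.
Qed.

(** At an interior minimum both second derivatives are nonnegative. The Laplacian has to be negative
    only where [P < - eps], which is what a positive eigenvalue provides. *)
Lemma min_principle (P : R -> R -> R) (eps Y : R) :
  (forall x y, 0 < y -> continuity_2d_pt P x y) ->
  (forall y, 0 < y <= Y -> 1 <= y -> - eps <= P 0 y) ->
  (forall y, 0 < y <= Y -> 3 / 4 <= y ^ 2 -> - eps <= P (1 / 2) y) ->
  (forall x y, 0 < y -> 0 <= x <= 1 / 2 -> x ^ 2 + y ^ 2 = 1 -> - eps <= P x y) ->
  (forall x, 0 <= x <= 1 / 2 -> - eps <= P x Y) ->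
  (forall x y, 0 < x < 1 / 2 -> 0 < y < Y -> 1 < x ^ 2 + y ^ 2 -> P x y < - eps ->
     exists c d, second_derive (fun u => P u y) x c /\ second_derive (fun u => P x u) y d /\ c + d < 0) ->
  1 <= Y ->
  forall x y, reduced x y -> y <= Y -> - eps <= P x y.
Proof.
  intros Hc B1 B2 B3 B4 Hi HY x y (Hy & Hx & Hn) HyY.
  pose (c := fun x => sqrt (1 - x ^ 2)).
  assert (Hcx : forall x, 0 <= x <= 1 / 2 -> 0 < c x /\ c x ^ 2 = 1 - x ^ 2 /\ c x <= 1).
  { intros u Hu. assert (1 / 2 < 1 - u ^ 2 <= 1) by nra. unfold c.
    assert (0 < sqrt (1 - u ^ 2)) by (apply sqrt_lt_R0; lra).
    assert (sqrt (1 - u ^ 2) ^ 2 = 1 - u ^ 2) by (apply pow2_sqrt; lra).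
    repeat split; auto; nra. }
  (* Straightens the region between the arc and the line [y = Y] to a rectangle, on which the
     minimum exists. *)
  pose (h := fun x t => c x + t * (Y - c x)).
  assert (Hh : forall u t, 0 <= u <= 1 / 2 -> 0 <= t <= 1 ->
    0 < h u t <= Y /\ 1 <= u ^ 2 + h u t ^ 2).
  { intros u t Hu Ht. destruct (Hcx u Hu) as (C1 & C2 & C3). unfold h.
    assert (c u <= c u + t * (Y - c u) <= Y) by nra. split; [lra|]. nra. }
  assert (Hcont : forall u t, 0 <= u <= 1 / 2 -> 0 <= t <= 1 ->
    continuity_2d_pt (fun u t => P u (h u t)) u t).
  { intros u t Hu Ht eps0.
    destruct (Hc u (h u t) ltac:(apply (Hh u t); assumption) eps0) as [d1 D1].
    assert (Ch : continuity_2d_pt h u t).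
    { unfold h. assert (Cc : continuity_2d_pt (fun x _ => c x) u t).
      { apply (continuity_1d_2d_pt_comp c (fun x _ => x)).
        - unfold c. apply (continuity_pt_comp (fun x => 1 - x ^ 2) sqrt).
          + apply derivable_continuous_pt, ex_derive_Reals_0. auto_derive; trivial.
          + apply continuity_pt_sqrt. nra.
        - apply continuity_2d_pt_id1. }
      apply continuity_2d_pt_plus; [assumption|].
      apply continuity_2d_pt_mult; [apply continuity_2d_pt_id2|].
      apply continuity_2d_pt_minus; [apply continuity_2d_pt_const|assumption]. }
    destruct (Ch d1) as [d2 D2].
    assert (Hm : 0 < Rmin d1 d2) by (apply Rmin_pos; apply cond_pos).
    exists (mkposreal _ Hm). cbn. intros u' t' Hu' Ht'.
    apply D1; [|apply D2]; eapply Rlt_le_trans; eauto using Rmin_l, Rmin_r. }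
  destruct (continuous_min_2d _ 0 (1 / 2) 0 1 ltac:(lra) ltac:(lra) Hcont)
    as (x0 & t0 & Hx0 & Ht0 & Hmin).
  set (y0 := h x0 t0) in *.
  destruct (Hh x0 t0 Hx0 Ht0) as [Hy0 Hn0]; fold y0 in Hy0, Hn0.
  assert (Hmin' : forall u w, 0 <= u <= 1 / 2 -> 0 < w <= Y -> 1 <= u ^ 2 + w ^ 2 -> P x0 y0 <= P u w).
  { intros u w Hu Hw Hn'. destruct (Hcx u Hu) as (C1 & C2 & C3).
    assert (Hcw : c u <= w) by nra.
    (* For [Y = 1] the column over [u = 0] shrinks to a point. *)
    destruct (Req_dec (c u) Y) as [E|E].
    - replace w with (h u 0) by (unfold h; lra). apply Hmin; lra.
    - assert (Hlt : 0 < Y - c u) by lra.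
      pose (t := (w - c u) / (Y - c u)).
      assert (Et : h u t = w) by (unfold h, t; field; lra).
      rewrite <- Et. apply Hmin; [assumption|]. unfold t; split.
      + apply Rdiv_le_0_compat; lra.
      + apply Rmult_le_reg_r with (Y - c u); [assumption|].
        unfold Rdiv; rewrite Rmult_assoc, Rinv_l; lra. }
  apply Rle_trans with (P x0 y0); [|apply Hmin'; auto].
  apply Rnot_lt_le; intro Hlt.
  assert (X0 : 0 < x0).
  { destruct (proj1 Hx0) as [H|<-]; [assumption|]. exfalso.
    specialize (B1 y0 Hy0 ltac:(nra)); lra. }
  assert (X1 : x0 < 1 / 2).
  { destruct (proj2 Hx0) as [H|E]; [assumption|]. exfalso.
    rewrite E in *. specialize (B2 y0 Hy0 ltac:(nra)); lra. }
  assert (Y1 : y0 < Y).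
  { destruct (proj2 Hy0) as [H|E]; [assumption|]. exfalso.
    rewrite E in *. specialize (B4 x0 Hx0); lra. }
  assert (N1 : 1 < x0 ^ 2 + y0 ^ 2).
  { destruct Hn0 as [H|E]; [assumption|]. exfalso.
    specialize (B3 x0 y0 ltac:(lra) Hx0 ltac:(lra)); lra. }
  destruct (Hi x0 y0 ltac:(lra) ltac:(lra) N1 Hlt) as (cc & dd & S1 & S2 & S3).
  set (N := x0 ^ 2 + y0 ^ 2 - 1) in *. assert (HN : 0 < N) by (unfold N; lra).
  assert (L1 : locally x0 (fun u => P x0 y0 <= P u y0)).
  { assert (He : 0 < Rmin (Rmin x0 (1 / 2 - x0)) N) by (repeat apply Rmin_pos; lra).
    exists (mkposreal _ He); intros u Hu. cbn in Hu.
    change (Rabs (u - x0) < Rmin (Rmin x0 (1 / 2 - x0)) N) in Hu.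
    assert (M1 := Rmin_l (Rmin x0 (1 / 2 - x0)) N). assert (M2 := Rmin_r (Rmin x0 (1 / 2 - x0)) N).
    assert (M3 := Rmin_l x0 (1 / 2 - x0)). assert (M4 := Rmin_r x0 (1 / 2 - x0)).
    apply Rabs_def2 in Hu. apply Hmin'; [lra|assumption|].
    unfold N in *. nra. }
  assert (L2 : locally y0 (fun w => P x0 y0 <= P x0 w)).
  { assert (HN' : 0 < N / (2 * y0)) by (apply Rdiv_lt_0_compat; lra).
    assert (He : 0 < Rmin (Rmin y0 (Y - y0)) (N / (2 * y0))) by (repeat apply Rmin_pos; lra).
    exists (mkposreal _ He); intros w Hw. cbn in Hw.
    change (Rabs (w - y0) < Rmin (Rmin y0 (Y - y0)) (N / (2 * y0))) in Hw.
    set (e := Rmin (Rmin y0 (Y - y0)) (N / (2 * y0))) in *.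
    assert (M1 : e <= Rmin y0 (Y - y0)) by apply Rmin_l.
    assert (M2 : e * (2 * y0) <= N).
    { apply Rle_trans with (N / (2 * y0) * (2 * y0)).
      - apply Rmult_le_compat_r; [lra|apply Rmin_r].
      - right; field; lra. }
    assert (M3 := Rmin_l y0 (Y - y0)). assert (M4 := Rmin_r y0 (Y - y0)).
    apply Rabs_def2 in Hw. apply Hmin'; [lra|lra|].
    unfold N in *. nra. }
  pose proof (second_derive_local_min _ _ _ S1 L1).
  pose proof (second_derive_local_min _ _ _ S2 L2). lra.
Qed.

(* Up to the factor [-2 s], the derivative of [tm] in [x]; like [tm] it is an eigenfunction of
   [y^2 (d^2/dx^2 + d^2/dy^2)] with eigenvalue [s (s - 1)]. *)
Definition ut (s : nat) (x y : R) (v : Z * Z) : R :=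
  IZR (fst v) * (IZR (fst v) * x + IZR (snd v)) * y ^ s / qf x y v ^ S s.

Lemma ut_fst_0 s x y n : ut s x y (0, n)%Z = 0.
Proof. unfold ut; cbn [fst snd]; unfold Rdiv; ring. Qed.

Lemma tm_derive s x y v : 0 < y ->
  is_derive (fun x => tm (S s) x y v) x (- 2 * INR (S s) * ut (S s) x y v).
Proof.
  intro Hy. destruct (pair_eq_dec v (0, 0)%Z) as [->|Hv].
  - apply is_derive_ext with (fun _ => 0); [intro; symmetry; apply tm_zero|].
    rewrite ut_fst_0, Rmult_0_r. evar_last; [apply is_derive_const|reflexivity].
  - pose proof (qf_pos x y v Hy Hv) as Hq.
    set (u := IZR (fst v) * (IZR (fst v) * x + IZR (snd v))).
    assert (D1 : is_derive (fun x => qf x y v) x (2 * u)).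
    { unfold qf, u. auto_derive; [exact I|ring]. }
    pose proof (is_derive_scal _ _ y _ (is_derive_inv _ _ _ D1 ltac:(lra))) as D2.
    pose proof (is_derive_pow _ (S s) _ _ D2) as D3. cbv beta in D3.
    evar_last; [exact D3|].
    unfold ut; fold u. replace (Init.Nat.pred (S s)) with s by reflexivity.
    set (q := qf x y v) in *. rewrite Rpow_mult_distr, pow_inv.
    replace (y ^ S s) with (y * y ^ s) by reflexivity.
    replace (q ^ S (S s)) with (q ^ 2 * q ^ s) by (simpl; ring).
    assert (q ^ s <> 0) by (apply pow_nonzero; lra). field; split; [assumption|lra].
Qed.

Lemma quotient_derive (f q : R -> R) f' q' t k : is_derive f t f' -> is_derive q t q' -> q t <> 0 ->
  is_derive (fun t => f t / q t ^ k) t ((f' * q t - INR k * f t * q') / q t ^ S k).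
Proof.
  intros Hf Hq H0.
  assert (Hk : q t ^ k <> 0) by (apply pow_nonzero, H0).
  pose proof (is_derive_div _ _ _ _ _ Hf (is_derive_pow _ k _ _ Hq) Hk) as D.
  evar_last; [exact D|]. cbv beta.
  destruct k as [|k]; [simpl; field; assumption|].
  replace (Init.Nat.pred (S k)) with k by reflexivity.
  replace (q t ^ S (S k)) with (q t * q t * q t ^ k) by (simpl; ring).
  replace (q t ^ S k) with (q t * q t ^ k) in * by reflexivity.
  field. split; [|assumption]. apply pow_nonzero, H0.
Qed.

Lemma quotient_second_derive (f f1 f2 q q1 q2 : R -> R) t k :
  locally t (fun u => is_derive f u (f1 u) /\ is_derive q u (q1 u) /\ q u <> 0) ->
  is_derive f1 t (f2 t) -> is_derive q1 t (q2 t) ->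
  second_derive (fun t => f t / q t ^ k) t
    ((f2 t * q t ^ 2 - INR k * (2 * f1 t * q1 t + f t * q2 t) * q t + INR k * (INR k + 1) * f t * q1 t ^ 2)
      / q t ^ S (S k)).
Proof.
  intros HL Hf1 Hq1.
  exists (fun u => (f1 u * q u - INR k * f u * q1 u) / q u ^ S k); split.
  - generalize HL; apply filter_imp; intros u (A & B & C). apply quotient_derive; assumption.
  - destruct (locally_singleton _ _ HL) as (A & B & C).
    pose proof (is_derive_minus _ _ _ _ _ (is_derive_mult _ _ _ _ _ Hf1 B Rmult_comm)
      (is_derive_mult _ _ _ _ _ (is_derive_scal _ _ (INR k) _ A) Hq1 Rmult_comm)) as D.
    pose proof (quotient_derive _ _ _ _ _ (S k) D B C) as E.
    evar_last; [exact E|]. f_equal. rewrite S_INR. unfold minus, plus, opp, mult; simpl. ring.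
Qed.

Lemma ut_second_derive s k x y a b : a <> 0 -> 0 < y ->
  (forall u w, 0 < w -> 0 < (a * u + b) ^ 2 + (a * w) ^ 2) ->
  (s = 3%nat /\ k = 6 \/ s = 6%nat /\ k = 30) -> exists c d,
  second_derive (fun u => a * (a * u + b) * y ^ s / ((a * u + b) ^ 2 + (a * y) ^ 2) ^ S s) x c /\
  second_derive (fun w => a * (a * x + b) * w ^ s / ((a * x + b) ^ 2 + (a * w) ^ 2) ^ S s) y d /\
  y ^ 2 * (c + d) = k * (a * (a * x + b) * y ^ s / ((a * x + b) ^ 2 + (a * y) ^ 2) ^ S s).
Proof.
  intros Ha Hy Hq Hs.
  assert (Hloc : locally y (fun w => 0 < w)).
  { exists (mkposreal _ Hy); intros w Hw. change (Rabs (w - y) < y) in Hw.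
    apply Rabs_def2 in Hw; lra. }
  assert (Hk : INR s * (INR s - 1) = k) by (destruct Hs as [[-> ->]|[-> ->]]; simpl; ring).
  assert (Hp : exists r, s = S (S r)) by (destruct Hs as [[-> _]|[-> _]]; eexists; reflexivity).
  destruct Hp as (r & ->).
  assert (Dp : forall n w, is_derive (fun w => w ^ S n) w (INR (S n) * w ^ n)).
  { intros n w. evar_last; [apply (is_derive_pow (fun w => w)), is_derive_id|].
    unfold one; simpl Init.Nat.pred; simpl. ring. }
  eexists; eexists; split; [|split].
  - apply (quotient_second_derive (fun u => a * (a * u + b) * y ^ S (S r)) (fun _ => a * a * y ^ S (S r)) (fun _ => 0)
      (fun u => (a * u + b) ^ 2 + (a * y) ^ 2) (fun u => 2 * a * (a * u + b)) (fun _ => 2 * a * a)).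
    + apply filter_forall; intro u. pose proof (Hq u y Hy). generalize (y ^ S (S r)); intro Y.
      split; [|split; [|lra]]; (auto_derive; [exact I|ring]).
    + evar_last; [apply is_derive_const|reflexivity].
    + auto_derive; [exact I|ring].
  - apply (quotient_second_derive (fun w => a * (a * x + b) * w ^ S (S r))
      (fun w => a * (a * x + b) * (INR (S (S r)) * w ^ S r))
      (fun w => a * (a * x + b) * (INR (S (S r)) * (INR (S r) * w ^ r)))
      (fun w => (a * x + b) ^ 2 + (a * w) ^ 2) (fun w => 2 * a * a * w) (fun _ => 2 * a * a)).
    + generalize Hloc; apply filter_imp; intros w Hw. pose proof (Hq x w Hw).
      split; [|split; [|lra]]; [|auto_derive; [exact I|ring]].
      apply (is_derive_scal (fun w => w ^ S (S r))), Dp.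
    + apply (is_derive_scal (fun w => INR (S (S r)) * w ^ S r)), (is_derive_scal (fun w => w ^ S r)), Dp.
    + auto_derive; [exact I|ring].
  - cbv beta. rewrite <- Hk, !S_INR. pose proof (Hq x y Hy) as Q.
    (* [q] stays opaque until the end, so that its powers with symbolic exponent cancel and a
       polynomial identity is left. *)
    assert (E : exists q, q = (a * x + b) ^ 2 + (a * y) ^ 2) by (eexists; reflexivity).
    destruct E as (q & E). rewrite <- E in *.
    replace (q ^ S (S (S (S (S r))))) with (q ^ 2 * q ^ S (S (S r))) by (simpl; ring).
    assert (q ^ S (S (S r)) <> 0) by (apply pow_nonzero; lra).
    set (z := q ^ S (S (S r))) in *. set (n := INR r).
    replace (y ^ S (S r)) with (y ^ 2 * y ^ r) by (simpl; ring). replace (y ^ S r) with (y * y ^ r) by reflexivity.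
    apply Rmult_eq_reg_r with (q ^ 2 * z); [|apply Rmult_integral_contrapositive_currified; [apply pow_nonzero; lra|assumption]].
    unfold Rdiv. field_simplify; try lra. rewrite E. ring.
Qed.

Lemma ut_laplace s k x y v : 0 < y ->
  (s = 3%nat /\ k = 6 \/ s = 6%nat /\ k = 30) -> exists c d,
  second_derive (fun u => ut s u y v) x c /\ second_derive (fun w => ut s x w v) y d /\
  y ^ 2 * (c + d) = k * ut s x y v.
Proof.
  intros Hy Hs. destruct v as [m n]. destruct (Z.eq_dec m 0) as [->|Hm].
  { exists 0, 0. rewrite ut_fst_0. split; [|split; [|ring]];
      apply (second_derive_ext (fun _ => 0)); try apply second_derive_const;
      intro; symmetry; apply ut_fst_0. }
  apply ut_second_derive; auto.
  - apply not_0_IZR; assumption.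
  - intros u w Hw. apply (qf_pos u w (m, n) Hw). congruence.
Qed.

Lemma qf_wden x y v : qf x y v = wden x v + IZR (fst v) ^ 2 * (x ^ 2 + y ^ 2 - 1).
Proof. unfold qf, wden; ring. Qed.

Lemma qf_reduced x y v : reduced x y -> 3 / 4 * IZR (nrm v) ^ 2 <= qf x y v.
Proof.
  intros (Hy & Hx & Hn). rewrite qf_wden. pose proof (wden_ge x v Hx).
  pose proof (Rmult_le_pos (IZR (fst v) ^ 2) (x ^ 2 + y ^ 2 - 1) (pow2_ge_0 _) ltac:(lra)).
  lra.
Qed.

Definition s36 (s : nat) : Prop := s = 3%nat \/ s = 6%nat.

(** [m (m x + n) y] is at most [q / 2] in modulus, as a product of two coordinates of length
    [sqrt q], and [y^(s-1) <= 2 q^(s-2)] because [y^2 <= q]. The bound does not grow with [y]: the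
    vectors with [m = 0], whose summands do grow, have no derivative in [x]. *)
Lemma ut_le_qf s x y v : s36 s -> reduced x y -> v <> (0, 0)%Z ->
  Rabs (ut s x y v) <= / qf x y v ^ 2 /\ (fst v = 0%Z \/ y ^ 2 <= qf x y v).
Proof.
  intros Hs Hr Hv. destruct (Hr) as (Hy & Hx & Hn).
  pose proof (qf_pos x y v Hy Hv) as Q. pose proof (qf_reduced x y v Hr) as Q1.
  destruct (Z.eq_dec (fst v) 0) as [E|E].
  { split; [|left; assumption]. destruct v as [m n]; cbn in E; subst.
    rewrite ut_fst_0, Rabs_R0. left; apply Rinv_0_lt_compat, pow_lt, Q. }
  assert (Hm : 1 <= IZR (fst v) ^ 2).
  { rewrite <- sqr_IZR_abs. assert (1 <= IZR (Z.abs (fst v))) by (apply IZR_le; lia). nra. }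
  assert (Hy2 : y ^ 2 <= qf x y v).
  { unfold qf. pose proof (pow2_ge_0 (IZR (fst v) * x + IZR (snd v))). pose proof (pow2_ge_0 y). nra. }
  split; [|right; assumption].
  assert (Q34 : 3 / 4 <= qf x y v) by (pose proof (nrm_pos v Hv); nra).
  unfold ut. set (q := qf x y v) in *. set (u := IZR (fst v) * x + IZR (snd v)).
  assert (B : Rabs (IZR (fst v) * u * y) <= q / 2).
  { assert (Eq : q = u ^ 2 + (IZR (fst v) * y) ^ 2) by reflexivity. rewrite Eq.
    pose proof (pow2_ge_0 (u + IZR (fst v) * y)). pose proof (pow2_ge_0 (u - IZR (fst v) * y)).
    apply Rabs_le; split; nra. }
  assert (G : exists r, 0 <= r /\ r <= 2 * q ^ (s - 2) /\ y ^ s = y * r).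
  { destruct Hs as [-> | ->].
    - exists (y ^ 2); simpl (3 - 2)%nat; rewrite pow_1; split; [apply pow2_ge_0|split; [lra|ring]].
    - exists (y ^ 5); simpl (6 - 2)%nat; split; [apply pow_le; lra|split; [|ring]].
      assert (y <= 2 * q ^ 2) by (destruct (Rle_dec y 1); nra).
      assert (y ^ 2 * y ^ 2 <= q * q) by (apply Rmult_le_compat; nra).
      replace (y ^ 5) with (y ^ 2 * y ^ 2 * y) by ring.
      replace (2 * q ^ 4) with (q * q * (2 * q ^ 2)) by ring.
      apply Rmult_le_compat; nra. }
  destruct G as (r & G0 & G1 & ->).
  assert (Hqs : q ^ S s = q ^ 2 * (q * q ^ (s - 2))) by (destruct Hs as [-> | ->]; simpl; ring).
  rewrite Hqs. assert (P : 0 < q ^ (s - 2)) by (apply pow_lt, Q).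
  assert (P2 : 0 < q ^ 2) by (apply pow_lt, Q).
  replace (IZR (fst v) * u * (y * r) / (q ^ 2 * (q * q ^ (s - 2)))) with
    (IZR (fst v) * u * y * r * / (q * q ^ (s - 2)) * / q ^ 2) by (field; repeat split; lra).
  rewrite !Rabs_mult, (Rabs_pos_eq r) by assumption.
  rewrite (Rabs_pos_eq (/ q ^ 2)) by (left; apply Rinv_0_lt_compat, P2).
  rewrite (Rabs_pos_eq (/ (q * _))) by (left; apply Rinv_0_lt_compat, Rmult_lt_0_compat; lra).
  rewrite <- (Rmult_1_l (/ q ^ 2)) at 2.
  apply Rmult_le_compat_r; [left; apply Rinv_0_lt_compat, P2|].
  apply Rmult_le_reg_r with (q * q ^ (s - 2)); [apply Rmult_lt_0_compat; lra|].
  rewrite Rmult_assoc, Rinv_l, Rmult_1_r, Rmult_1_l by (apply Rgt_not_eq, Rmult_lt_0_compat; lra).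
  rewrite <- !Rabs_mult.
  pose proof (Rmult_le_compat _ _ _ _ (Rabs_pos (IZR (fst v) * u * y)) G0 B G1). nra.
Qed.

Lemma ut_le s x y v : s36 s -> reduced x y -> v <> (0, 0)%Z ->
  Rabs (ut s x y v) <= 2 / IZR (nrm v) ^ 4.
Proof.
  intros Hs Hr Hv. destruct (ut_le_qf s x y v Hs Hr Hv) as [H _].
  pose proof (qf_reduced x y v Hr) as Q. pose proof (nrm_pos v Hv) as N.
  eapply Rle_trans; [exact H|].
  apply Rle_trans with (/ (3 / 4 * IZR (nrm v) ^ 2) ^ 2).
  - apply Rinv_le_contravar; [apply pow_lt; nra|apply pow_incr; nra].
  - replace (/ (3 / 4 * IZR (nrm v) ^ 2) ^ 2) with (16 / 9 * / IZR (nrm v) ^ 4) by (field; lra).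
    apply Rmult_le_compat_r; [left; apply Rinv_0_lt_compat, pow_lt; lra|lra].
Qed.

Definition us (s : nat) (x y : R) : R := real (Lim_seq (fun N => lsum (ut s x y) (box N))).

Lemma us_sum s x y : s36 s -> reduced x y -> has_sum (ut s x y) (us s x y).
Proof.
  intros Hs Hr. destruct (summable4 (ut s x y) 2) as [l Hl]; [lra|intros; apply ut_le; assumption|].
  unfold us; rewrite (is_lim_seq_unique _ _ (has_sum_box _ _ Hl)); assumption.
Qed.

Lemma us_uniform eps : 0 < eps -> exists N0, forall N, (N0 <= N)%nat -> forall s x y, s36 s -> reduced x y ->
  Rabs (us s x y - lsum (ut s x y) (box N)) <= eps.
Proof.
  intro He. destruct (archimed_cor1 (eps / 8)) as (N0 & H1 & H2); [lra|].
  exists N0; intros N HN s x y Hs Hr.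
  assert (Hpos : 1 <= INR N0) by (apply (le_INR 1); lia).
  assert (HNN : INR N0 <= INR N) by (apply le_INR; assumption).
  apply Rle_trans with (2 * (4 / INR N ^ 2)).
  - apply has_sum_tail; [apply NoDup_box|apply us_sum; assumption|].
    intros L HL Hd.
    apply Rle_trans with (lsum (fun v => Rabs (ut s x y v)) L).
    + apply lsum_Rabs_le; intros; lra.
    + apply lsum_tail4; auto; [lia|lra|intro; apply Rabs_pos|].
      intros v Hv; apply ut_le; auto. intros ->; apply Hv, box_origin.
  - apply Rle_trans with (8 * / INR N0); [|lra].
    replace (2 * (4 / INR N ^ 2)) with (8 * / (INR N ^ 2)) by (field; lra).
    apply Rmult_le_compat_l; [lra|]. apply Rinv_le_contravar; [lra|]. nra.
Qed.

Lemma us_x0 s y : s36 s -> reduced 0 y -> us s 0 y = 0.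
Proof.
  intros Hs Hr. pose (sg := fun v : Z * Z => (fst v, - snd v)%Z).
  assert (I : forall v, sg (sg v) = v) by (intros [m n]; unfold sg; cbn; f_equal; lia).
  apply (has_sum_odd _ _ (us_sum s 0 y Hs Hr) sg sg I I).
  intros [m n]; unfold ut.
  assert (D : qf 0 y (sg (m, n)) = qf 0 y (m, n)).
  { unfold qf, sg; cbn [fst snd]; rewrite opp_IZR; ring. }
  rewrite D; unfold sg; cbn [fst snd]; rewrite opp_IZR; unfold Rdiv; ring.
Qed.

(** The bijection comes from the reflection in the line [x = 1/2]: it keeps the form and reverses
    the sign of [m x + n]. *)
Lemma us_x_half s y : s36 s -> reduced (1 / 2) y -> us s (1 / 2) y = 0.
Proof.
  intros Hs Hr. pose (sg := fun v : Z * Z => (fst v, - snd v - fst v)%Z).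
  assert (I : forall v, sg (sg v) = v) by (intros [m n]; unfold sg; cbn; f_equal; lia).
  apply (has_sum_odd _ _ (us_sum s (1 / 2) y Hs Hr) sg sg I I).
  intros [m n]; unfold ut.
  assert (D : qf (1 / 2) y (sg (m, n)) = qf (1 / 2) y (m, n)).
  { unfold qf, sg; cbn [fst snd]; rewrite minus_IZR, opp_IZR; field. }
  rewrite D; unfold sg; cbn [fst snd]; rewrite minus_IZR, opp_IZR.
  set (q := qf (1 / 2) y (m, n) ^ S s).
  replace (IZR m * (1 / 2) + (- IZR n - IZR m)) with (- (IZR m * (1 / 2) + IZR n)) by field.
  unfold Rdiv; ring.
Qed.

(* On [|z| = 1] the form is symmetric in [m] and [n], so the summand may be averaged over the swap. *)
Lemma us_arc s x y : s36 s -> 0 < y -> 0 <= x <= 1 / 2 -> x ^ 2 + y ^ 2 = 1 ->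
  us s x y = y ^ s / 2 * ws s x.
Proof.
  intros Hs Hy Hx E. assert (Hr : reduced x y) by (split; [assumption|split; lra]).
  pose (sg := fun v : Z * Z => (snd v, fst v)).
  assert (I : forall v, sg (sg v) = v) by (intros [m n]; reflexivity).
  pose proof (us_sum s x y Hs Hr) as H.
  pose proof (has_sum_plus _ _ _ _ H (has_sum_reindex sg sg _ _ I I H)) as H2.
  assert (HW : has_sum (wt s x) (ws s x)) by (destruct Hs as [-> | ->]; apply ws_sum; assumption).
  cut (us s x y + us s x y = y ^ s * ws s x); [lra|].
  apply (has_sum_unique _ _ _ H2).
  eapply has_sum_ext; [|exact (has_sum_scal (y ^ s) _ _ HW)].
  intros [m n]; cbv beta.
  assert (Q : forall a b, qf x y (a, b) = wden x (a, b)).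
  { intros a b; rewrite qf_wden; replace (x ^ 2 + y ^ 2 - 1) with 0 by lra; ring. }
  unfold ut, wt, sg; cbn [fst snd]. rewrite !Q.
  replace (wden x (n, m)) with (wden x (m, n)) by (unfold wden; cbn [fst snd]; ring).
  rewrite pow_inv. destruct (pair_eq_dec (m, n) (0, 0)%Z) as [Z0|Hv].
  - injection Z0 as -> ->. unfold wnum; cbn [fst snd]; unfold Rdiv; ring.
  - pose proof (wden_pos x (m, n) Hx Hv) as W.
    assert (W2 : wden x (m, n) ^ s <> 0) by (apply pow_nonzero; lra).
    replace (wden x (m, n) ^ S s) with (wden x (m, n) * wden x (m, n) ^ s) by reflexivity.
    unfold wnum; cbn [fst snd]. field. split; [assumption|lra].
Qed.

Lemma us_arc_nonneg x y : 0 < y -> 0 <= x <= 1 / 2 -> x ^ 2 + y ^ 2 = 1 ->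
  0 <= us 3 x y /\ 0 <= 13 / 4 * us 3 x y - 2 * us 6 x y.
Proof.
  intros Hy Hx E. rewrite (us_arc 3), (us_arc 6) by (unfold s36; auto).
  pose proof (ws3_nonneg x Hx) as W3. pose proof (wgap_nonneg x Hx) as G.
  pose proof (pcub_ge x y Hx Hy E) as PC. unfold wgap in G.
  assert (P3 : 0 < y ^ 3) by (apply pow_lt, Hy).
  split; [nra|].
  replace (13 / 4 * (y ^ 3 / 2 * ws 3 x) - 2 * (y ^ 6 / 2 * ws 6 x)) with
    (y ^ 3 / 2 * (13 / 4 * ws 3 x - 2 * y ^ 3 * ws 6 x)) by field.
  apply Rmult_le_pos; [lra|].
  (* For [ws 6 x >= 0] replacing [y^3] by [pcub x] only lowers the difference, down to [wgap];
     otherwise both terms are nonnegative. *)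
  destruct (Rle_dec 0 (ws 6 x)); nra.
Qed.

Lemma usum_continuous s x y L : 0 < y -> continuity_2d_pt (fun x y => lsum (ut s x y) L) x y.
Proof.
  intro Hy; induction L as [|v L IH].
  - apply (continuity_2d_pt_ext (fun _ _ => 0)); [reflexivity|apply continuity_2d_pt_const].
  - apply (continuity_2d_pt_ext (fun x y => ut s x y v + lsum (ut s x y) L)); [reflexivity|].
    apply continuity_2d_pt_plus; [|assumption]. clear IH.
    destruct (pair_eq_dec v (0, 0)%Z) as [->|Hv].
    { apply (continuity_2d_pt_ext (fun _ _ => 0)); [intros; symmetry; apply ut_fst_0|].
      apply continuity_2d_pt_const. }
    assert (Cpow : forall f k, continuity_2d_pt f x y -> continuity_2d_pt (fun x y => f x y ^ k) x y).
    { intros f k Hf; induction k as [|k IHk].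
      { apply (continuity_2d_pt_ext (fun _ _ => 1)); [reflexivity|apply continuity_2d_pt_const]. }
      apply (continuity_2d_pt_ext (fun x y => f x y * f x y ^ k)); [reflexivity|].
      apply continuity_2d_pt_mult; assumption. }
    assert (Clin : forall a b, continuity_2d_pt (fun x _ => a * x + b) x y).
    { intros a b. apply (continuity_2d_pt_plus (fun x _ => a * x) (fun _ _ => b));
        [apply (continuity_2d_pt_mult (fun _ _ => a) (fun x _ => x))|];
        auto using continuity_2d_pt_const, continuity_2d_pt_id1. }
    assert (Cy : forall a, continuity_2d_pt (fun _ y => a * y) x y).
    { intro a. apply (continuity_2d_pt_mult (fun _ _ => a) (fun _ y => y));
        auto using continuity_2d_pt_const, continuity_2d_pt_id2. }
    assert (Cq : continuity_2d_pt (fun x y => qf x y v) x y).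
    { unfold qf. apply continuity_2d_pt_plus.
      - apply (Cpow (fun x _ => IZR (fst v) * x + IZR (snd v))), Clin.
      - apply (Cpow (fun _ y => IZR (fst v) * y)), Cy. }
    unfold ut, Rdiv. apply continuity_2d_pt_mult.
    + apply continuity_2d_pt_mult.
      * apply (continuity_2d_pt_mult (fun _ _ => IZR (fst v))); [apply continuity_2d_pt_const|apply Clin].
      * apply (Cpow (fun _ y => y)), continuity_2d_pt_id2.
    + apply (continuity_2d_pt_inv (fun x y => qf x y v ^ S s)); [apply Cpow, Cq|].
      apply pow_nonzero. pose proof (qf_pos x y v Hy Hv); lra.
Qed.

(** Controls the upper side of the truncated domain. The height depends on [L], which is harmless,
    since the box is fixed before the height. *)
Lemma usum_decay L eps : 0 < eps -> exists Y0, 1 <= Y0 /\ forall Y s x, Y0 <= Y -> s36 s -> 0 <= x <= 1 / 2 ->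
  Rabs (lsum (ut s x Y) L) <= eps.
Proof.
  intro He. exists (1 + INR (length L) / eps).
  assert (Hn : 0 <= INR (length L) / eps) by (apply Rdiv_le_0_compat; [apply pos_INR|assumption]).
  split; [lra|]. intros Y s x HY Hs Hx.
  assert (Hr : reduced x Y) by (split; [lra|split; [assumption|nra]]).
  apply Rle_trans with (lsum (fun v => Rabs (ut s x Y v)) L).
  { apply lsum_Rabs_le; intros; lra. }
  apply Rle_trans with (INR (length L) * / Y).
  - apply lsum_const_le. intros v _.
    destruct (pair_eq_dec v (0, 0)%Z) as [->|Hv].
    { rewrite ut_fst_0, Rabs_R0. left; apply Rinv_0_lt_compat; lra. }
    destruct (ut_le_qf s x Y v Hs Hr Hv) as [H [H0|H0]].
    + destruct v as [m n]; cbn in H0; subst. rewrite ut_fst_0, Rabs_R0. left; apply Rinv_0_lt_compat; lra.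
    + eapply Rle_trans; [exact H|]. apply Rinv_le_contravar; [lra|].
      assert (Y <= Y ^ 2) by nra. nra.
  - apply Rmult_le_reg_r with Y; [lra|]. rewrite Rmult_assoc, Rinv_l, Rmult_1_r by lra.
    replace (INR (length L)) with (INR (length L) / eps * eps) at 1 by (field; lra). nra.
Qed.

Lemma usum_laplace s k N x y : 0 < y -> (s = 3%nat /\ k = 6 \/ s = 6%nat /\ k = 30) -> exists c d,
  second_derive (fun u => lsum (ut s u y) (box N)) x c /\
  second_derive (fun w => lsum (ut s x w) (box N)) y d /\
  y ^ 2 * (c + d) = k * lsum (ut s x y) (box N).
Proof.
  intros Hy Hs. generalize (box N); intro L. induction L as [|v L (c & d & H1 & H2 & H3)].
  - exists 0, 0. split; [apply (second_derive_const x 0)|]. split; [apply (second_derive_const y 0)|].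
    unfold lsum; simpl; ring.
  - destruct (ut_laplace s k x y v Hy Hs) as (c' & d' & G1 & G2 & G3).
    exists (c' + c), (d' + d). split; [|split].
    + exact (second_derive_plus _ _ _ _ _ G1 H1).
    + exact (second_derive_plus _ _ _ _ _ G2 H2).
    + change (lsum (ut s x y) (v :: L)) with (ut s x y v + lsum (ut s x y) L). nra.
Qed.

(** The eigenvalue equations hold exactly for partial sums, the symmetries that fix the boundary
    values only for the limit; each sum is off by at most [eps], and [13/4 + 2 <= 6] accounts for
    the second bound on the boundary. *)
Lemma usum_almost_nonneg eps : 0 < eps -> exists N0, forall N, (N0 <= N)%nat ->
  forall x y, reduced x y ->
  - eps <= lsum (ut 3 x y) (box N) /\
  - (6 * eps) <= 13 / 4 * lsum (ut 3 x y) (box N) - 2 * lsum (ut 6 x y) (box N).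
Proof.
  intro He. destruct (us_uniform eps He) as (N0 & HN0). exists N0; intros N HN x y Hr.
  specialize (HN0 N HN).
  destruct (usum_decay (box N) eps He) as (Y0 & HY0 & Hdec).
  set (Y := Y0 + y).
  assert (HYy : y <= Y) by (unfold Y; lra).
  assert (HY1 : 1 <= Y) by (unfold Y; destruct Hr; lra).
  assert (HYY : Y0 <= Y) by (unfold Y; destruct Hr; lra).
  assert (S3 : s36 3) by (left; reflexivity). assert (S6 : s36 6) by (right; reflexivity).
  assert (Near : forall u w s, s36 s -> reduced u w ->
    us s u w - eps <= lsum (ut s u w) (box N) <= us s u w + eps).
  { intros u w s Hs Hr'. specialize (HN0 s u w Hs Hr'). apply Rabs_le_between in HN0; lra. }
  assert (R0 : forall w, 0 < w -> 1 <= w -> reduced 0 w) by (intros; split; [lra|split; nra]).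
  assert (R2 : forall w, 0 < w -> 3 / 4 <= w ^ 2 -> reduced (1 / 2) w) by (intros; split; [lra|split; nra]).
  assert (Ra : forall u w, 0 < w -> 0 <= u <= 1 / 2 -> u ^ 2 + w ^ 2 = 1 -> reduced u w)
    by (intros; split; [lra|split; lra]).
  assert (P3 : forall u w, reduced u w -> w <= Y -> - eps <= lsum (ut 3 u w) (box N)).
  { apply min_principle; auto.
    - intros; apply usum_continuous; assumption.
    - intros w Hw1 Hw2. pose proof (Near 0 w 3%nat S3 (R0 w ltac:(lra) Hw2)).
      rewrite (us_x0 3 w S3 (R0 w ltac:(lra) Hw2)) in H; lra.
    - intros w Hw1 Hw2. pose proof (Near (1 / 2) w 3%nat S3 (R2 w ltac:(lra) Hw2)).
      rewrite (us_x_half 3 w S3 (R2 w ltac:(lra) Hw2)) in H; lra.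
    - intros u w Hw Hu E. pose proof (Near u w 3%nat S3 (Ra u w Hw Hu E)).
      destruct (us_arc_nonneg u w Hw Hu E); lra.
    - intros u Hu. pose proof (Hdec Y 3%nat u HYY S3 Hu) as H. apply Rabs_le_between in H; lra.
    - intros u w Hu [Hw HwY] Hn Hneg.
      destruct (usum_laplace 3 6 N u w Hw ltac:(auto)) as (c & d & H1 & H2 & H3).
      exists c, d; split; [assumption|split; [assumption|]].
      assert (0 < w ^ 2) by (apply pow_lt, Hw). nra. }
  split; [apply P3; assumption|].
  apply (min_principle (fun u w => 13 / 4 * lsum (ut 3 u w) (box N) - 2 * lsum (ut 6 u w) (box N)) (6 * eps) Y); auto.
  - intros u w Hw. apply continuity_2d_pt_minus;
      (apply (continuity_2d_pt_mult (fun _ _ => _)); [apply continuity_2d_pt_const|apply usum_continuous, Hw]).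
  - intros w Hw1 Hw2. pose proof (Near 0 w 3%nat S3 (R0 w ltac:(lra) Hw2)) as A.
    pose proof (Near 0 w 6%nat S6 (R0 w ltac:(lra) Hw2)) as B.
    rewrite (us_x0 3 w S3 (R0 w ltac:(lra) Hw2)) in A. rewrite (us_x0 6 w S6 (R0 w ltac:(lra) Hw2)) in B. lra.
  - intros w Hw1 Hw2. pose proof (Near (1 / 2) w 3%nat S3 (R2 w ltac:(lra) Hw2)) as A.
    pose proof (Near (1 / 2) w 6%nat S6 (R2 w ltac:(lra) Hw2)) as B.
    rewrite (us_x_half 3 w S3 (R2 w ltac:(lra) Hw2)) in A. rewrite (us_x_half 6 w S6 (R2 w ltac:(lra) Hw2)) in B. lra.
  - intros u w Hw Hu E. pose proof (Near u w 3%nat S3 (Ra u w Hw Hu E)).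
    pose proof (Near u w 6%nat S6 (Ra u w Hw Hu E)).
    destruct (us_arc_nonneg u w Hw Hu E); lra.
  - intros u Hu. pose proof (Hdec Y 3%nat u HYY S3 Hu) as A. pose proof (Hdec Y 6%nat u HYY S6 Hu) as B.
    apply Rabs_le_between in A; apply Rabs_le_between in B; lra.
  - intros u w Hu [Hw HwY] Hn Hneg.
    destruct (usum_laplace 3 6 N u w Hw ltac:(auto)) as (c & d & H1 & H2 & H3).
    destruct (usum_laplace 6 30 N u w Hw ltac:(auto)) as (c' & d' & G1 & G2 & G3).
    exists (13 / 4 * c + (-2) * c'), (13 / 4 * d + (-2) * d'). split; [|split].
    + eapply second_derive_ext; [|exact (second_derive_plus _ _ _ _ _
        (second_derive_scal _ _ (13 / 4) _ H1) (second_derive_scal _ _ (-2) _ G1))]. intro; cbv beta; ring.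
    + eapply second_derive_ext; [|exact (second_derive_plus _ _ _ _ _
        (second_derive_scal _ _ (13 / 4) _ H2) (second_derive_scal _ _ (-2) _ G2))]. intro; cbv beta; ring.
    (* The two eigenvalues differ, so the combination is not an eigenfunction: its Laplacian, times
       [w^2], is [30] times itself minus [24 * 13/4] times the sum for [3]. The first bound makes
       this less than [- 180 eps + 78 eps]. *)
    + assert (B3 : - eps <= lsum (ut 3 u w) (box N)).
      { apply P3; [split; [assumption|split; lra]|lra]. }
      assert (0 < w ^ 2) by (apply pow_lt, Hw).
      assert (w ^ 2 * (13 / 4 * c + -2 * c' + (13 / 4 * d + -2 * d')) < 0).
      { replace (w ^ 2 * (13 / 4 * c + -2 * c' + (13 / 4 * d + -2 * d'))) with
          (13 / 4 * (w ^ 2 * (c + d)) - 2 * (w ^ 2 * (c' + d'))) by ring.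
        rewrite H3, G3. lra. }
      nra.
Qed.

Lemma zs_diff_ge s1 s2 c1 c2 x1 x2 y d : 0 < y ->
  (exists N0, forall N, (N0 <= N)%nat ->
    d <= (c1 * lsum (tm (S (S s1)) x2 y) (box N) + c2 * lsum (tm (S (S s2)) x2 y) (box N))
       - (c1 * lsum (tm (S (S s1)) x1 y) (box N) + c2 * lsum (tm (S (S s2)) x1 y) (box N))) ->
  d <= (c1 * zs (S (S s1)) x2 y + c2 * zs (S (S s2)) x2 y)
     - (c1 * zs (S (S s1)) x1 y + c2 * zs (S (S s2)) x1 y).
Proof.
  intros Hy (N0 & H).
  assert (L : forall s x, is_lim_seq (fun N => lsum (tm (S (S s)) x y) (box N)) (zs (S (S s)) x y)).
  { intros s x; apply has_sum_box, zs_sum, Hy. }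
  assert (Lc : forall c1 c2 x, is_lim_seq
    (fun N => c1 * lsum (tm (S (S s1)) x y) (box N) + c2 * lsum (tm (S (S s2)) x y) (box N))
    (c1 * zs (S (S s1)) x y + c2 * zs (S (S s2)) x y)).
  { intros a b x. apply is_lim_seq_plus'; apply is_lim_seq_mult'; auto using is_lim_seq_const. }
  match goal with |- _ <= ?l =>
    apply (is_lim_seq_le_loc (fun _ => d) _ (Finite d) (Finite l) (ex_intro _ N0 H)) end;
    [apply is_lim_seq_const|apply is_lim_seq_minus'; apply Lc].
Qed.

Lemma lsum_derive (F d : R -> Z * Z -> R) x L :
  (forall v, is_derive (fun x => F x v) x (d x v)) ->
  is_derive (fun x => lsum (F x) L) x (lsum (d x) L).
Proof.
  intro H; induction L as [|v L IH].
  - apply is_derive_ext with (fun _ => 0); [reflexivity|].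
    evar_last; [apply is_derive_const|reflexivity].
  - apply is_derive_ext with (fun x => F x v + lsum (F x) L); [reflexivity|].
    exact (is_derive_plus _ _ _ _ _ (H v) IH).
Qed.

Lemma tm_lsum_derive s x y L : 0 < y ->
  is_derive (fun x => lsum (tm (S s) x y) L) x (- 2 * INR (S s) * lsum (ut (S s) x y) L).
Proof.
  intro Hy. rewrite <- lsum_scal.
  apply (lsum_derive (fun x => tm (S s) x y) (fun x v => - 2 * INR (S s) * ut (S s) x y v)).
  intro v; apply tm_derive, Hy.
Qed.

(** The mean value theorem is applied to partial sums, whose derivatives are [-6] and [-12] times
    the sums of [ut]; the errors [6 eps] and [6 * 6 eps] survive the limit in [N] and are then sent
    to zero. *)
Lemma horizontal_monotone x1 x2 y : x1 <= x2 -> reduced x1 y -> reduced x2 y ->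
  zs 3 x2 y <= zs 3 x1 y /\
  zs 6 x1 y - 13 / 4 * zs 3 x1 y <= zs 6 x2 y - 13 / 4 * zs 3 x2 y.
Proof.
  intros Hx (Hy & Hx1 & Hn1) (_ & Hx2 & Hn2).
  assert (Hr : forall x, x1 <= x <= x2 -> reduced x y) by (intros x H; split; [assumption|split; nra]).
  assert (G : forall eps, 0 < eps ->
    - (6 * eps) <= zs 3 x1 y - zs 3 x2 y /\
    - (36 * eps) <= zs 6 x2 y - 13 / 4 * zs 3 x2 y - (zs 6 x1 y - 13 / 4 * zs 3 x1 y)).
  { intros eps He. destruct (usum_almost_nonneg eps He) as (N0 & HN0).
    destruct (Req_dec x1 x2) as [<-|Hne]; [lra|].
    assert (D : forall c1 c2 N x, is_derive
      (fun x => c1 * lsum (tm 3 x y) (box N) + c2 * lsum (tm 6 x y) (box N)) x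
      (c1 * (-6 * lsum (ut 3 x y) (box N)) + c2 * (-12 * lsum (ut 6 x y) (box N)))).
    { intros c1 c2 N x.
      pose proof (tm_lsum_derive 2 x y (box N) Hy) as D3. pose proof (tm_lsum_derive 5 x y (box N) Hy) as D6.
      replace (-2 * INR 3) with (-6) in D3 by (simpl; ring).
      replace (-2 * INR 6) with (-12) in D6 by (simpl; ring).
      exact (is_derive_plus _ _ _ _ _ (is_derive_scal _ _ c1 _ D3) (is_derive_scal _ _ c2 _ D6)). }
    split.
    - pose proof (zs_diff_ge 1 4 (-1) 0 x1 x2 y (- (6 * eps)) Hy) as Z.
      cut (- (6 * eps) <= -1 * zs 3 x2 y + 0 * zs 6 x2 y - (-1 * zs 3 x1 y + 0 * zs 6 x1 y)); [lra|].
      apply Z. exists N0; intros N HN.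
      destruct (MVT_cor2 (fun x => -1 * lsum (tm 3 x y) (box N) + 0 * lsum (tm 6 x y) (box N))
        (fun x => -1 * (-6 * lsum (ut 3 x y) (box N)) + 0 * (-12 * lsum (ut 6 x y) (box N))) x1 x2 ltac:(lra))
        as (c & E & Hc); [intros x _; apply is_derive_Reals, D|].
      rewrite E. destruct (HN0 N HN c y (Hr c ltac:(lra))) as [A _]. nra.
    - pose proof (zs_diff_ge 1 4 (- 13 / 4) 1 x1 x2 y (- (36 * eps)) Hy) as Z.
      cut (- (36 * eps) <= - 13 / 4 * zs 3 x2 y + 1 * zs 6 x2 y - (- 13 / 4 * zs 3 x1 y + 1 * zs 6 x1 y)); [lra|].
      apply Z. exists N0; intros N HN.
      destruct (MVT_cor2 (fun x => - 13 / 4 * lsum (tm 3 x y) (box N) + 1 * lsum (tm 6 x y) (box N))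
        (fun x => - 13 / 4 * (-6 * lsum (ut 3 x y) (box N)) + 1 * (-12 * lsum (ut 6 x y) (box N))) x1 x2 ltac:(lra))
        as (c & E & Hc); [intros x _; apply is_derive_Reals, D|].
      rewrite E. destruct (HN0 N HN c y (Hr c ltac:(lra))) as [_ A]. nra. }
  split; apply le_epsilon; intros e He;
    destruct (G (e / 36) ltac:(lra)) as [A B]; lra.
Qed.

(** * Power sums of three reciprocals as functions of the product *)

Definition phi3 (a e K : R) : R := a ^ 3 / K ^ 3 - 6 * e * a / K ^ 2 + 3 / K.
Definition phi6 (a e K : R) : R :=
  a ^ 6 / K ^ 6 - 12 * e * a ^ 4 / K ^ 5 + (36 * e ^ 2 * a ^ 2 + 6 * a ^ 3) / K ^ 4
  - (16 * e ^ 3 + 24 * e * a) / K ^ 3 + 3 / K ^ 2.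

(** Newton's identities for the reciprocals, whose elementary symmetric functions are [a / K],
    [2 e / K] and [1 / K]. Once [e] and [a] are fixed, the product is the only variable. *)
Lemma phi3_powersum A B C : 0 < A -> 0 < B -> 0 < C ->
  phi3 (A * B + B * C + C * A) ((A + B + C) / 2) (A * B * C) = (/ A) ^ 3 + (/ B) ^ 3 + (/ C) ^ 3.
Proof. intros; unfold phi3; field; repeat split; lra. Qed.

Lemma phi6_powersum A B C : 0 < A -> 0 < B -> 0 < C ->
  phi6 (A * B + B * C + C * A) ((A + B + C) / 2) (A * B * C) = (/ A) ^ 6 + (/ B) ^ 6 + (/ C) ^ 6.
Proof. intros; unfold phi6; field; repeat split; lra. Qed.

(** Complete homogeneous symmetric polynomials in two and three variables, and in [hconv] that of
    the three variables each taken twice. All their terms are positive, so signs are evident and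
    intervals do not suffer from the cancellations in [dphi3] and its companions. *)
Fixpoint hsum2 (n : nat) (a b : R) : R :=
  match n with O => 1 | S m => a ^ n + b * hsum2 m a b end.
Fixpoint hsum (n : nat) (a b c : R) : R :=
  match n with O => 1 | S m => hsum2 n a b + c * hsum m a b c end.
Definition hconv (s : nat) (a b c : R) : R :=
  fold_right (fun i r => hsum i a b c * hsum (s - i) a b c + r) 0 (seq 0 (S s)).

Definition dphi3 (a e K : R) : R := - (3 * a ^ 3 / K ^ 4 - 12 * e * a / K ^ 3 + 3 / K ^ 2).
Definition dphi6 (a e K : R) : R :=
  - (6 * a ^ 6 / K ^ 7 - 60 * e * a ^ 4 / K ^ 6 + 4 * (36 * e ^ 2 * a ^ 2 + 6 * a ^ 3) / K ^ 5
  - 3 * (16 * e ^ 3 + 24 * e * a) / K ^ 4 + 6 / K ^ 3).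
Definition ddphi3 (a e K : R) : R := 12 * a ^ 3 / K ^ 5 - 36 * e * a / K ^ 4 + 6 / K ^ 3.
Definition ddphi6 (a e K : R) : R :=
  42 * a ^ 6 / K ^ 8 - 360 * e * a ^ 4 / K ^ 7 + 20 * (36 * e ^ 2 * a ^ 2 + 6 * a ^ 3) / K ^ 6
  - 12 * (16 * e ^ 3 + 24 * e * a) / K ^ 5 + 18 / K ^ 4.

Ltac derive_rational := 
  auto_derive; [repeat split; repeat apply Rmult_integral_contrapositive_currified; lra|field; lra].

Lemma phi3_derive a e K : 0 < K -> is_derive (phi3 a e) K (dphi3 a e K).
Proof. intro; unfold phi3, dphi3; derive_rational. Qed.
Lemma phi6_derive a e K : 0 < K -> is_derive (phi6 a e) K (dphi6 a e K).
Proof. intro; unfold phi6, dphi6; derive_rational. Qed.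
Lemma dphi3_derive a e K : 0 < K -> is_derive (dphi3 a e) K (ddphi3 a e K).
Proof. intro; unfold dphi3, ddphi3; derive_rational. Qed.
Lemma dphi6_derive a e K : 0 < K -> is_derive (dphi6 a e) K (ddphi6 a e K).
Proof. intro; unfold dphi6, ddphi6; derive_rational. Qed.

(* The elementary symmetric functions of [A, B, C] are [2e, a, K]; with [alpha = / A] etc. this is the
   generating function identity [sum_s p_s t^s / s = - ln (1 - (a t - 2 e t^2 + t^3) / K)]. *)
Lemma dphi3_hsum A B C : 0 < A -> 0 < B -> 0 < C ->
  dphi3 (A * B + B * C + C * A) ((A + B + C) / 2) (A * B * C) =
  - (/ A * (/ B * / C) * (3 * hsum 3 (/ A) (/ B) (/ C))).
Proof. intros; unfold dphi3; cbn [hsum hsum2]; field; repeat split; lra. Qed.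

Lemma dphi6_hsum A B C : 0 < A -> 0 < B -> 0 < C ->
  dphi6 (A * B + B * C + C * A) ((A + B + C) / 2) (A * B * C) =
  - (/ A * (/ B * / C) * (6 * hsum 6 (/ A) (/ B) (/ C))).
Proof. intros; unfold dphi6; cbn [hsum hsum2]; field; repeat split; lra. Qed.

Lemma ddphi3_hconv A B C : 0 < A -> 0 < B -> 0 < C ->
  ddphi3 (A * B + B * C + C * A) ((A + B + C) / 2) (A * B * C) =
  (/ A * (/ B * / C)) ^ 2 * (3 * hconv 3 (/ A) (/ B) (/ C)).
Proof. intros; unfold ddphi3, hconv; cbn [hsum hsum2 fold_right seq Nat.sub]; field; repeat split; lra. Qed.

Lemma ddphi6_hconv A B C : 0 < A -> 0 < B -> 0 < C ->
  ddphi6 (A * B + B * C + C * A) ((A + B + C) / 2) (A * B * C) =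
  (/ A * (/ B * / C)) ^ 2 * (6 * hconv 6 (/ A) (/ B) (/ C)).
Proof. intros; unfold ddphi6, hconv; cbn [hsum hsum2 fold_right seq Nat.sub]; field; repeat split; lra. Qed.

(** * Interval bounds for the derivatives of the two triple sums *)

Definition elets (l : list rexpr) (b : rexpr) : rexpr := fold_right ELet b l.

(* In the environment [p; q], with [r = (1 - p q) / (p + q)], pushes
   [1 / (p + q)], [1 / (p + r)] and [1 / (q + r)]. *)
Definition einverses : list rexpr :=
  [EInv (EAdd (EVar 0) (EVar 1));
   EMul (EAdd (EVar 1) (EVar 2)) (EInv (EAdd (EInt 1) (EPow (EVar 1) 2)));
   EMul (EAdd (EVar 2) (EVar 3)) (EInv (EAdd (EInt 1) (EPow (EVar 3) 2)))].
(* In the environment [hsum (n-1); hsum2 (n-1); a^(n-1); ...; c; b; a], pushes the next three entries. *)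
Definition ehsum_step (n : nat) : list rexpr :=
  [EMul (EVar 2) (EVar (3 * n + 2));
   EAdd (EVar 0) (EMul (EVar 2) (EVar (3 * n + 2)));
   EAdd (EVar 0) (EMul (EVar 2) (EVar (3 * n + 2)))].
Definition ehsums (s : nat) (b : rexpr) : rexpr :=
  elets [EInt 1; EInt 1; EInt 1] (elets (flat_map ehsum_step (seq 1 s)) b).
Definition ekappa (s : nat) : rexpr :=
  EMul (EVar (3 * s + 5)) (EMul (EVar (3 * s + 4)) (EVar (3 * s + 3))).
Definition ehsum (s n : nat) : rexpr := EVar (3 * (s - n)).
Definition ehconv (s : nat) : rexpr :=
  fold_right (fun i t => EAdd (EMul (ehsum s i) (ehsum s (s - i))) t) (EInt 0) (seq 0 (S s)).

(** [39 / 4] is [3 * 13 / 4]: the product is [- (dphi6 - 13/4 dphi3)]. *)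
Definition body_gap : rexpr :=
  esub (EMul (ekappa 6) (esub (EMul (EInt 6) (ehsum 6 6)) (EMul (ECst 39 4) (ehsum 6 3)))) (ECst 33 10).
Definition body_low : rexpr := esub (EMul (ekappa 3) (EMul (EInt 3) (ehsum 3 3))) (EInt 5).
Definition body_d (s : nat) (c : Z) : rexpr :=
  esub (EInt c) (EMul (ekappa s) (EMul (EInt (Z.of_nat s)) (ehsum s s))).
Definition body_dd (s : nat) (c : Z) : rexpr :=
  esub (EInt c) (EMul (EPow (ekappa s) 2) (EMul (EInt (Z.of_nat s)) (ehconv s))).

Definition er : rexpr :=
  EMul (esub (EInt 1) (EMul (EVar 0) (EVar 1))) (EInv (EAdd (EVar 0) (EVar 1))).
(** The complement of [p <= q <= r], [p + q + r <= 13 / 6], with [r] recovered from the relation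
    between [p, q, r]. At the point [3 i / 2] the sum [p + q + r] is [13 / 6]. *)
Definition eoutside : list rexpr :=
  [esub (EVar 0) (EVar 1); esub (EVar 1) er; esub (EAdd (EVar 0) (EAdd (EVar 1) er)) (ECst 13 6)].
(** Upper bounds are needed on the complete circle about the hexagonal point, where the least of the
    three may be negative; the lower bounds, in [narrow], only where it is not. *)
Definition wide : list itv := [irat (-15) 100 58 100; irat 28 100 116 100].
Definition narrow : list itv := [irat 0 1 58 100; irat 28 100 1 1].

Lemma itv_check_gap :
  bisect (positive_test eoutside (elets einverses (ehsums 6 body_gap))) 20 0 narrow = true.
Proof. vm_cast_no_check (eq_refl true). Qed.
Lemma itv_check_low :
  bisect (positive_test eoutside (elets einverses (ehsums 3 body_low))) 20 0 narrow = true.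
Proof. vm_cast_no_check (eq_refl true). Qed.
Lemma itv_check_d3 :
  bisect (positive_test eoutside (elets einverses (ehsums 3 (body_d 3 19)))) 20 0 wide = true.
Proof. vm_cast_no_check (eq_refl true). Qed.
Lemma itv_check_dd3 :
  bisect (positive_test eoutside (elets einverses (ehsums 3 (body_dd 3 57)))) 20 0 wide = true.
Proof. vm_cast_no_check (eq_refl true). Qed.
Lemma itv_check_d6 :
  bisect (positive_test eoutside (elets einverses (ehsums 6 (body_d 6 215)))) 20 0 wide = true.
Proof. vm_cast_no_check (eq_refl true). Qed.
Lemma itv_check_dd6 :
  bisect (positive_test eoutside (elets einverses (ehsums 6 (body_dd 6 1150)))) 20 0 wide = true.
Proof. vm_cast_no_check (eq_refl true). Qed.

Definition kap (a b c : R) : R := a * (b * c).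

Fixpoint hsum_env (s : nat) (a b c : R) (rest : list R) : list R :=
  match s with
  | O => 1 :: 1 :: 1 :: c :: b :: a :: rest
  | S m => hsum s a b c :: hsum2 s a b :: a ^ s :: hsum_env m a b c rest
  end.

Lemma hsum_env_nth s a b c rest :
  nth (3 * s + 3) (hsum_env s a b c rest) 0 = c /\
  nth (3 * s + 4) (hsum_env s a b c rest) 0 = b /\
  nth (3 * s + 5) (hsum_env s a b c rest) 0 = a.
Proof.
  induction s as [|s IH]; [simpl; auto|].
  replace (3 * S s + 3)%nat with (3 + (3 * s + 3))%nat by lia.
  replace (3 * S s + 4)%nat with (3 + (3 * s + 4))%nat by lia.
  replace (3 * S s + 5)%nat with (3 + (3 * s + 5))%nat by lia. exact IH.
Qed.

Lemma elets_app l l' t : elets (l ++ l') t = elets l (elets l' t).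
Proof. apply fold_right_app. Qed.

Lemma eval_ehsums s a b c rest t :
  eval (c :: b :: a :: rest) (ehsums s t) = eval (hsum_env s a b c rest) t.
Proof.
  unfold ehsums. change (eval (c :: b :: a :: rest) (elets [EInt 1; EInt 1; EInt 1] ?u))
    with (eval (hsum_env 0 a b c rest) u).
  revert t; induction s as [|s IH]; intro t; [reflexivity|].
  rewrite seq_S, flat_map_app, elets_app, IH. cbn [plus flat_map]. rewrite app_nil_r.
  destruct (hsum_env_nth s a b c rest) as (Hc & Hb & Ha).
  assert (H0 : exists u w z l, hsum_env s a b c rest = u :: w :: z :: l /\
    u = hsum s a b c /\ w = hsum2 s a b /\ z = a ^ s).
  { destruct s; repeat eexists. }
  destruct H0 as (u & w & z & l & E & -> & -> & ->).
  unfold ehsum_step, elets; cbn [fold_right eval].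
  change (1 + s)%nat with (S s). replace (3 * S s + 2)%nat with (3 * s + 5)%nat by lia.
  replace (nth (3 * s + 5) (hsum_env s a b c rest) 0) with a by auto.
  replace (3 * s + 5)%nat with (S (3 * s + 4)) by lia. cbn [nth].
  replace (nth (3 * s + 4) (hsum_env s a b c rest) 0) with b by auto.
  replace (3 * s + 4)%nat with (S (3 * s + 3)) by lia. cbn [nth].
  replace (nth (3 * s + 3) (hsum_env s a b c rest) 0) with c by auto.
  rewrite E; cbn [nth]. rewrite <- E. cbn [hsum_env hsum hsum2 pow].
  f_equal. f_equal; [ring|]. f_equal; [ring|]. f_equal; ring.
Qed.

Lemma eval_body_gap p q a b c : eval [c; b; a; p; q] (ehsums 6 body_gap) =
  kap a b c * (6 * hsum 6 a b c - 39 / 4 * hsum 3 a b c) - 33 / 10.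
Proof. rewrite eval_ehsums; reflexivity. Qed.
Lemma eval_body_low p q a b c : eval [c; b; a; p; q] (ehsums 3 body_low) =
  kap a b c * (3 * hsum 3 a b c) - 5.
Proof. rewrite eval_ehsums; reflexivity. Qed.
Lemma eval_body_d3 p q a b c z : eval [c; b; a; p; q] (ehsums 3 (body_d 3 z)) =
  IZR z - kap a b c * (3 * hsum 3 a b c).
Proof. rewrite eval_ehsums; reflexivity. Qed.
Lemma eval_body_d6 p q a b c z : eval [c; b; a; p; q] (ehsums 6 (body_d 6 z)) =
  IZR z - kap a b c * (6 * hsum 6 a b c).
Proof. rewrite eval_ehsums; reflexivity. Qed.
Lemma eval_body_dd3 p q a b c z : eval [c; b; a; p; q] (ehsums 3 (body_dd 3 z)) =
  IZR z - kap a b c ^ 2 * (3 * hconv 3 a b c).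
Proof. rewrite eval_ehsums; reflexivity. Qed.
Lemma eval_body_dd6 p q a b c z : eval [c; b; a; p; q] (ehsums 6 (body_dd 6 z)) =
  IZR z - kap a b c ^ 2 * (6 * hconv 6 a b c).
Proof. rewrite eval_ehsums; reflexivity. Qed.

Lemma eval_einverses p q r t : 0 < p + q -> 0 < p + r -> 0 < q + r -> p * q + q * r + r * p = 1 ->
  eval [p; q] (elets einverses t) = eval [/ (q + r); / (p + r); / (p + q); p; q] t.
Proof.
  intros H1 H2 H3 E. unfold elets, einverses; cbn [fold_right eval nth].
  (* [1 + p^2] factors as [(p + q) (p + r)], so the inverse is obtained without computing [r]. *)
  replace ((p + q) * / (1 + p ^ 2)) with (/ (p + r)).
  2: { replace (1 + p ^ 2) with ((p + q) * (p + r)) by (rewrite <- E; ring). field; lra. }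
  replace ((p + q) * / (1 + q ^ 2)) with (/ (q + r)).
  2: { replace (1 + q ^ 2) with ((p + q) * (q + r)) by (rewrite <- E; ring). field; lra. }
  reflexivity.
Qed.

Lemma sorted_bounds p q r : p <= q <= r -> p * q + q * r + r * p = 1 -> 0 < p + q ->
  p + q + r <= 13 / 6 -> -15 / 100 <= p <= 58 / 100 /\ 28 / 100 <= q <= 116 / 100.
Proof.
  intros [H1 H2] E Hs He.
  assert (P1 : p <= 58 / 100).
  { apply Rnot_lt_le; intro. assert (p * q + q * r + r * p >= 3 * p ^ 2) by nra. nra. }
  assert (P2 : -15 / 100 <= p).
  { apply Rnot_lt_le; intro Hp.
    (* The discriminant [(q - r)^2] of the quadratic with roots [q] and [r], in terms of [p] and the
       sum. *)
    assert (D : 0 <= (p + q + r) ^ 2 + 2 * (p + q + r) * p - 3 * p ^ 2 - 4).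
    { replace ((p + q + r) ^ 2 + 2 * (p + q + r) * p - 3 * p ^ 2 - 4) with
        ((q - r) ^ 2 + 4 * (p * q + q * r + r * p - 1)) by ring. pose proof (pow2_ge_0 (q - r)). lra. }
    nra. }
  assert (Q1 : 28 / 100 <= q).
  { apply Rnot_lt_le; intro Hq. set (s := p + q) in *.
    assert (p * q <= s ^ 2 / 4) by (unfold s; pose proof (pow2_ge_0 (p - q)); nra).
    assert (s * r <= s * (13 / 6 - s)) by (apply Rmult_le_compat_l; unfold s in *; lra).
    assert (1 <= s ^ 2 / 4 + s * (13 / 6 - s)) by (unfold s in *; nra).
    assert (s < 56 / 100) by (unfold s; lra). nra. }
  repeat split; lra.
Qed.

Lemma encl2_irat a b c d a' b' c' d' x y : (0 < b)%Z -> (0 < d)%Z -> (0 < b')%Z -> (0 < d')%Z ->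
  IZR a / IZR b <= x <= IZR c / IZR d -> IZR a' / IZR b' <= y <= IZR c' / IZR d' ->
  Forall2 encl [irat a b c d; irat a' b' c' d'] [x; y].
Proof.
  intros; constructor; [apply encl_irat; assumption|].
  constructor; [apply encl_irat; assumption|constructor].
Qed.

Lemma eval_outside p q r e : p <= q <= r -> p * q + q * r + r * p = 1 -> 0 < p + q ->
  p + q + r <= 13 / 6 -> In e eoutside -> eval [p; q] e <= 0.
Proof.
  intros [H1 H2] E Hs He Hin.
  assert (Er : (1 + - (p * q)) * / (p + q) = r).
  { replace (1 + - (p * q)) with (r * (p + q)) by (rewrite <- E; ring). field; lra. }
  unfold eoutside, er, esub in Hin; cbn [In] in Hin.
  destruct Hin as [<-|[<-|[<-|[]]]]; cbn [eval nth]; rewrite ?Er; lra.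
Qed.

Lemma sorted_facts p q r : p <= q <= r -> p * q + q * r + r * p = 1 -> 0 < p + q ->
  p + q + r <= 13 / 6 ->
  let a := / (p + q) in let b := / (p + r) in let c := / (q + r) in
  kap a b c * (3 * hsum 3 a b c) <= 19 /\ kap a b c ^ 2 * (3 * hconv 3 a b c) <= 57 /\
  kap a b c * (6 * hsum 6 a b c) <= 215 /\ kap a b c ^ 2 * (6 * hconv 6 a b c) <= 1150 /\
  (0 <= p -> 5 <= kap a b c * (3 * hsum 3 a b c) /\
   33 / 10 <= kap a b c * (6 * hsum 6 a b c) - 13 / 4 * (kap a b c * (3 * hsum 3 a b c))).
Proof.
  intros Ho E Hs He a b c. destruct (sorted_bounds p q r Ho E Hs He) as [Hp Hq].
  pose proof (fun e H => eval_outside p q r e Ho E Hs He H) as Out.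
  assert (W : Forall2 encl wide [p; q]) by (apply encl2_irat; (lia || lra)).
  assert (F : forall t g, bisect (positive_test eoutside (elets einverses t)) 20 0 wide = true ->
    eval [c; b; a; p; q] t = g -> 0 < g).
  { intros t g HB <-. unfold a, b, c. rewrite <- (eval_einverses p q r t) by lra.
    apply (bisect_positive _ _ _ _ _ HB W Out). }
  pose proof (F _ _ itv_check_d3 (eval_body_d3 _ _ _ _ _ _)).
  pose proof (F _ _ itv_check_dd3 (eval_body_dd3 _ _ _ _ _ _)).
  pose proof (F _ _ itv_check_d6 (eval_body_d6 _ _ _ _ _ _)).
  pose proof (F _ _ itv_check_dd6 (eval_body_dd6 _ _ _ _ _ _)).
  split; [lra|]. split; [lra|]. split; [lra|]. split; [lra|].
  intro Hp0.
  assert (N : Forall2 encl narrow [p; q]).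
  (* The bound [q <= 1] comes from [q^2 <= q r <= 1]. *)
  { apply encl2_irat; (lia || lra || idtac). split; [lra|]. nra. }
  assert (G : forall t g, bisect (positive_test eoutside (elets einverses t)) 20 0 narrow = true ->
    eval [c; b; a; p; q] t = g -> 0 < g).
  { intros t g HB <-. unfold a, b, c. rewrite <- (eval_einverses p q r t) by lra.
    apply (bisect_positive _ _ _ _ _ HB N Out). }
  pose proof (G _ _ itv_check_low (eval_body_low _ _ _ _ _)).
  pose proof (G _ _ itv_check_gap (eval_body_gap _ _ _ _ _)).
  split; [lra|]. lra.
Qed.

(** * Three real roots *)

Lemma cos_3 t : cos (3 * t) = 4 * cos t ^ 3 - 3 * cos t.
Proof.
  replace (3 * t) with (2 * t + t) by ring. rewrite cos_plus, cos_2a, sin_2a.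
  pose proof (sin2_cos2 t) as H. unfold Rsqr in H.
  replace (sin t * sin t) with (1 - cos t * cos t) by lra.
  replace (2 * sin t * cos t * sin t) with (2 * (sin t * sin t) * cos t) by ring.
  replace (sin t * sin t) with (1 - cos t * cos t) by lra. ring.
Qed.

(** Viete's solution of [4 u^3 - 3 u = C]: the roots are the cosines of [t] and [t] plus or minus a
    third of a turn, where [cos (3 t) = C]. *)
Lemma trisection C : -1 <= C <= 1 -> exists u v w,
  -1 <= u <= 1 /\ -1 <= v <= 1 /\ -1 <= w <= 1 /\
  u + v + w = 0 /\ u * v + v * w + w * u = - 3 / 4 /\ u * v * w = C / 4.
Proof.
  intro HC. set (t := acos C / 3).
  assert (E : cos (3 * t) = C).
  { unfold t. replace (3 * (acos C / 3)) with (acos C) by field. apply cos_acos; lra. }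
  rewrite cos_3 in E. pose proof (sin2_cos2 t) as S. unfold Rsqr in S.
  set (c := cos t) in *. set (s := sin t) in *.
  assert (H3 : sqrt 3 * sqrt 3 = 3) by (apply sqrt_sqrt; lra). set (k := sqrt 3) in *.
  assert (B : forall z, z * z <= 1 -> -1 <= z <= 1) by (intros; nra).
  exists c, (- c / 2 + k * s / 2), (- c / 2 - k * s / 2).
  assert (K : k * s * (k * s) = 3 * (1 - c * c)).
  { replace (k * s * (k * s)) with (k * k * (s * s)) by ring. rewrite H3. lra. }
  split; [apply B; pose proof (Rle_0_sqr s); unfold Rsqr in *; nra|].
  split; [apply B; pose proof (Rle_0_sqr (k * c + s)); unfold Rsqr in *; nra|].
  split; [apply B; pose proof (Rle_0_sqr (k * c - s)); unfold Rsqr in *; nra|].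
  split; [field|]. split; [nra|].
  replace (c * (- c / 2 + k * s / 2) * (- c / 2 - k * s / 2)) with (c * (c * c - k * s * (k * s)) / 4) by field.
  rewrite K. lra.
Qed.

Lemma sort3 A B C : exists A' B' C', A' <= B' <= C' /\ A' + B' + C' = A + B + C /\
  A' * B' + B' * C' + C' * A' = A * B + B * C + C * A /\ A' * B' * C' = A * B * C /\
  (forall P : R -> Prop, P A -> P B -> P C -> P A' /\ P B' /\ P C').
Proof.
  destruct (Rle_dec A B), (Rle_dec B C), (Rle_dec A C); try lra.
  - exists A, B, C; repeat split; auto; lra.
  - exists A, C, B; repeat split; auto; try lra; ring.
  - exists C, A, B; repeat split; auto; try lra; ring.
  - exists B, A, C; repeat split; auto; try lra; ring.
  - exists B, C, A; repeat split; auto; try lra; ring.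
  - exists C, B, A; repeat split; auto; try lra; ring.
Qed.

Definition kcub (e X : R) : R := 2 / 27 * (e ^ 3 + 9 * e + X).

(** The roots are [2/3 (e + rho u)] with [u] from the trisection of [X / rho^3]; they are positive
    since [rho < e]. *)
Lemma real_roots e rho X : 0 <= rho -> 0 < e -> e ^ 2 = 3 + rho ^ 2 -> Rabs X <= rho ^ 3 ->
  exists A B C, 0 < A /\ A <= B <= C /\ A + B + C = 2 * e /\
    A * B + B * C + C * A = e ^ 2 + 1 /\ A * B * C = kcub e X.
Proof.
  intros Hr He E HX.
  assert (HC : exists C, -1 <= C <= 1 /\ X = rho ^ 3 * C).
  { destruct (Req_dec rho 0) as [->|Hr0].
    - exists 0; split; [lra|]. replace (0 ^ 3) with 0 in * by ring.
      rewrite Rmult_0_l. destruct (Req_dec X 0); auto. pose proof (Rabs_pos_lt X H); lra.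
    - assert (P : 0 < rho ^ 3) by (apply pow_lt; lra).
      exists (X / rho ^ 3). apply Rabs_le_between in HX.
      assert (X = rho ^ 3 * (X / rho ^ 3)) by (field; lra). split; [nra|assumption]. }
  destruct HC as (C & HC & ->).
  destruct (trisection C HC) as (u & v & w & Hu & Hv & Hw & E1 & E2 & E3).
  assert (Hre : rho < e) by nra.
  destruct (sort3 (2 / 3 * (e + rho * u)) (2 / 3 * (e + rho * v)) (2 / 3 * (e + rho * w)))
    as (A' & B' & C' & S0 & S1 & S2 & S3 & S4).
  destruct (S4 (fun z => 0 < z)) as (P1 & P2 & P3); try nra.
  exists A', B', C'. split; [assumption|]. split; [assumption|].
  rewrite S1, S2, S3. split; [|split].
  - replace (2 / 3 * (e + rho * u) + 2 / 3 * (e + rho * v) + 2 / 3 * (e + rho * w)) with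
      (2 * e + 2 / 3 * rho * (u + v + w)) by field. rewrite E1; ring.
  - replace (2 / 3 * (e + rho * u) * (2 / 3 * (e + rho * v)) + 2 / 3 * (e + rho * v) * (2 / 3 * (e + rho * w)) +
      2 / 3 * (e + rho * w) * (2 / 3 * (e + rho * u))) with
      (4 / 3 * e ^ 2 + 8 / 9 * e * rho * (u + v + w) + 4 / 9 * rho ^ 2 * (u * v + v * w + w * u)) by field.
    rewrite E1, E2. replace (rho ^ 2) with (e ^ 2 - 3) by lra. field.
  - unfold kcub.
    replace (2 / 3 * (e + rho * u) * (2 / 3 * (e + rho * v)) * (2 / 3 * (e + rho * w))) with
      (8 / 27 * (e ^ 3 + e ^ 2 * rho * (u + v + w) + e * rho ^ 2 * (u * v + v * w + w * u) + rho ^ 3 * (u * v * w))) by field.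
    rewrite E1, E2, E3. replace (e * rho ^ 2) with (e ^ 3 - 3 * e) by (replace (rho ^ 2) with (e ^ 2 - 3) by lra; ring). field.
Qed.


(** Every admissible product belongs to some actual triple, namely that of [real_roots], to which
    the interval checks apply; the signs come from the positivity of the homogeneous sums. *)
Lemma phi_bounds e rho X : 0 <= rho -> 0 < e <= 13 / 6 -> e ^ 2 = 3 + rho ^ 2 -> Rabs X <= rho ^ 3 ->
  let a := e ^ 2 + 1 in let K := kcub e X in
  0 < K /\ -19 <= dphi3 a e K <= 0 /\ 0 <= ddphi3 a e K <= 57 /\
  -215 <= dphi6 a e K <= 0 /\ 0 <= ddphi6 a e K <= 1150 /\
  (K <= e -> dphi3 a e K <= -5 /\ dphi6 a e K - 13 / 4 * dphi3 a e K <= - 33 / 10).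
Proof.
  intros Hr [He He'] E HX a K.
  destruct (real_roots e rho X Hr He E HX) as (A & B & C & HA & HABC & S1 & S2 & S3).
  assert (Ee : e = (A + B + C) / 2) by lra.
  assert (Ea : a = A * B + B * C + C * A) by (unfold a; lra).
  assert (EK : K = A * B * C) by (unfold K; lra).
  clearbody a K.
  assert (HK : 0 < A * B * C) by (repeat apply Rmult_lt_0_compat; lra).
  pose proof (sorted_facts (e - C) (e - B) (e - A) ltac:(lra)) as F.
  replace (e - C + (e - B)) with A in F by lra.
  replace (e - C + (e - A)) with B in F by lra.
  replace (e - B + (e - A)) with C in F by lra.
  cbv zeta in F.
  specialize (F ltac:(nra) HA ltac:(lra)).
  destruct F as (F1 & F2 & F3 & F4 & F5). unfold kap in *.
  assert (D3 := dphi3_hsum A B C HA ltac:(lra) ltac:(lra)).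
  assert (D6 := dphi6_hsum A B C HA ltac:(lra) ltac:(lra)).
  assert (DD3 := ddphi3_hconv A B C HA ltac:(lra) ltac:(lra)).
  assert (DD6 := ddphi6_hconv A B C HA ltac:(lra) ltac:(lra)).
  rewrite <- Ea, <- Ee, <- EK in D3, D6, DD3, DD6. rewrite D3, D6, DD3, DD6.
  assert (IA : 0 < / A) by (apply Rinv_0_lt_compat; lra).
  assert (IB : 0 < / B) by (apply Rinv_0_lt_compat; lra).
  assert (IC : 0 < / C) by (apply Rinv_0_lt_compat; lra).
  assert (Kp : 0 < / A * (/ B * / C)) by (repeat apply Rmult_lt_0_compat; assumption).
  assert (Hh2 : forall n, 0 <= hsum2 n (/ A) (/ B)).
  { induction n; cbn [hsum2]; [lra|]. apply Rplus_le_le_0_compat; [apply pow_le; lra|].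
    apply Rmult_le_pos; lra. }
  assert (Hh : forall n, 0 <= hsum n (/ A) (/ B) (/ C)).
  { induction n; cbn [hsum]; [lra|]. apply Rplus_le_le_0_compat; [apply Hh2|].
    apply Rmult_le_pos; lra. }
  assert (Hc : forall n, 0 <= hconv n (/ A) (/ B) (/ C)).
  { intro n. unfold hconv. generalize (seq 0 (S n)); intro l; induction l; simpl; [lra|].
    apply Rplus_le_le_0_compat; [apply Rmult_le_pos; apply Hh|assumption]. }
  set (k := / A * (/ B * / C)) in *.
  assert (0 <= k * (3 * hsum 3 (/ A) (/ B) (/ C))) by (apply Rmult_le_pos; [lra|pose proof (Hh 3%nat); lra]).
  assert (0 <= k * (6 * hsum 6 (/ A) (/ B) (/ C))) by (apply Rmult_le_pos; [lra|pose proof (Hh 6%nat); lra]).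
  assert (0 <= k ^ 2 * (3 * hconv 3 (/ A) (/ B) (/ C))) by (apply Rmult_le_pos; [apply pow2_ge_0|pose proof (Hc 3%nat); lra]).
  assert (0 <= k ^ 2 * (6 * hconv 6 (/ A) (/ B) (/ C))) by (apply Rmult_le_pos; [apply pow2_ge_0|pose proof (Hc 6%nat); lra]).
  split; [lra|]. split; [lra|]. split; [lra|]. split; [lra|]. split; [lra|].
  (* [(e - A) (e - B) (e - C) = e - K], and for [e < C] the first two factors have a product above
     [1], which would force [K > e]. *)
  intro HKe. assert (Hp : 0 <= e - C).
  { apply Rnot_lt_le; intro Hp.
    assert (Q1 : (e - A) * (e - B) = 1 + (C - e) * (2 * e - A - B)) by nra.
    assert (Q2 : (e - A) * (e - B) * (e - C) = e - K).
    { rewrite EK. replace (e - A * B * C) with (e ^ 3 - (A + B + C) * e ^ 2 + (A * B + B * C + C * A) * e - A * B * C);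
        [ring|]. rewrite S1, S2; ring. }
    assert (W : 0 < (C - e) * (2 * e - A - B)) by (apply Rmult_lt_0_compat; lra).
    rewrite Q1 in Q2.
    assert (0 < (1 + (C - e) * (2 * e - A - B)) * (C - e)) by (apply Rmult_lt_0_compat; lra).
    lra. }
  specialize (F5 Hp); lra.
Qed.

(** * Rotation about the hexagonal point *)

Lemma is_derive_le_bound (f d : R -> R) a b M : a <= b ->
  (forall t, a <= t <= b -> is_derive f t (d t) /\ Rabs (d t) <= M) ->
  Rabs (f b - f a) <= M * (b - a).
Proof.
  intros Hab H. destruct (Req_dec a b) as [->|Hne].
  { rewrite !Rminus_diag, Rabs_R0; lra. }
  destruct (MVT_cor2 f d a b ltac:(lra)) as (c & E & Hc).
  - intros t Ht; apply is_derive_Reals, H, Ht.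
  - rewrite E, Rabs_mult, (Rabs_pos_eq (b - a)) by lra.
    apply Rmult_le_compat_r; [lra|apply H; lra].
Qed.

Lemma is_derive_abs_diff (f d : R -> R) a b M r : Rabs a <= r -> Rabs b <= r ->
  (forall t, Rabs t <= r -> is_derive f t (d t) /\ Rabs (d t) <= M) ->
  Rabs (f b - f a) <= M * Rabs (b - a).
Proof.
  intros Ha Hb H. apply Rabs_le_between in Ha; apply Rabs_le_between in Hb.
  destruct (Rle_dec a b).
  - rewrite (Rabs_pos_eq (b - a)) by lra. apply (is_derive_le_bound f d); [lra|].
    intros t Ht; apply H, Rabs_le; lra.
  - rewrite (Rabs_minus_sym (f b)), (Rabs_minus_sym b), (Rabs_pos_eq (a - b)) by lra.
    apply (is_derive_le_bound f d); [lra|]. intros t Ht; apply H, Rabs_le; lra.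
Qed.

Section Rotation.
Variables (f f1 f2 : R -> R) (r N1 N2 g h : R).
Hypothesis Hr : 0 <= r.
Hypothesis Hgh : g ^ 2 + h ^ 2 = 1.
Hypothesis H1 : forall X, Rabs X <= r -> is_derive f X (f1 X) /\ Rabs (f1 X) <= N1.
Hypothesis H2 : forall X, Rabs X <= r -> is_derive f1 X (f2 X) /\ Rabs (f2 X) <= N2.

(** With [(g, h) = (cos c, sin c)] this is [f (r cos (t - c)) + f (r cos (t + c))]. It is even in
    [t], so its derivative vanishes at the ends like [sin t], and it is Lipschitz in [cos t]
    although the two summands separately need not be. *)
Let F (t : R) : R := f (r * (g * cos t + h * sin t)) + f (r * (g * cos t - h * sin t)).
Let B : R := 2 * (N1 + r * N2) * r.

Lemma rotation_arg t : Rabs (r * (g * cos t + h * sin t)) <= r /\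
  Rabs (r * (g * cos t - h * sin t)) <= r.
Proof.
  pose proof (sin2_cos2 t) as S; unfold Rsqr in S. set (s := sin t) in *; set (c := cos t) in *.
  assert (Hu : forall u, u ^ 2 <= 1 -> Rabs (r * u) <= r).
  { intros u Hu. rewrite Rabs_mult, (Rabs_pos_eq r) by assumption.
    assert (Rabs u <= 1) by (apply Rabs_le; nra). nra. }
  split; apply Hu.
  - pose proof (pow2_ge_0 (g * s - h * c)).
    replace ((g * c + h * s) ^ 2) with ((g ^ 2 + h ^ 2) * (s * s + c * c) - (g * s - h * c) ^ 2) by ring.
    rewrite Hgh, S; lra.
  - pose proof (pow2_ge_0 (g * s + h * c)).
    replace ((g * c - h * s) ^ 2) with ((g ^ 2 + h ^ 2) * (s * s + c * c) - (g * s + h * c) ^ 2) by ring.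
    rewrite Hgh, S; lra.
Qed.

(** The part of the derivative without a factor [sin t] carries [f1 X1 - f1 X2], and
    [X1 - X2 = 2 r h sin t] restores the factor; this is where the second derivative enters. *)
Lemma rotation_derive t : 0 <= sin t ->
  exists d, is_derive F t d /\ Rabs d <= B * sin t.
Proof.
  intro Hs. destruct (rotation_arg t) as [A1 A2].
  destruct (H1 _ A1) as [D1 E1], (H1 _ A2) as [D2 E2].
  pose proof (sin2_cos2 t) as S; unfold Rsqr in S.
  assert (P1 : is_derive (fun t => r * (g * cos t + h * sin t)) t (r * (- g * sin t + h * cos t)))
    by (auto_derive; [exact I|ring]).
  assert (P2 : is_derive (fun t => r * (g * cos t - h * sin t)) t (r * (- g * sin t - h * cos t)))
    by (auto_derive; [exact I|ring]).
  eexists; split.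
  { exact (is_derive_plus _ _ _ _ _ (is_derive_comp f _ _ _ _ D1 P1) (is_derive_comp f _ _ _ _ D2 P2)). }
  unfold plus, scal; simpl; unfold mult; simpl.
  set (X1 := r * (g * cos t + h * sin t)) in *. set (X2 := r * (g * cos t - h * sin t)) in *.
  pose proof (is_derive_abs_diff f1 f2 X2 X1 N2 r A2 A1 H2) as L.
  replace (X1 - X2) with (2 * r * (h * sin t)) in L by (unfold X1, X2; ring).
  set (s := sin t) in *; set (c := cos t) in *.
  replace (r * (- g * s + h * c) * f1 X1 + r * (- g * s - h * c) * f1 X2) with
    (r * (- (g * s) * (f1 X1 + f1 X2) + h * c * (f1 X1 - f1 X2))) by ring.
  assert (G1 : Rabs g <= 1) by (apply Rabs_le; nra).
  assert (G2 : Rabs h <= 1) by (apply Rabs_le; nra).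
  assert (G3 : Rabs c <= 1) by (apply Rabs_le; nra).
  assert (N20 : 0 <= N2) by (destruct (H2 X1 A1) as [_ Hx]; pose proof (Rabs_pos (f2 X1)); lra).
  assert (L' : Rabs (f1 X1 - f1 X2) <= N2 * (2 * r * s)).
  { eapply Rle_trans; [exact L|]. apply Rmult_le_compat_l; [assumption|].
    rewrite !Rabs_mult, (Rabs_pos_eq 2), (Rabs_pos_eq r), (Rabs_pos_eq s) by lra.
    apply Rmult_le_compat_l; [lra|]. nra. }
  assert (T1 : Rabs (- (g * s) * (f1 X1 + f1 X2)) <= s * (2 * N1)).
  { rewrite Rabs_mult, Rabs_Ropp, Rabs_mult, (Rabs_pos_eq s) by assumption.
    pose proof (Rabs_triang (f1 X1) (f1 X2)).
    apply Rmult_le_compat; try apply Rabs_pos; [|nra|lra].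
    apply Rmult_le_pos; [apply Rabs_pos|assumption]. }
  assert (T2 : Rabs (h * c * (f1 X1 - f1 X2)) <= N2 * (2 * r * s)).
  { rewrite !Rabs_mult.
    assert (Rabs h * Rabs c <= 1) by (pose proof (Rabs_pos h); pose proof (Rabs_pos c); nra).
    pose proof (Rabs_pos (f1 X1 - f1 X2)). pose proof (Rmult_le_pos _ _ (Rabs_pos h) (Rabs_pos c)). nra. }
  rewrite Rabs_mult, (Rabs_pos_eq r) by assumption. unfold B.
  replace (2 * (N1 + r * N2) * r * s) with (r * (s * (2 * N1) + N2 * (2 * r * s))) by ring.
  apply Rmult_le_compat_l; [assumption|]. eapply Rle_trans; [apply Rabs_triang|]. lra.
Qed.

Lemma rotation_bound t t' : 0 <= t <= t' -> t' <= PI ->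
  Rabs (F t' - F t) <= B * (cos t - cos t').
Proof.
  intros Ht Ht'. destruct (Req_dec t t') as [->|Hne].
  { rewrite !Rminus_diag, Rabs_R0; lra. }
  assert (D : forall u, t <= u <= t' -> is_derive F u (Derive F u) /\ Rabs (Derive F u) <= B * sin u).
  { intros u Hu. destruct (rotation_derive u) as (d & D1 & D2); [apply sin_ge_0; lra|].
    rewrite (is_derive_unique _ _ _ D1); split; assumption. }
  assert (G : forall k, k = 1 \/ k = -1 -> 0 <= k * (F t' - F t) + B * (cos t - cos t')).
  { intros k Hk.
    destruct (MVT_cor2 (fun u => k * F u - B * cos u) (fun u => k * Derive F u + B * sin u) t t' ltac:(lra))
      as (c & E & Hc).
    - intros u Hu. apply is_derive_Reals. destruct (D u Hu) as [D1 _].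
      pose proof (is_derive_scal _ _ k _ D1) as S1.
      assert (S2 : is_derive (fun u => B * cos u) u (- (B * sin u))) by (auto_derive; [exact I|ring]).
      pose proof (is_derive_minus _ _ _ _ _ S1 S2) as S3.
      evar_last; [exact S3|]. unfold minus, plus, opp; simpl. ring.
    - destruct (D c ltac:(lra)) as [_ D2]. apply Rabs_le_between in D2.
      assert (0 <= k * Derive F c + B * sin c) by (destruct Hk; subst; lra).
      assert (0 <= (k * Derive F c + B * sin c) * (t' - t)) by (apply Rmult_le_pos; lra).
      lra. }
  pose proof (G 1 ltac:(auto)); pose proof (G (-1) ltac:(auto)). apply Rabs_le; lra.
Qed.

Lemma rotation_points X Y X' Y' : 0 <= Y -> 0 <= Y' -> X ^ 2 + Y ^ 2 = r ^ 2 -> X' ^ 2 + Y' ^ 2 = r ^ 2 ->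
  X' <= X ->
  Rabs (f (g * X' + h * Y') + f (g * X' - h * Y') - (f (g * X + h * Y) + f (g * X - h * Y)))
  <= 2 * (N1 + r * N2) * (X - X').
Proof.
  intros HY HY' E E' HX. destruct (Req_dec r 0) as [R0|R0].
  { assert (X = 0 /\ Y = 0 /\ X' = 0 /\ Y' = 0) as (-> & -> & -> & ->) by (rewrite R0 in *; repeat split; nra).
    rewrite !Rminus_diag, Rabs_R0; lra. }
  assert (Hr' : 0 < r) by lra.
  assert (P : forall X Y, 0 <= Y -> X ^ 2 + Y ^ 2 = r ^ 2 ->
    X = r * cos (acos (X / r)) /\ Y = r * sin (acos (X / r)) /\ -1 <= X / r <= 1).
  { intros x y Hy Exy.
    assert (Hx : -1 <= x / r <= 1).
    { assert (Ex : x = x / r * r) by (field; lra). set (w := x / r) in *.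
      assert (w ^ 2 <= 1); [|nra]. assert (w ^ 2 * r ^ 2 <= 1 * r ^ 2) by (rewrite Ex in Exy; nra).
      apply Rmult_le_reg_r with (r ^ 2); [apply pow_lt; lra|assumption]. }
    rewrite cos_acos, sin_acos by assumption. split; [field; lra|]. split; [|assumption].
    rewrite <- (sqrt_pow2 y Hy).
    replace (y ^ 2) with (r ^ 2 * (1 - Rsqr (x / r))) by (unfold Rsqr; field_simplify_eq; [lra|lra]).
    rewrite sqrt_mult by (try apply pow2_ge_0; unfold Rsqr; nra). rewrite sqrt_pow2; lra. }
  destruct (P X Y HY E) as (EX & EY & B1), (P X' Y' HY' E') as (EX' & EY' & B1').
  set (t := acos (X / r)) in *. set (t' := acos (X' / r)) in *.
  assert (Ht : 0 <= t <= PI) by apply acos_bound. assert (Ht' : 0 <= t' <= PI) by apply acos_bound.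
  assert (Htt : t <= t').
  { apply Rnot_lt_le; intro Hlt.
    pose proof (cos_decreasing_1 t' t ltac:(lra) ltac:(lra) ltac:(lra) ltac:(lra) Hlt). nra. }
  pose proof (rotation_bound t t' ltac:(lra) ltac:(lra)) as RB. unfold F, B in RB.
  replace (r * (g * cos t' + h * sin t')) with (g * X' + h * Y') in RB by (rewrite EX' at 1; rewrite EY' at 1; ring).
  replace (r * (g * cos t' - h * sin t')) with (g * X' - h * Y') in RB by (rewrite EX' at 1; rewrite EY' at 1; ring).
  replace (r * (g * cos t + h * sin t)) with (g * X + h * Y) in RB by (rewrite EX at 1; rewrite EY at 1; ring).
  replace (r * (g * cos t - h * sin t)) with (g * X - h * Y) in RB by (rewrite EX at 1; rewrite EY at 1; ring).
  replace (2 * (N1 + r * N2) * r * (cos t - cos t')) with (2 * (N1 + r * N2) * (X - X')) in RB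
    by (rewrite EX at 1; rewrite EX' at 1; ring).
  exact RB.
Qed.
End Rotation.

(** * Triple sums over the hexagonal rotations *)

Definition tq (p q r a b c : R) : R := p * a ^ 2 + q * b ^ 2 + r * c ^ 2.
(* With a primitive cube root of unity [w], up to conjugation: [coX], [coV] are the real and (up to the factor
   [sqrt (27/4)]) imaginary part of [(p + q w + r w^2)^3] when [p q + q r + r p = 1], and [xiR], [xiI]
   those of [(a^2 + b^2 w + c^2 w^2)^3] with [c = - (a + b)]. *)
Definition coX (p q r : R) : R := (27 * (p * q * r) + 2 * (p + q + r) ^ 3 - 9 * (p + q + r)) / 2.
Definition coV (p q r : R) : R := (p - q) * (q - r) * (r - p).
Definition xiR (a b : R) : R := 27 / 2 * (a * b * (a + b)) ^ 2 - (a ^ 2 + a * b + b ^ 2) ^ 3.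
Definition xiI (a b : R) : R := (a - b) * (2 * a + b) * (a + 2 * b) * (a * b * (a + b)).

(** By Fourier transform on three points the values are [2/3 (N e + Re (w^j P Q'))], where
    [P = p + q w + r w^2] and [Q'] is the conjugate of [a^2 + b^2 w + c^2 w^2]. Only the product
    feels the argument of [P Q'], through the real part of its cube. *)
Lemma triple_product p q r a b : p * q + q * r + r * p = 1 ->
  let c := - (a + b) in let e := p + q + r in let N := a ^ 2 + a * b + b ^ 2 in
  tq p q r a b c + tq p q r b c a + tq p q r c a b = N * (2 * e) /\
  tq p q r a b c * tq p q r b c a + tq p q r b c a * tq p q r c a b + tq p q r c a b * tq p q r a b c
    = N ^ 2 * (e ^ 2 + 1) /\
  tq p q r a b c * tq p q r b c a * tq p q r c a b =
  2 / 27 * (N ^ 3 * (e ^ 3 + 9 * e) + xiR a b * coX p q r - 27 / 4 * xiI a b * coV p q r).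
Proof.
  intros E c e N. unfold tq, c, e, N. split; [ring|]. split.
  - transitivity ((a ^ 2 + a * b + b ^ 2) ^ 2 * ((p + q + r) ^ 2 + (p * q + q * r + r * p))); [ring|rewrite E; ring].
  - assert (X : coX p q r = (27 * (p * q * r) + 2 * (p + q + r) ^ 3 - 9 * (p + q + r) * (p * q + q * r + r * p)) / 2)
      by (unfold coX; rewrite E; field).
    rewrite X. transitivity (2 / 27 * ((a ^ 2 + a * b + b ^ 2) ^ 3 * ((p + q + r) ^ 3 + 9 * (p + q + r) * (p * q + q * r + r * p)) +
      xiR a b * ((27 * (p * q * r) + 2 * (p + q + r) ^ 3 - 9 * (p + q + r) * (p * q + q * r + r * p)) / 2) -
      27 / 4 * xiI a b * coV p q r)); [unfold coV, xiR, xiI; field|rewrite E; field].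
Qed.

Lemma xi_norm a b : xiR a b ^ 2 + 27 / 4 * xiI a b ^ 2 = (a ^ 2 + a * b + b ^ 2) ^ 6.
Proof. unfold xiR, xiI; field. Qed.

Lemma co_norm p q r : p * q + q * r + r * p = 1 ->
  coX p q r ^ 2 + 27 / 4 * coV p q r ^ 2 = ((p + q + r) ^ 2 - 3) ^ 3.
Proof.
  intro E.
  assert (X : coX p q r = (27 * (p * q * r) + 2 * (p + q + r) ^ 3 - 9 * (p + q + r) * (p * q + q * r + r * p)) / 2)
    by (unfold coX; rewrite E; field).
  transitivity (((p + q + r) ^ 2 - 3 * (p * q + q * r + r * p)) ^ 3); [|rewrite E; ring].
  rewrite X; unfold coV; field.
Qed.

Definition triple (s : nat) (p q r a b : R) : R :=
  let c := - (a + b) in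
  (/ tq p q r a b c) ^ s + (/ tq p q r b c a) ^ s + (/ tq p q r c a b) ^ s.
(** Exchanging [a] and [b] reverses the sign of [xiI], so the sum has the even shape for which the
    rotation bound holds. *)
Definition sextuple (s : nat) (p q r a b : R) : R := triple s p q r a b + triple s p q r b a.
Definition hexn (a b : R) : R := a ^ 2 + a * b + b ^ 2.

Lemma tq_pos p q r a b : 0 <= p -> 0 <= q -> 0 <= r -> p * q + q * r + r * p = 1 ->
  0 < hexn a b -> 0 < tq p q r a b (- (a + b)).
Proof.
  intros Hp Hq Hr E HN.
  assert (Hs : 0 < p + q + r) by nra.
  assert (I : (p + q + r) * tq p q r a b (- (a + b)) = (p * q + q * r + r * p) * hexn a b +
    ((p * a - q * b) ^ 2 + (q * b + r * (a + b)) ^ 2 + (- r * (a + b) - p * a) ^ 2) / 2)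
    by (unfold tq, hexn; field).
  rewrite E, Rmult_1_l in I.
  pose proof (pow2_ge_0 (p * a - q * b)). pose proof (pow2_ge_0 (q * b + r * (a + b))).
  pose proof (pow2_ge_0 (- r * (a + b) - p * a)).
  apply Rmult_lt_reg_l with (p + q + r); lra.
Qed.

Definition pfun (s : nat) : R -> R -> R -> R := match s with 3%nat => phi3 | _ => phi6 end.

(** After division by the hexagonal norm the first two symmetric functions are the same for all
    vectors, so a single function of the product serves them all. *)
Lemma triple_phi s p q r a b : s = 3%nat \/ s = 6%nat ->
  0 <= p -> 0 <= q -> 0 <= r -> p * q + q * r + r * p = 1 -> 0 < hexn a b ->
  let e := p + q + r in
  triple s p q r a b = (/ hexn a b) ^ s * pfun s (e ^ 2 + 1) e
    (kcub e (xiR a b / hexn a b ^ 3 * coX p q r - 27 / 4 * (xiI a b / hexn a b ^ 3) * coV p q r)).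
Proof.
  intros Hs Hp Hq Hr E HN e. set (N := hexn a b) in *. set (c := - (a + b)).
  pose proof (triple_product p q r a b E) as T. cbv zeta in T. fold N c e in T.
  change (a ^ 2 + a * b + b ^ 2) with N in T. destruct T as (T1 & T2 & T3).
  assert (P1 : 0 < tq p q r a b c) by (apply tq_pos; assumption).
  assert (P2 : 0 < tq p q r b c a).
  { replace a with (- (b + c)) by (unfold c; ring). apply tq_pos; auto. unfold N, hexn, c in *; nra. }
  assert (P3 : 0 < tq p q r c a b).
  { replace b with (- (c + a)) by (unfold c; ring). apply tq_pos; auto. unfold N, hexn, c in *; nra. }
  unfold triple. fold c.
  set (Q1 := tq p q r a b c) in *; set (Q2 := tq p q r b c a) in *; set (Q3 := tq p q r c a b) in *.
  set (A := Q1 / N); set (B := Q2 / N); set (C := Q3 / N).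
  assert (HA : 0 < A) by (apply Rdiv_lt_0_compat; assumption).
  assert (HB : 0 < B) by (apply Rdiv_lt_0_compat; assumption).
  assert (HC : 0 < C) by (apply Rdiv_lt_0_compat; assumption).
  assert (S1 : (A + B + C) / 2 = e).
  { unfold A, B, C. replace ((Q1 / N + Q2 / N + Q3 / N) / 2) with ((Q1 + Q2 + Q3) / (2 * N)) by (field; lra).
    rewrite T1; field; lra. }
  assert (S2 : A * B + B * C + C * A = e ^ 2 + 1).
  { unfold A, B, C. replace (Q1 / N * (Q2 / N) + Q2 / N * (Q3 / N) + Q3 / N * (Q1 / N)) with
      ((Q1 * Q2 + Q2 * Q3 + Q3 * Q1) / N ^ 2) by (field; lra). rewrite T2; field; lra. }
  assert (S3 : A * B * C = kcub e (xiR a b / N ^ 3 * coX p q r - 27 / 4 * (xiI a b / N ^ 3) * coV p q r)).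
  { unfold A, B, C, kcub. replace (Q1 / N * (Q2 / N) * (Q3 / N)) with (Q1 * Q2 * Q3 / N ^ 3) by (field; lra).
    rewrite T3; field; lra. }
  rewrite <- S3, <- S2, <- S1.
  replace (/ Q1) with (/ N * / A) by (unfold A; field; lra).
  replace (/ Q2) with (/ N * / B) by (unfold B; field; lra).
  replace (/ Q3) with (/ N * / C) by (unfold C; field; lra).
  rewrite !Rpow_mult_distr.
  destruct Hs as [-> | ->]; cbn [pfun]; [rewrite phi3_powersum by assumption|rewrite phi6_powersum by assumption]; ring.
Qed.

Lemma hexn_sym a b : hexn b a = hexn a b.
Proof. unfold hexn; ring. Qed.
Lemma xiR_sym a b : xiR b a = xiR a b.
Proof. unfold xiR; ring. Qed.
Lemma xiI_sym a b : xiI b a = - xiI a b.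
Proof. unfold xiI; ring. Qed.

(* The circle of radius [rho], [rho^2 = e^2 - 3], about the hexagonal point: both positions compared
   have the same [e = p + q + r]. *)
Record position (e rho p q r : R) : Prop := {
  pos_p : 0 <= p; pos_q : 0 <= q; pos_r : 0 <= r;
  pos_e2 : p * q + q * r + r * p = 1;
  pos_e : p + q + r = e;
  pos_le : e <= 13 / 6;
  pos_rho : 0 <= rho;
  pos_rho2 : e ^ 2 = 3 + rho ^ 2 }.

Lemma position_e e rho p q r : position e rho p q r -> 0 < e <= 13 / 6.
Proof. intros [Hp Hq Hr E He Hle Hrho Hrho2]; split; [|assumption]. nra. Qed.

Lemma position_norm e rho p q r : position e rho p q r ->
  coX p q r ^ 2 + 27 / 4 * coV p q r ^ 2 = (rho ^ 3) ^ 2.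
Proof.
  intros [Hp Hq Hr E He Hle Hrho Hrho2]. rewrite co_norm, He, Hrho2 by assumption. ring.
Qed.

Lemma position_coX e rho p q r : position e rho p q r -> Rabs (coX p q r) <= rho ^ 3.
Proof.
  intro H. pose proof (position_norm _ _ _ _ _ H) as E. destruct H.
  assert (0 <= rho ^ 3) by (apply pow_le; assumption).
  pose proof (pow2_ge_0 (coV p q r)). apply Rabs_le; nra.
Qed.

Lemma rho_bound e rho p q r : position e rho p q r -> 2 / 27 * rho ^ 3 <= 164 / 1000.
Proof.
  intro H. pose proof (position_e _ _ _ _ _ H) as He. destruct H as [_ _ _ _ _ _ Hr E].
  (* [61 / 36 = (13 / 6)^2 - 3]. *)
  assert (R2 : rho ^ 2 <= 61 / 36) by nra.
  assert (Hrho : rho <= 1302 / 1000) by nra.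
  assert (rho ^ 3 <= 61 / 36 * (1302 / 1000)) by (replace (rho ^ 3) with (rho ^ 2 * rho) by ring; apply Rmult_le_compat; nra).
  lra.
Qed.

Definition sqrt27 : R := 3 * sqrt 3 / 2.
Lemma sqrt27_sqr : sqrt27 * sqrt27 = 27 / 4.
Proof. unfold sqrt27. pose proof (sqrt_sqrt 3 ltac:(lra)). nra. Qed.
Lemma sqrt27_pos : 0 <= sqrt27.
Proof. unfold sqrt27; pose proof (sqrt_pos 3); lra. Qed.

Lemma sextuple_phi s e rho p q r a b : s = 3%nat \/ s = 6%nat -> position e rho p q r -> 0 < hexn a b ->
  let g := xiR a b / hexn a b ^ 3 in let h := sqrt27 * xiI a b / hexn a b ^ 3 in
  let f := fun X => pfun s (e ^ 2 + 1) e (kcub e X) in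
  let Y := sqrt27 * Rabs (coV p q r) in
  sextuple s p q r a b = (/ hexn a b) ^ s * (f (g * coX p q r + h * Y) + f (g * coX p q r - h * Y)).
Proof.
  intros Hs H HN g h f Y. destruct H as [Hp Hq Hr E He _ _ _].
  assert (HN' : 0 < hexn b a) by (rewrite hexn_sym; assumption).
  pose proof (triple_phi s p q r a b Hs Hp Hq Hr E HN) as T1.
  pose proof (triple_phi s p q r b a Hs Hp Hq Hr E HN') as T2.
  cbv zeta in T1, T2. rewrite He in T1, T2.
  rewrite (hexn_sym a b), (xiR_sym a b), (xiI_sym a b) in T2.
  unfold sextuple. rewrite T1, T2. fold g.
  fold (f (g * coX p q r - 27 / 4 * (xiI a b / hexn a b ^ 3) * coV p q r)).
  fold (f (g * coX p q r - 27 / 4 * (- xiI a b / hexn a b ^ 3) * coV p q r)).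
  rewrite <- Rmult_plus_distr_l. f_equal.
  assert (Z1 : 27 / 4 * (xiI a b / hexn a b ^ 3) * coV p q r = h * (sqrt27 * coV p q r)).
  { rewrite <- sqrt27_sqr; unfold h; field; lra. }
  assert (Z2 : 27 / 4 * (- xiI a b / hexn a b ^ 3) * coV p q r = - (h * (sqrt27 * coV p q r))).
  { rewrite <- sqrt27_sqr; unfold h; field; lra. }
  rewrite Z1, Z2. unfold Y. destruct (Rle_dec 0 (coV p q r)).
  - rewrite Rabs_pos_eq by assumption. rewrite Rplus_comm. f_equal; f_equal; ring.
  - rewrite Rabs_left by lra. f_equal; f_equal; ring.
Qed.

Lemma kcub_derive e X : is_derive (kcub e) X (2 / 27).
Proof. unfold kcub; auto_derive; [exact I|field]. Qed.

(** The rotation bound on the circle of radius [rho^3], rescaled by [2 / 27] from [X] to the product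
    [kcub e X]; [M1] and [M2] are the derivative bounds of [phi_bounds], and [0.164] bounds the
    rescaled radius. *)
Lemma sextuple_bound s M1 M2 e rho p q r p' q' r' a b : s = 3%nat /\ M1 = 19 /\ M2 = 57 \/ s = 6%nat /\ M1 = 215 /\ M2 = 1150 ->
  position e rho p q r -> position e rho p' q' r' -> 0 < hexn a b -> coX p' q' r' <= coX p q r ->
  Rabs (sextuple s p' q' r' a b - sextuple s p q r a b) <=
  (/ hexn a b) ^ s * (2 * (M1 + 164 / 1000 * M2)) * (2 / 27 * (coX p q r - coX p' q' r')).
Proof.
  intros Hs H H' HN HX. set (N := hexn a b) in *.
  pose proof (position_e _ _ _ _ _ H) as He. pose proof (rho_bound _ _ _ _ _ H) as HR.
  assert (Hs' : s = 3%nat \/ s = 6%nat) by tauto.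
  rewrite (sextuple_phi s e rho p q r a b Hs' H HN), (sextuple_phi s e rho p' q' r' a b Hs' H' HN). fold N.
  set (g := xiR a b / N ^ 3). set (h := sqrt27 * xiI a b / N ^ 3).
  set (f := fun X => pfun s (e ^ 2 + 1) e (kcub e X)).
  assert (Hgh : g ^ 2 + h ^ 2 = 1).
  { unfold g, h. replace ((xiR a b / N ^ 3) ^ 2 + (sqrt27 * xiI a b / N ^ 3) ^ 2) with
      ((xiR a b ^ 2 + sqrt27 * sqrt27 * xiI a b ^ 2) / N ^ 6) by (field; lra).
    rewrite sqrt27_sqr, xi_norm. fold (hexn a b). fold N. field; lra. }
  assert (Hrho : 0 <= rho) by (destruct H; assumption).
  assert (Hrho2 : e ^ 2 = 3 + rho ^ 2) by (destruct H; assumption).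
  set (d1 := match s with 3%nat => dphi3 | _ => dphi6 end).
  set (d2 := match s with 3%nat => ddphi3 | _ => ddphi6 end).
  assert (PB := fun X HX => phi_bounds e rho X Hrho He Hrho2 HX). cbv zeta in PB.
  assert (HM2 : 0 <= M2) by (destruct Hs as [(_ & _ & ->)|(_ & _ & ->)]; lra).
  assert (D1 : forall X, Rabs X <= rho ^ 3 ->
    is_derive f X (2 / 27 * d1 (e ^ 2 + 1) e (kcub e X)) /\ Rabs (2 / 27 * d1 (e ^ 2 + 1) e (kcub e X)) <= 2 / 27 * M1).
  { intros X HX'. destruct (PB X HX') as (K0 & B3 & BB3 & B6 & BB6 & _). split.
    - unfold f. apply (is_derive_comp (pfun s (e ^ 2 + 1) e) (kcub e)); [|apply kcub_derive].
      unfold pfun, d1. destruct Hs as [(-> & _)|(-> & _)]; [apply phi3_derive|apply phi6_derive]; assumption.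
    - rewrite Rabs_mult, (Rabs_pos_eq (2 / 27)) by lra. apply Rmult_le_compat_l; [lra|].
      apply Rabs_le; unfold d1; destruct Hs as [(-> & -> & _)|(-> & -> & _)]; lra. }
  assert (D2 : forall X, Rabs X <= rho ^ 3 ->
    is_derive (fun X => 2 / 27 * d1 (e ^ 2 + 1) e (kcub e X)) X (2 / 27 * (2 / 27 * d2 (e ^ 2 + 1) e (kcub e X))) /\
    Rabs (2 / 27 * (2 / 27 * d2 (e ^ 2 + 1) e (kcub e X))) <= 2 / 27 * (2 / 27 * M2)).
  { intros X HX'. destruct (PB X HX') as (K0 & B3 & BB3 & B6 & BB6 & _). split.
    - apply (is_derive_scal (fun X => d1 (e ^ 2 + 1) e (kcub e X))).
      apply (is_derive_comp (d1 (e ^ 2 + 1) e) (kcub e)); [|apply kcub_derive].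
      unfold d1, d2. destruct Hs as [(-> & _)|(-> & _)]; [apply dphi3_derive|apply dphi6_derive]; assumption.
    - rewrite !Rabs_mult, (Rabs_pos_eq (2 / 27)) by lra. repeat (apply Rmult_le_compat_l; [lra|]).
      apply Rabs_le; unfold d2; destruct Hs as [(-> & _ & ->)|(-> & _ & ->)]; lra. }
  assert (Hr3 : 0 <= rho ^ 3) by (apply pow_le; assumption).
  assert (YN : forall V, (sqrt27 * Rabs V) ^ 2 = 27 / 4 * V ^ 2).
  { intro V. rewrite <- sqrt27_sqr. replace ((sqrt27 * Rabs V) ^ 2) with (sqrt27 * sqrt27 * Rabs V ^ 2) by ring.
    rewrite RPow_abs, (Rabs_pos_eq (V ^ 2)) by apply pow2_ge_0. ring. }
  pose proof (rotation_points f _ _ (rho ^ 3) (2 / 27 * M1) (2 / 27 * (2 / 27 * M2)) g h Hr3 Hgh D1 D2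
    (coX p q r) (sqrt27 * Rabs (coV p q r)) (coX p' q' r') (sqrt27 * Rabs (coV p' q' r'))
    ltac:(apply Rmult_le_pos; [apply sqrt27_pos|apply Rabs_pos])
    ltac:(apply Rmult_le_pos; [apply sqrt27_pos|apply Rabs_pos])
    ltac:(rewrite YN; apply (position_norm e rho); assumption)
    ltac:(rewrite YN; apply (position_norm e rho); assumption) HX) as RB.
  rewrite <- Rmult_minus_distr_l, Rabs_mult.
  assert (HNs : 0 <= (/ N) ^ s) by (apply pow_le; left; apply Rinv_0_lt_compat, HN).
  rewrite (Rabs_pos_eq _ HNs), Rmult_assoc. apply Rmult_le_compat_l; [assumption|].
  eapply Rle_trans; [exact RB|].
  assert (HD : 0 <= coX p q r - coX p' q' r') by lra.
  replace (2 * (M1 + 164 / 1000 * M2) * (2 / 27 * (coX p q r - coX p' q' r'))) with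
    (2 * (2 / 27 * M1 + 2 / 27 * (164 / 1000) * M2) * (coX p q r - coX p' q' r')) by ring.
  apply Rmult_le_compat_r; [assumption|].
  assert (rho ^ 3 * (2 / 27 * (2 / 27 * M2)) <= 2 / 27 * (164 / 1000) * M2); [|lra].
  replace (rho ^ 3 * (2 / 27 * (2 / 27 * M2))) with (2 / 27 * rho ^ 3 * (2 / 27 * M2)) by ring.
  replace (2 / 27 * (164 / 1000) * M2) with (164 / 1000 * (2 / 27 * M2)) by ring.
  apply Rmult_le_compat_r; lra.
Qed.

(** Here the cube [xi] is [-1]: there is no dependence on [coV], and the product is [e - p q r] by
    [kcub_opp]. *)
Lemma sextuple_unit s e rho p q r a b : s = 3%nat \/ s = 6%nat -> position e rho p q r ->
  hexn a b = 1 -> a * b * (a + b) = 0 ->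
  sextuple s p q r a b = 2 * pfun s (e ^ 2 + 1) e (kcub e (- coX p q r)).
Proof.
  intros Hs H HN H0. rewrite (sextuple_phi s e rho) by (try assumption; lra). cbv zeta.
  assert (G : xiR a b = - 1) by (unfold xiR; fold (hexn a b); rewrite HN, H0; ring).
  assert (I0 : xiI a b = 0) by (unfold xiI; rewrite H0; ring).
  rewrite G, I0, HN. rewrite Rinv_1, pow1.
  replace (-1 / 1 ^ 3 * coX p q r + sqrt27 * 0 / 1 ^ 3 * (sqrt27 * Rabs (coV p q r))) with (- coX p q r) by field.
  replace (-1 / 1 ^ 3 * coX p q r - sqrt27 * 0 / 1 ^ 3 * (sqrt27 * Rabs (coV p q r))) with (- coX p q r) by field.
  ring.
Qed.

Lemma sextuple_norm3 e rho p q r a b : position e rho p q r ->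
  hexn a b = 3 -> (a * b * (a + b)) ^ 2 = 4 -> xiI a b = 0 ->
  sextuple 3 p q r a b = 2 / 27 * phi3 (e ^ 2 + 1) e (kcub e (coX p q r)).
Proof.
  intros H HN H0 I0. rewrite (sextuple_phi 3 e rho) by (try assumption; auto; lra). cbv zeta. cbn [pfun].
  assert (G : xiR a b = 27) by (unfold xiR; fold (hexn a b); rewrite HN, H0; lra).
  rewrite G, I0, HN.
  replace (27 / 3 ^ 3 * coX p q r + sqrt27 * 0 / 3 ^ 3 * (sqrt27 * Rabs (coV p q r))) with (coX p q r) by field.
  replace (27 / 3 ^ 3 * coX p q r - sqrt27 * 0 / 3 ^ 3 * (sqrt27 * Rabs (coV p q r))) with (coX p q r) by field.
  field.
Qed.

Lemma slope_le (f d : R -> R) a b m : a <= b ->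
  (forall t, a <= t <= b -> is_derive f t (d t) /\ d t <= m) -> f b - f a <= m * (b - a).
Proof.
  intros Hab H. destruct (Req_dec a b) as [->|Hne]; [lra|].
  destruct (MVT_cor2 f d a b ltac:(lra)) as (c & E & Hc).
  - intros t Ht; apply is_derive_Reals, H, Ht.
  - rewrite E; apply Rmult_le_compat_r; [lra|apply H; lra].
Qed.

Lemma kcub_opp e rho p q r : position e rho p q r -> kcub e (- coX p q r) = e - p * q * r.
Proof. intros [Hp Hq Hr E <- _ _ _]. unfold kcub, coX; field. Qed.

(** The unit vectors supply the gain. Their product [e - p q r] rises as [p q r] falls and never
    exceeds [e], which is where [phi_bounds] gives the slopes [-5] and [-3.3]; the two equal triples
    double them. *)
Lemma sextuple_unit_gap e rho p q r p' q' r' a b :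
  position e rho p q r -> position e rho p' q' r' -> coX p' q' r' <= coX p q r ->
  hexn a b = 1 -> a * b * (a + b) = 0 ->
  let d := 2 / 27 * (coX p q r - coX p' q' r') in
  10 * d <= sextuple 3 p q r a b - sextuple 3 p' q' r' a b /\
  66 / 10 * d <= (sextuple 6 p q r a b - sextuple 6 p' q' r' a b)
    - 13 / 4 * (sextuple 3 p q r a b - sextuple 3 p' q' r' a b).
Proof.
  intros H H' HX HN H0 d.
  rewrite !(sextuple_unit _ e rho p q r), !(sextuple_unit _ e rho p' q' r') by auto. cbn [pfun].
  set (f3 := fun X => phi3 (e ^ 2 + 1) e (kcub e X)). set (f6 := fun X => phi6 (e ^ 2 + 1) e (kcub e X)).
  pose proof (position_e _ _ _ _ _ H) as He.
  assert (PB : forall X, - coX p q r <= X <= - coX p' q' r' -> Rabs X <= rho ^ 3 /\ kcub e X <= e).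
  { intros X HX'. pose proof (position_coX _ _ _ _ _ H) as A. pose proof (position_coX _ _ _ _ _ H') as A'.
    apply Rabs_le_between in A; apply Rabs_le_between in A'. split; [apply Rabs_le; lra|].
    apply Rle_trans with (kcub e (- coX p' q' r')); [unfold kcub; lra|].
    rewrite (kcub_opp e rho) by assumption. destruct H'.
    assert (0 <= p' * q' * r') by (repeat apply Rmult_le_pos; assumption). lra. }
  assert (D : forall X, - coX p q r <= X <= - coX p' q' r' ->
    (is_derive f3 X (2 / 27 * dphi3 (e ^ 2 + 1) e (kcub e X)) /\
      2 / 27 * dphi3 (e ^ 2 + 1) e (kcub e X) <= 2 / 27 * (-5)) /\
    (is_derive (fun X => f6 X + (- (13 / 4)) * f3 X) X
      (2 / 27 * dphi6 (e ^ 2 + 1) e (kcub e X) + (- (13 / 4)) * (2 / 27 * dphi3 (e ^ 2 + 1) e (kcub e X))) /\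
      2 / 27 * dphi6 (e ^ 2 + 1) e (kcub e X) + (- (13 / 4)) * (2 / 27 * dphi3 (e ^ 2 + 1) e (kcub e X))
        <= 2 / 27 * (- 33 / 10))).
  { intros X HX'. destruct (PB X HX') as [B1 B2].
    destruct H as [_ _ _ _ _ _ Hrho Hrho2].
    destruct (phi_bounds e rho X Hrho He Hrho2 B1) as (K0 & _ & _ & _ & _ & B5).
    destruct (B5 B2) as [B6 B7].
    assert (Q3 : is_derive f3 X (2 / 27 * dphi3 (e ^ 2 + 1) e (kcub e X))).
    { apply (is_derive_comp (phi3 (e ^ 2 + 1) e) (kcub e)); [apply phi3_derive; assumption|apply kcub_derive]. }
    assert (Q6 : is_derive f6 X (2 / 27 * dphi6 (e ^ 2 + 1) e (kcub e X))).
    { apply (is_derive_comp (phi6 (e ^ 2 + 1) e) (kcub e)); [apply phi6_derive; assumption|apply kcub_derive]. }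
    split; split; [assumption|lra| |lra].
    exact (is_derive_plus _ _ _ _ _ Q6 (is_derive_scal _ _ (- (13 / 4)) _ Q3)). }
  assert (HX' : - coX p q r <= - coX p' q' r') by lra.
  pose proof (slope_le _ _ _ _ _ HX' (fun t Ht => proj1 (D t Ht))) as S3.
  pose proof (slope_le _ _ _ _ _ HX' (fun t Ht => proj2 (D t Ht))) as S6.
  cbv beta in S6. fold (f3 (- coX p q r)) (f3 (- coX p' q' r')) (f6 (- coX p q r)) (f6 (- coX p' q' r')).
  unfold d. split; lra.
Qed.

(** For these vectors [xi] is [27], in phase with [coX], so their terms in [zeta 3] rise along the
    move. In [zeta 6 - 13/4 zeta 3] the rise helps, and [drop63] omits the loss [741 / (4 N^3)] at
    [N = 3]. *)
Lemma sextuple_norm3_le e rho p q r p' q' r' a b :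
  position e rho p q r -> position e rho p' q' r' -> coX p' q' r' <= coX p q r ->
  hexn a b = 3 -> (a * b * (a + b)) ^ 2 = 4 -> xiI a b = 0 ->
  sextuple 3 p q r a b <= sextuple 3 p' q' r' a b.
Proof.
  intros H H' HX HN H0 I0.
  rewrite (sextuple_norm3 e rho p q r), (sextuple_norm3 e rho p' q' r') by assumption.
  pose proof (position_e _ _ _ _ _ H) as He.
  pose proof (position_coX _ _ _ _ _ H) as A. pose proof (position_coX _ _ _ _ _ H') as A'.
  apply Rabs_le_between in A; apply Rabs_le_between in A'.
  destruct H as [_ _ _ _ _ _ Hrho Hrho2].
  pose proof (slope_le (fun X => phi3 (e ^ 2 + 1) e (kcub e X))
    (fun X => 2 / 27 * dphi3 (e ^ 2 + 1) e (kcub e X)) _ _ 0 HX) as S.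
  cut (phi3 (e ^ 2 + 1) e (kcub e (coX p q r)) <= phi3 (e ^ 2 + 1) e (kcub e (coX p' q' r'))); [lra|].
  enough (phi3 (e ^ 2 + 1) e (kcub e (coX p q r)) - phi3 (e ^ 2 + 1) e (kcub e (coX p' q' r'))
    <= 0 * (coX p q r - coX p' q' r')) by lra.
  apply S. intros X HX'. destruct (phi_bounds e rho X Hrho He Hrho2 ltac:(apply Rabs_le; lra)) as (K0 & B & _).
  split; [|lra].
  apply (is_derive_comp (phi3 (e ^ 2 + 1) e) (kcub e)); [apply phi3_derive; assumption|apply kcub_derive].
Qed.

(* [|m z + n|^2 / Im z = p a^2 + q b^2 + r c^2] with [(a, b, c) = (m + n, - n, - m)]. *)
Definition hp (x y : R) : R := x / y.
Definition hq (x y : R) : R := (1 - x) / y.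
Definition hr (x y : R) : R := (x ^ 2 + y ^ 2 - x) / y.
Definition ha (v : Z * Z) : R := IZR (fst v + snd v).
Definition hb (v : Z * Z) : R := - IZR (snd v).
Definition hexz (v : Z * Z) : Z := (fst v * fst v + fst v * snd v + snd v * snd v)%Z.
Definition sext (s : nat) (x y : R) (v : Z * Z) : R :=
  sextuple s (hp x y) (hq x y) (hr x y) (ha v) (hb v).

Lemma hexn_hexz v : hexn (ha v) (hb v) = IZR (hexz v).
Proof. unfold hexn, ha, hb, hexz. rewrite !plus_IZR, !mult_IZR. ring. Qed.

Lemma tm_tq s x y v : 0 < y ->
  tm s x y v = (/ tq (hp x y) (hq x y) (hr x y) (ha v) (hb v) (- (ha v + hb v))) ^ s.
Proof.
  intro Hy. rewrite tm_fm. do 2 f_equal. unfold fm, qf, tq, hp, hq, hr, ha, hb. rewrite plus_IZR. field. lra.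
Qed.

(** The six permutations of [(m + n, - n, - m)], up to sign, are bijections of the lattice, each
    contributing one copy of the sum. *)
Lemma sext_sum s x y : 0 < y -> has_sum (sext (S (S s)) x y) (6 * zs (S (S s)) x y).
Proof.
  intro Hy. set (k := S (S s)).
  pose (cy := fun v : Z * Z => (- (fst v + snd v), fst v)%Z).
  pose (yc := fun v : Z * Z => (snd v, - (fst v + snd v))%Z).
  pose (sw := fun v : Z * Z => (fst v, - (fst v + snd v))%Z).
  assert (C1 : forall v, cy (yc v) = v) by (intros [m n]; unfold cy, yc; cbn; f_equal; lia).
  assert (C2 : forall v, yc (cy v) = v) by (intros [m n]; unfold cy, yc; cbn; f_equal; lia).
  assert (C3 : forall v, sw (sw v) = v) by (intros [m n]; unfold sw; cbn; f_equal; lia).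
  pose proof (zs_sum s x y Hy : has_sum (tm k x y) (zs k x y)) as H0.
  pose proof (has_sum_reindex cy yc _ _ C1 C2 H0) as H1.
  pose proof (has_sum_reindex cy yc _ _ C1 C2 H1) as H2.
  pose proof (has_sum_reindex sw sw _ _ C3 C3 H0) as K0.
  pose proof (has_sum_reindex sw sw _ _ C3 C3 H1) as K1.
  pose proof (has_sum_reindex sw sw _ _ C3 C3 H2) as K2.
  cbv beta in *.
  replace (6 * zs k x y) with (zs k x y + zs k x y + zs k x y + (zs k x y + zs k x y + zs k x y)) by ring.
  eapply has_sum_ext; [|exact (has_sum_plus _ _ _ _ (has_sum_plus _ _ _ _ (has_sum_plus _ _ _ _ H0 H1) H2)
    (has_sum_plus _ _ _ _ (has_sum_plus _ _ _ _ K0 K1) K2))].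
  intro v; cbv beta. rewrite !tm_tq by assumption. unfold sext, sextuple, triple.
  destruct v as [m n]; unfold ha, hb, cy, sw; cbn [fst snd].
  repeat rewrite ?plus_IZR, ?opp_IZR.
  f_equal; [f_equal; [f_equal|]|f_equal; [f_equal|]]; f_equal; f_equal; f_equal; ring.
Qed.

Lemma hexz_ge v : (3 * (nrm v * nrm v) <= 4 * hexz v)%Z.
Proof.
  destruct v as [m n]; unfold nrm, hexz; cbn [fst snd].
  assert (H : (Z.max (Z.abs m) (Z.abs n) * Z.max (Z.abs m) (Z.abs n) = m * m \/
    Z.max (Z.abs m) (Z.abs n) * Z.max (Z.abs m) (Z.abs n) = n * n)%Z).
  { destruct (Z.max_spec (Z.abs m) (Z.abs n)) as [[_ ->]|[_ ->]]; [right|left]; nia. }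
  pose proof (Z.square_nonneg (2 * m + n)); pose proof (Z.square_nonneg (m + 2 * n)).
  destruct H as [-> | ->]; nia.
Qed.

Lemma hexz_small v : (hexz v <= 3)%Z -> (-2 <= fst v <= 2 /\ -2 <= snd v <= 2)%Z.
Proof.
  intro H. pose proof (hexz_ge v) as G.
  assert (nrm v <= 2)%Z by nia. destruct v; unfold nrm in *; cbn [fst snd] in *; lia.
Qed.

Lemma hexz_one v : hexz v = 1%Z -> ((fst v + snd v) * snd v * fst v = 0)%Z.
Proof.
  intro H. destruct (hexz_small v ltac:(lia)) as [A B]. destruct v as [m n]; cbn [fst snd] in *.
  unfold hexz in H; cbn [fst snd] in H.
  assert (Em : (m = -2 \/ m = -1 \/ m = 0 \/ m = 1 \/ m = 2)%Z) by lia.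
  assert (En : (n = -2 \/ n = -1 \/ n = 0 \/ n = 1 \/ n = 2)%Z) by lia.
  decompose [or] Em; decompose [or] En; subst; first [reflexivity|discriminate H].
Qed.

Lemma hexz_three v : hexz v = 3%Z ->
  (((fst v + snd v) * snd v * fst v) * ((fst v + snd v) * snd v * fst v) = 4 /\
  (fst v + 2 * snd v) * (2 * fst v + snd v) * (fst v - snd v) = 0)%Z.
Proof.
  intro H. destruct (hexz_small v ltac:(lia)) as [A B]. destruct v as [m n]; cbn [fst snd] in *.
  unfold hexz in H; cbn [fst snd] in H.
  assert (Em : (m = -2 \/ m = -1 \/ m = 0 \/ m = 1 \/ m = 2)%Z) by lia.
  assert (En : (n = -2 \/ n = -1 \/ n = 0 \/ n = 1 \/ n = 2)%Z) by lia.
  decompose [or] Em; decompose [or] En; subst; first [discriminate H|split; reflexivity].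
Qed.

(* Lower bounds, in units of the drop of [p q r], for the decrease of the symmetrized terms of [zeta 3]
   and of [zeta 6 - (13/4) zeta 3]. *)
Definition drop3 (N : Z) : rexpr :=
  match N with 0 => EInt 0 | 1 => EInt 10 | _ => ECst (-57) (N * N * N) end%Z.
Definition drop63 (N : Z) : rexpr :=
  match N with
  | 0 => EInt 0 | 1 => ECst 66 10 | 3 => ECst (-808) 729
  | _ => EAdd (ECst (-808) (N * N * N * (N * N * N))) (ECst (-741) (4 * (N * N * N)))
  end%Z.

Lemma drop_check :
  bisect (positive_test [] (EAdd (EInt (-1)) (esum (fun v => drop3 (hexz v)) (box 6)))) 0 0 [] = true /\
  bisect (positive_test [] (EAdd (EInt (-1)) (esum (fun v => drop63 (hexz v)) (box 6)))) 0 0 [] = true.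
Proof. vm_compute; split; reflexivity. Qed.

Lemma drop_tail v : ~ In v (box 6) ->
  - (440 / IZR (nrm v) ^ 6) <= eval [] (drop3 (hexz v)) /\
  - (440 / IZR (nrm v) ^ 6) <= eval [] (drop63 (hexz v)).
Proof.
  intro Hv. rewrite In_box in Hv.
  pose proof (hexz_ge v) as G. set (r := nrm v) in *. set (N := hexz v) in *.
  assert (Hr : (7 <= r)%Z) by lia. assert (HN : (37 <= N)%Z) by nia.
  assert (Hr' : 7 <= IZR r) by (apply IZR_le; assumption).
  assert (HN' : 37 <= IZR N) by (apply IZR_le; assumption).
  assert (G' : 3 / 4 * IZR r ^ 2 <= IZR N).
  { apply IZR_le in G. rewrite !mult_IZR in G. lra. }
  assert (E3 : drop3 N = ECst (-57) (N * N * N)).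
  { unfold drop3. destruct N as [|[ | |]|]; try reflexivity; lia. }
  assert (E6 : drop63 N = EAdd (ECst (-808) (N * N * N * (N * N * N))) (ECst (-741) (4 * (N * N * N)))).
  { unfold drop63. destruct N as [|[[ | |]| |]|]; try reflexivity; lia. }
  rewrite E3, E6; cbn [eval]. rewrite !mult_IZR.
  set (R := IZR r) in *. set (M := IZR N) in *.
  assert (P : / (M * M * M) <= 64 / 27 / R ^ 6).
  { replace (64 / 27 / R ^ 6) with (/ (27 / 64 * R ^ 6)) by (field; lra).
    apply Rinv_le_contravar; [apply Rmult_lt_0_compat; [lra|apply pow_lt; lra]|].
    replace (27 / 64 * R ^ 6) with ((3 / 4 * R ^ 2) ^ 3) by field.
    replace (M * M * M) with (M ^ 3) by ring. apply pow_incr. nra. }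
  assert (M3 : 0 < M * M * M) by (repeat apply Rmult_lt_0_compat; lra).
  assert (P0 : 0 < / (M * M * M)) by (apply Rinv_0_lt_compat, M3).
  assert (P1 : / (M * M * M) <= 1 / 50000).
  { replace (1 / 50000) with (/ 50000) by field. apply Rinv_le_contravar; [lra|].
    apply Rle_trans with (37 * 37 * 37); [lra|]. repeat apply Rmult_le_compat; lra. }
  set (W := / (M * M * M)) in *.
  replace (-57 / (M * M * M)) with (-57 * W) by reflexivity.
  replace (-808 / (M * M * M * (M * M * M)) + -741 / (4 * (M * M * M))) with (-808 * (W * W) + -741 / 4 * W)
    by (unfold W; field; lra).
  (* [440 * 27 / 64] exceeds [741 / 4 + 808 / 50000]. *)
  replace (440 / R ^ 6) with (440 * (27 / 64) * (64 / 27 / R ^ 6)) by (field; lra).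
  split; nra.
Qed.

(** Over [box 6] the lower bounds add up to more than [1], while everything outside loses at most
    [440 * 2 / 6^4 < 1]. *)
Lemma hexagonal_sum_nonneg F l d (lb : Z -> rexpr) : 0 <= d -> has_sum F l ->
  (forall v, d * eval [] (lb (hexz v)) <= F v) ->
  bisect (positive_test [] (EAdd (EInt (-1)) (esum (fun v => lb (hexz v)) (box 6)))) 0 0 [] = true ->
  (forall v, ~ In v (box 6) -> - (440 / IZR (nrm v) ^ 6) <= eval [] (lb (hexz v))) -> 0 <= l.
Proof.
  intros Hd HF Hlb Hc Ht. apply (has_sum_ge _ _ _ (box 6) HF). intros L HL Hi.
  apply Rle_trans with (d * lsum (fun v => eval [] (lb (hexz v))) L).
  2: { rewrite <- lsum_scal. apply lsum_le_in; auto. }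
  apply Rmult_le_pos; [assumption|].
  rewrite (lsum_perm _ _ _ (Permutation_join L (box 6) HL (NoDup_box 6) Hi)), lsum_app.
  pose proof (bisect_positive _ _ _ _ [] Hc (Forall2_nil _) ltac:(intros e [])) as B.
  change (0 < -1 + eval [] (esum (fun v => lb (hexz v)) (box 6))) in B.
  rewrite eval_esum in B.
  (* The tail estimate is for nonnegative terms, so it is applied to the negative part. *)
  set (g := fun v => Rmax 0 (- eval [] (lb (hexz v)))).
  assert (T : lsum g (lminus L (box 6)) <= 440 * (2 / INR 6 ^ 4)).
  { apply lsum_tail6; auto using NoDup_lminus; [lia|lra|intro; apply Rmax_l| |].
    - intros v Hv. unfold g. specialize (Ht v Hv). apply Rmax_lub; [|lra].
      apply Rdiv_le_0_compat; [lra|]. apply pow_lt. rewrite In_box in Hv. apply IZR_lt. lia.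
    - intros v Hv; apply In_lminus in Hv; tauto. }
  assert (U : lsum (fun v => -1 * g v) (lminus L (box 6)) <= lsum (fun v => eval [] (lb (hexz v))) (lminus L (box 6))).
  { apply lsum_le_in. intros v _. unfold g. pose proof (Rmax_r 0 (- eval [] (lb (hexz v)))). lra. }
  rewrite lsum_scal in U. simpl INR in T. lra.
Qed.

Lemma sextuple_zero s p q r : (0 < s)%nat -> sextuple s p q r 0 0 = 0.
Proof.
  intro Hs. unfold sextuple, triple, tq.
  replace (p * 0 ^ 2 + q * 0 ^ 2 + r * (- (0 + 0)) ^ 2) with 0 by ring.
  replace (p * 0 ^ 2 + q * (- (0 + 0)) ^ 2 + r * 0 ^ 2) with 0 by ring.
  replace (p * (- (0 + 0)) ^ 2 + q * 0 ^ 2 + r * 0 ^ 2) with 0 by ring.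
  rewrite Rinv_0, pow_ne_zero by lia. ring.
Qed.

Lemma rotation_decrease e rho x y x' y' : 0 < y -> 0 < y' ->
  position e rho (hp x y) (hq x y) (hr x y) -> position e rho (hp x' y') (hq x' y') (hr x' y') ->
  hp x' y' * hq x' y' * hr x' y' <= hp x y * hq x y * hr x y ->
  zs 3 x' y' <= zs 3 x y /\
  zs 6 x' y' - 13 / 4 * zs 3 x' y' <= zs 6 x y - 13 / 4 * zs 3 x y.
Proof.
  intros Hy Hy' H H' Hd.
  (* [coX] is [27 / 2] times [p q r] plus a function of [e], so [d] is the drop of [p q r]. *)
  pose (d := 2 / 27 * (coX (hp x y) (hq x y) (hr x y) - coX (hp x' y') (hq x' y') (hr x' y'))).
  assert (HX : coX (hp x' y') (hq x' y') (hr x' y') <= coX (hp x y) (hq x y) (hr x y)).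
  { unfold coX. rewrite (pos_e _ _ _ _ _ H), (pos_e _ _ _ _ _ H'). lra. }
  assert (D0 : 0 <= d) by (unfold d; lra).
  assert (B : forall s M1 M2 C, s = 3%nat /\ M1 = 19 /\ M2 = 57 \/ s = 6%nat /\ M1 = 215 /\ M2 = 1150 ->
    2 * (M1 + 164 / 1000 * M2) <= C -> forall v, v <> (0, 0)%Z ->
    - (C * / IZR (hexz v) ^ s * d) <= sext s x y v - sext s x' y' v <= C * / IZR (hexz v) ^ s * d).
  { intros s M1 M2 C Hs HC v Hv. assert (HN : 0 < hexn (ha v) (hb v)).
    { rewrite hexn_hexz. apply IZR_lt. pose proof (hexz_ge v). pose proof (nrm_pos v Hv) as N.
      apply le_IZR in N. nia. }
    pose proof (sextuple_bound s M1 M2 e rho _ _ _ _ _ _ _ _ Hs H H' HN HX) as B.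
    rewrite hexn_hexz in *. fold d in B. apply Rabs_le_between. rewrite Rabs_minus_sym.
    eapply Rle_trans; [exact B|]. rewrite pow_inv. apply Rmult_le_compat_r; [assumption|].
    rewrite Rmult_comm. apply Rmult_le_compat_r; [|assumption].
    left; apply Rinv_0_lt_compat, pow_lt, HN. }
  (* [57] and [808] are [2 (M1 + 0.164 M2)] rounded up, and [741 / 4] in [drop63] is
     [57 * 13 / 4]. *)
  pose proof (B 3%nat 19 57 57 ltac:(auto) ltac:(lra)) as B3.
  pose proof (B 6%nat 215 1150 808 ltac:(auto) ltac:(lra)) as B6.
  assert (Hab : forall v, ha v * hb v * (ha v + hb v) = - IZR ((fst v + snd v) * snd v * fst v)).
  { intro v. unfold ha, hb. rewrite !mult_IZR, !plus_IZR. ring. }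
  assert (L : forall v, d * eval [] (drop3 (hexz v)) <= sext 3 x y v - sext 3 x' y' v /\
    d * eval [] (drop63 (hexz v)) <=
      (sext 6 x y v - sext 6 x' y' v) - 13 / 4 * (sext 3 x y v - sext 3 x' y' v)).
  { intro v. destruct (pair_eq_dec v (0, 0)%Z) as [->|Hv].
    { unfold sext, ha, hb, hexz; cbn -[sextuple]. rewrite Ropp_0, !sextuple_zero by lia. lra. }
    pose proof (B3 v Hv) as C3. pose proof (B6 v Hv) as C6.
    assert (HN : (1 <= hexz v)%Z).
    { pose proof (hexz_ge v). pose proof (nrm_pos v Hv) as N. apply le_IZR in N. nia. }
    destruct (Z.eq_dec (hexz v) 1) as [E1|E1].
    { pose proof (sextuple_unit_gap e rho _ _ _ _ _ _ (ha v) (hb v) H H' HX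
        ltac:(rewrite hexn_hexz, E1; reflexivity)
        ltac:(rewrite Hab, (hexz_one v E1); ring)) as U. fold d in U. rewrite E1; cbn [drop3 drop63 eval].
      unfold sext. lra. }
    assert (HNp : 0 < IZR (hexz v)) by (apply IZR_lt; lia).
    assert (E3 : eval [] (drop3 (hexz v)) = - (57 * / IZR (hexz v) ^ 3)).
    { assert (Ed : drop3 (hexz v) = ECst (-57) (hexz v * hexz v * hexz v)).
      { unfold drop3. destruct (hexz v) as [|[ | |]|]; try reflexivity; lia. }
      rewrite Ed; cbn [eval]. rewrite !mult_IZR. field. lra. }
    rewrite E3. split; [lra|].
    destruct (Z.eq_dec (hexz v) 3) as [E|E].
    - destruct (hexz_three v E) as [F1 F2].
      pose proof (sextuple_norm3_le e rho _ _ _ _ _ _ (ha v) (hb v) H H' HX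
        ltac:(rewrite hexn_hexz, E; reflexivity)) as U.
      assert (U' : sext 3 x y v <= sext 3 x' y' v).
      { apply U.
        - rewrite Hab. replace ((- IZR ((fst v + snd v) * snd v * fst v)) ^ 2) with
            (IZR ((fst v + snd v) * snd v * fst v) * IZR ((fst v + snd v) * snd v * fst v)) by ring.
          rewrite <- mult_IZR, F1. reflexivity.
        - unfold xiI. rewrite Hab.
          replace ((ha v - hb v) * (2 * ha v + hb v) * (ha v + 2 * hb v)) with
            (IZR ((fst v + 2 * snd v) * (2 * fst v + snd v) * (fst v - snd v))).
          + rewrite F2; ring.
          + unfold ha, hb. rewrite !mult_IZR, minus_IZR, !plus_IZR, !mult_IZR. ring. }
      rewrite E in C6 |- *. cbn [drop63 eval]. lra.
    - assert (Ed : drop63 (hexz v) = EAdd (ECst (-808) (hexz v * hexz v * hexz v * (hexz v * hexz v * hexz v)))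
        (ECst (-741) (4 * (hexz v * hexz v * hexz v)))).
      { unfold drop63. destruct (hexz v) as [|[[ | |]| |]|]; try reflexivity; lia. }
      rewrite Ed; cbn [eval]. rewrite !mult_IZR.
      replace (d * (-808 / (IZR (hexz v) * IZR (hexz v) * IZR (hexz v) * (IZR (hexz v) * IZR (hexz v) * IZR (hexz v))) +
        -741 / (4 * (IZR (hexz v) * IZR (hexz v) * IZR (hexz v))))) with
        (- (808 * / IZR (hexz v) ^ 6 * d) - 13 / 4 * (57 * / IZR (hexz v) ^ 3 * d)) by (field; lra).
      lra. }
  destruct drop_check as [K3 K6].
  pose proof (has_sum_minus _ _ _ _ (sext_sum 1 x y Hy) (sext_sum 1 x' y' Hy')) as S3.
  pose proof (has_sum_minus _ _ _ _ (sext_sum 4 x y Hy) (sext_sum 4 x' y' Hy')) as S6.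
  pose proof (has_sum_minus _ _ _ _ S6 (has_sum_scal (13 / 4) _ _ S3)) as S63.
  pose proof (hexagonal_sum_nonneg _ _ d drop3 D0 S3 (fun v => proj1 (L v)) K3 (fun v Hv => proj1 (drop_tail v Hv))).
  pose proof (hexagonal_sum_nonneg _ _ d drop63 D0 S63 (fun v => proj2 (L v)) K6 (fun v Hv => proj2 (drop_tail v Hv))).
  split; lra.
Qed.

(** * Lowering the imaginary part *)

Lemma sum_inv_pow_ge_2 t s : 0 < t -> 2 <= t ^ s + / t ^ s.
Proof.
  intro Ht. assert (P : 0 < t ^ s) by (apply pow_lt, Ht). set (w := t ^ s) in *.
  assert (E : w + / w - 2 = (w - 1) ^ 2 / w) by (field; lra).
  assert (0 <= (w - 1) ^ 2 / w) by (apply Rdiv_le_0_compat; [apply pow2_ge_0|assumption]). lra.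
Qed.

(** With [t = y2 / y1], the quotient [y / qf] changes by a factor between [/ t] and [t], and
    [1 - t^-s <= t^s - 1]. *)
Lemma tm_vertical s x y1 y2 v : 0 < y1 <= y2 -> v <> (0, 0)%Z ->
  Rabs (tm s x y2 v - tm s x y1 v) <= (y2 ^ s - y1 ^ s) * (/ qf x y1 v) ^ s.
Proof.
  intros Hy Hv. pose proof (qf_pos x y1 v ltac:(lra) Hv) as Q1. pose proof (qf_pos x y2 v ltac:(lra) Hv) as Q2.
  set (t := y2 / y1). assert (Ht : 1 <= t).
  { unfold t. apply Rmult_le_reg_r with y1; [lra|]. unfold Rdiv. rewrite Rmult_assoc, Rinv_l; lra. }
  assert (E2 : y2 = t * y1) by (unfold t; field; lra). clearbody t.
  assert (H12 : qf x y1 v <= qf x y2 v).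
  { unfold qf. apply Rplus_le_compat_l. rewrite !Rpow_mult_distr.
    apply Rmult_le_compat_l; [apply pow2_ge_0|]. apply pow_incr; lra. }
  assert (H21 : qf x y2 v <= t ^ 2 * qf x y1 v).
  { rewrite E2; unfold qf. pose proof (pow2_ge_0 (IZR (fst v) * x + IZR (snd v))).
    assert (1 <= t ^ 2) by nra. nra. }
  unfold tm. set (q1 := qf x y1 v) in *. set (q2 := qf x y2 v) in *. clearbody q1 q2.
  set (f1 := y1 / q1). set (f2 := y2 / q2).
  assert (F1 : 0 < f1) by (apply Rdiv_lt_0_compat; lra).
  assert (U : f2 <= t * f1).
  { replace (t * f1) with (y2 * / q1) by (unfold f1; rewrite E2; field; lra).
    unfold f2, Rdiv. apply Rmult_le_compat_l; [lra|].
    apply Rinv_le_contravar; assumption. }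
  assert (Lw : / t * f1 <= f2).
  { unfold f1, f2. apply Rmult_le_reg_r with (t * q1 * q2);
      [repeat apply Rmult_lt_0_compat; lra|].
    replace (/ t * (y1 / q1) * (t * q1 * q2)) with (y1 * q2) by (field; lra).
    replace (y2 / q2 * (t * q1 * q2)) with (y1 * (t ^ 2 * q1)) by (rewrite E2; field; lra).
    apply Rmult_le_compat_l; lra. }
  assert (T0 : 0 < / t) by (apply Rinv_0_lt_compat; lra).
  assert (U' : f2 ^ s <= t ^ s * f1 ^ s).
  { rewrite <- Rpow_mult_distr. apply pow_incr. split; [|assumption]. apply Rle_trans with (/ t * f1); [|assumption].
    apply Rmult_le_pos; lra. }
  assert (L' : / t ^ s * f1 ^ s <= f2 ^ s).
  { rewrite <- pow_inv, <- Rpow_mult_distr. apply pow_incr. split; [|assumption]. apply Rmult_le_pos; lra. }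
  assert (E : (y2 ^ s - y1 ^ s) * (/ q1) ^ s = (t ^ s - 1) * f1 ^ s).
  { unfold f1, Rdiv. rewrite E2, !Rpow_mult_distr. ring. }
  rewrite E. fold f1 f2.
  pose proof (sum_inv_pow_ge_2 t s ltac:(lra)). assert (0 < f1 ^ s) by (apply pow_lt, F1).
  apply Rabs_le; nra.
Qed.

(** The terms of [(0, 1)] and [(0, -1)] are exactly [y^s]; their growth outweighs the change of all
    the others. *)
Definition unit_up (v : Z * Z) : R :=
  match v with (0, 1)%Z | (0, -1)%Z => 1 | _ => 0 end.
Definition cube_rest (x y : R) (v : Z * Z) : R :=
  match v with (0, 0)%Z | (0, 1)%Z | (0, -1)%Z => 0 | _ => (/ qf x y v) ^ 3 end.
Definition ecube (v : Z * Z) : rexpr :=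
  match v with
  | (0, 0)%Z | (0, 1)%Z | (0, -1)%Z => EInt 0
  | _ => EPow (EInv (EAdd (EPow (EAdd (EMul (EInt (fst v)) (EVar 0)) (EInt (snd v))) 2)
      (EPow (EMul (EInt (fst v)) (ECst 3 2)) 2))) 3
  end.

Lemma vertical_cases v : v = (0, 0)%Z \/
  (forall s x y, 0 < y -> tm s x y v = y ^ s) /\ unit_up v = 1 /\ (forall x y, cube_rest x y v = 0) /\ v <> (0, 0)%Z
  \/ v <> (0, 0)%Z /\ unit_up v = 0 /\ (forall x y, cube_rest x y v = (/ qf x y v) ^ 3).
Proof.
  assert (U : forall n s x y, n * n = 1 -> 0 < y -> (y / ((0 * x + n) ^ 2 + (0 * y) ^ 2)) ^ s = y ^ s).
  { intros n s x y Hn Hy. f_equal. replace ((0 * x + n) ^ 2 + (0 * y) ^ 2) with (n * n) by ring.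
    rewrite Hn; field. }
  destruct v as [[|m|m] [|[n|n|]|[n|n|]]]; auto;
    (right; right; split; [congruence|split; [reflexivity|intros; reflexivity]])
    || (right; left; split; [|split; [reflexivity|split; [intros; reflexivity|congruence]]];
        intros; apply U; [cbn [snd]; ring|assumption]).
Qed.

Lemma eval_ecube x v : eval [x] (ecube v) = cube_rest x (3 / 2) v.
Proof. destruct v as [[|m|m] [|[n|n|]|[n|n|]]]; reflexivity. Qed.

Lemma vertical_check :
  bisect (positive_test [] (esub (ECst 6 10) (esum ecube (box 3)))) 8 0 [irat 0 1 1 2] = true.
Proof. vm_compute; reflexivity. Qed.

Lemma cube_rest_nonneg x y v : 0 < y -> 0 <= cube_rest x y v.
Proof.
  intro Hy. destruct (vertical_cases v) as [-> |[(_ & _ & -> & _)|(Hv & _ & ->)]]; try (cbn; lra).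
  apply pow_le; left; apply Rinv_0_lt_compat, qf_pos; assumption.
Qed.

Lemma lsum_unit_up : lsum unit_up (box 3) = 2.
Proof. unfold lsum, box, zrange; simpl. ring. Qed.

(** At height [3/2] the other vectors contribute less than [0.6] inside [box 3] and less than [0.06]
    outside, against [2] from the pair in [unit_up]. *)
Lemma vertical_sum_nonneg x F l A B : 0 <= x <= 1 / 2 -> 0 <= A -> 0 <= B -> has_sum F l ->
  (forall v, A * unit_up v + - B * cube_rest x (3 / 2) v <= F v) ->
  66 / 100 * B <= 2 * A -> 0 <= l.
Proof.
  intros Hx HA HB HF Hlb HAB. apply (has_sum_ge _ _ _ (box 3) HF). intros L HL Hi.
  eapply Rle_trans; [|apply lsum_le_in; intros v _; apply Hlb].
  rewrite lsum_plus, !lsum_scal.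
  rewrite !(lsum_perm _ _ _ (Permutation_join L (box 3) HL (NoDup_box 3) Hi)), !lsum_app, lsum_unit_up.
  assert (U : 0 <= lsum unit_up (lminus L (box 3))).
  { apply lsum_nonneg. intros v _. unfold unit_up. destruct v as [[|m|m] [|[n|n|]|[n|n|]]]; lra. }
  assert (HE : Forall2 encl [irat 0 1 1 2] [x]).
  { constructor; [|constructor]. apply encl_irat; [reflexivity|reflexivity|lra]. }
  pose proof (bisect_positive _ _ _ _ _ vertical_check HE ltac:(intros e [])) as C.
  change (0 < 6 / 10 + - eval [x] (esum ecube (box 3))) in C. rewrite eval_esum in C.
  rewrite (lsum_ext_in _ (cube_rest x (3 / 2))) in C by (intros; apply eval_ecube).
  assert (Hr : reduced x (3 / 2)) by (repeat split; nra).
  assert (T : lsum (cube_rest x (3 / 2)) (lminus L (box 3)) <= 64 / 27 * (2 / INR 3 ^ 4)).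
  { apply lsum_tail6; auto using NoDup_lminus; [lra|intro; apply cube_rest_nonneg; lra| |].
    - intros v Hv. rewrite In_box in Hv.
      assert (N : 1 <= IZR (nrm v)) by (apply IZR_le; lia).
      pose proof (qf_reduced x (3 / 2) v Hr) as Q.
      assert (P : 0 < 3 / 4 * IZR (nrm v) ^ 2) by nra.
      apply Rle_trans with ((/ (3 / 4 * IZR (nrm v) ^ 2)) ^ 3).
      2: { apply Req_le. field. lra. }
      assert (P' : 0 <= / (3 / 4 * IZR (nrm v) ^ 2)) by (left; apply Rinv_0_lt_compat, P).
      destruct (vertical_cases v) as [-> |[(_ & _ & -> & _)|(_ & _ & ->)]]; try (apply pow_le; assumption).
      apply pow_incr. split; [left; apply Rinv_0_lt_compat; lra|]. apply Rinv_le_contravar; assumption.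
    - intros v Hv; apply In_lminus in Hv; tauto. }
  simpl INR in T. nra.
Qed.

Lemma vertical_decrease x y : 0 <= x <= 1 / 2 -> 3 / 2 <= y ->
  zs 3 x (3 / 2) <= zs 3 x y /\
  zs 6 x (3 / 2) - 13 / 4 * zs 3 x (3 / 2) <= zs 6 x y - 13 / 4 * zs 3 x y.
Proof.
  intros Hx Hy. set (y1 := 3 / 2). assert (Hy1 : 0 < y1 <= y) by (unfold y1; lra).
  set (D3 := y ^ 3 - y1 ^ 3). set (D6 := y ^ 6 - y1 ^ 6).
  assert (H3 : 0 <= D3) by (unfold D3; pose proof (pow_incr y1 y 3 ltac:(lra)); lra).
  assert (H6 : 27 / 4 * D3 <= D6).
  { replace D6 with ((y ^ 3 + y1 ^ 3) * D3) by (unfold D6, D3; ring).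
    apply Rmult_le_compat_r; [assumption|]. replace (27 / 4) with (y1 ^ 3 + y1 ^ 3) by (unfold y1; field).
    unfold D3 in H3; lra. }
  assert (L : forall v, 
    D3 * unit_up v + - D3 * cube_rest x y1 v <= tm 3 x y v - tm 3 x y1 v /\
    (D6 - 13 / 4 * D3) * unit_up v + - (D6 + 13 / 4 * D3) * cube_rest x y1 v <=
      tm 6 x y v - tm 6 x y1 v - 13 / 4 * (tm 3 x y v - tm 3 x y1 v)).
  { intro v. destruct (vertical_cases v) as [-> |[(E & -> & -> & _)|(Hv & -> & ->)]].
    - rewrite !tm_zero. cbn [unit_up cube_rest]. lra.
    - rewrite !E by lra. unfold D6, D3. lra.
    - pose proof (tm_vertical 3 x y1 y v Hy1 Hv) as B3. pose proof (tm_vertical 6 x y1 y v Hy1 Hv) as B6.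
      apply Rabs_le_between in B3. apply Rabs_le_between in B6. fold D3 in B3. fold D6 in B6.
      set (c := (/ qf x y1 v) ^ 3) in *.
      (* This bounds the inverse sixth power by the inverse cube, so one numerical check serves both
         exponents. *)
      assert (Q : 1 <= qf x y1 v).
      { unfold qf. destruct v as [m n]; cbn [fst snd]. destruct (Z.eq_dec m 0) as [->|Hm].
        - assert (n <> 0)%Z by congruence.
          assert (1 <= IZR n ^ 2); [|nra].
          rewrite <- sqr_IZR_abs. assert (1 <= IZR (Z.abs n)) by (apply IZR_le; lia). nra.
        - assert (1 <= IZR m ^ 2).
          { rewrite <- sqr_IZR_abs. assert (1 <= IZR (Z.abs m)) by (apply IZR_le; lia). nra. }
          pose proof (pow2_ge_0 (IZR m * x + IZR n)). unfold y1. nra. }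
      assert (C0 : 0 <= c) by (apply pow_le; left; apply Rinv_0_lt_compat; lra).
      assert (C1 : c <= 1).
      { rewrite <- (pow1 3). apply pow_incr. split; [left; apply Rinv_0_lt_compat; lra|].
        rewrite <- Rinv_1. apply Rinv_le_contravar; lra. }
      replace ((/ qf x y1 v) ^ 6) with (c * c) in B6 by (unfold c; ring).
      assert (c * c <= c) by nra. assert (D6 * (c * c) <= D6 * c) by (apply Rmult_le_compat_l; lra).
      split; lra. }
  pose proof (has_sum_minus _ _ _ _ (zs_sum 1 x y ltac:(lra)) (zs_sum 1 x y1 ltac:(lra))) as S3.
  pose proof (has_sum_minus _ _ _ _ (zs_sum 4 x y ltac:(lra)) (zs_sum 4 x y1 ltac:(lra))) as S6.
  pose proof (has_sum_minus _ _ _ _ S6 (has_sum_scal (13 / 4) _ _ S3)) as S63.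
  pose proof (vertical_sum_nonneg x _ _ D3 D3 Hx H3 H3 S3 (fun v => proj1 (L v)) ltac:(lra)).
  (* The inequality between the weights is [2.66 * 13/4 D3 <= 1.34 D6], which [D6 >= 27/4 D3]
     implies; the ratio [27/4] is [2 (3/2)^3]. *)
  pose proof (vertical_sum_nonneg x _ _ (D6 - 13 / 4 * D3) (D6 + 13 / 4 * D3) Hx ltac:(lra) ltac:(lra)
    S63 (fun v => proj2 (L v)) ltac:(lra)).
  split; lra.
Qed.

(** * Moves from the reduced domain into [Gamma] *)

Definition edge (x y : R) : Prop :=
  x = 0 /\ 1 <= y \/ 0 <= x <= 1 / 2 /\ 0 < y /\ x ^ 2 + y ^ 2 = 1.

Lemma edge_Gamma x y : edge x y -> Gamma (x, y).
Proof.
  intros [[-> H]|(Hx & Hy & E)]; [left; split; [reflexivity|exact H]|right].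
  unfold Gamma_b, upper_half, Cmod; cbn [fst snd Re Im]. rewrite E, sqrt_1.
  pose proof (sqrt_sqrt 3 ltac:(lra)). pose proof (sqrt_pos 3). repeat split; [assumption| |]; nra.
Qed.

Definition shape_move (x y x' y' : R) : Prop :=
  zs 3 x' y' <= zs 3 x y /\ zs 6 x' y' - 13 / 4 * zs 3 x' y' <= zs 6 x y - 13 / 4 * zs 3 x y.

Lemma position_of_point x y : reduced x y -> y <= 3 / 2 ->
  let e := (1 + x ^ 2 + y ^ 2 - x) / y in
  position e (sqrt (e ^ 2 - 3)) (hp x y) (hq x y) (hr x y).
Proof.
  intros (Hy & Hx & Hn) Hy2 e.
  assert (I : hp x y * hq x y + hq x y * hr x y + hr x y * hp x y = 1) by (unfold hp, hq, hr; field; lra).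
  assert (S : hp x y + hq x y + hr x y = e) by (unfold e, hp, hq, hr; field; lra).
  assert (E3 : 3 <= e ^ 2).
  { rewrite <- S. pose proof (pow2_ge_0 (hp x y - hq x y)). pose proof (pow2_ge_0 (hq x y - hr x y)).
    pose proof (pow2_ge_0 (hr x y - hp x y)). lra. }
  constructor; try assumption; try (apply Rdiv_le_0_compat; lra).
  - unfold e. apply Rmult_le_reg_r with y; [assumption|].
    unfold Rdiv; rewrite Rmult_assoc, Rinv_l, Rmult_1_r by lra.
    (* A line below the arc. The claim [1 + x^2 - x + y^2 <= 13/6 y] is convex in [y], so it follows
       from its two ends [y = 1 - 3 x / 10] and [y = 3/2]. *)
    assert (L : 1 - 3 / 10 * x <= y).
    { apply Rnot_lt_le; intro H. assert (y ^ 2 < (1 - 3 / 10 * x) ^ 2) by nra. nra. }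
    pose proof (Rmult_le_pos (y - (1 - 3 / 10 * x)) (3 / 2 - y) ltac:(lra) ltac:(lra)).
    nra.
  - apply sqrt_pos.
  - rewrite pow2_sqrt by lra. ring.
Qed.

(** The level sets of [e] are hyperbolic circles about the hexagonal point, and [i] lies on that
    with [e = 2]. Up to this value the circle reaches the arc, where [q = r]; beyond it, the axis,
    where [p = 0]. *)
Lemma move_to_edge x y : reduced x y -> y <= 3 / 2 -> exists x' y', edge x' y' /\ shape_move x y x' y'.
Proof.
  intros Hr Hy2. pose proof (position_of_point x y Hr Hy2) as H. cbv zeta in H.
  set (e := (1 + x ^ 2 + y ^ 2 - x) / y) in *. set (rho := sqrt (e ^ 2 - 3)) in *.
  assert (Hy : 0 < y) by apply Hr.
  pose proof (position_e _ _ _ _ _ H) as He. pose proof (position_coX _ _ _ _ _ H) as HX.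
  assert (Hrho : 0 <= rho) by (destruct H; assumption).
  assert (E2 : e ^ 2 = 3 + rho ^ 2) by (destruct H; assumption).
  destruct (Rle_dec e 2) as [H2|H2].
  (* The solution of [p + 2 q = e], [2 p q + q^2 = 1] with [p <= q]; it has [p >= 0] exactly when
     [e <= 2]. *)
  - set (p := (e - 2 * rho) / 3). set (q := (e + rho) / 3).
    assert (Hp : 0 <= p) by (unfold p; assert (2 * rho <= e) by nra; lra).
    assert (Hpq : p <= q) by (unfold p, q; lra).
    assert (Hq : 0 < q) by (unfold q; lra).
    assert (I : 2 * (p * q) + q ^ 2 = 1).
    { unfold p, q. replace (2 * ((e - 2 * rho) / 3 * ((e + rho) / 3)) + ((e + rho) / 3) ^ 2)
        with ((e ^ 2 - rho ^ 2) / 3) by field. rewrite E2; field. }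
    exists (p / (p + q)), (/ (p + q)).
    assert (F1 : hp (p / (p + q)) (/ (p + q)) = p) by (unfold hp; field; lra).
    assert (F2 : hq (p / (p + q)) (/ (p + q)) = q) by (unfold hq; field; lra).
    assert (F3 : hr (p / (p + q)) (/ (p + q)) = q).
    { unfold hr. replace (((p / (p + q)) ^ 2 + (/ (p + q)) ^ 2 - p / (p + q)) / / (p + q))
        with ((1 - p * q) / (p + q)) by (field; lra).
      apply Rmult_eq_reg_r with (p + q); [|lra].
      unfold Rdiv; rewrite Rmult_assoc, Rinv_l, Rmult_1_r by lra. lra. }
    assert (Hy' : 0 < / (p + q)) by (apply Rinv_0_lt_compat; lra).
    split.
    + right. split; [|split; [assumption|]].
      * split; [apply Rdiv_le_0_compat; lra|]. apply Rmult_le_reg_r with (p + q); [lra|].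
        unfold Rdiv; rewrite Rmult_assoc, Rinv_l, Rmult_1_r by lra. lra.
      * replace ((p / (p + q)) ^ 2 + (/ (p + q)) ^ 2) with ((p ^ 2 + 1) / (p + q) ^ 2) by (field; lra).
        replace (p ^ 2 + 1) with ((p + q) ^ 2) by (rewrite <- I; ring). field; lra.
    + apply (rotation_decrease e rho); try assumption; rewrite F1, F2, F3.
      * destruct H as [_ _ _ _ _ Hle _ _]. constructor; try lra. unfold p, q; field.
      (* In other words [coX] is [- rho^3] at the new point, its least value on the circle. *)
      * assert (C : 27 * (p * q * q) = e ^ 3 - 3 * e * rho ^ 2 - 2 * rho ^ 3) by (unfold p, q; field).
        apply Rabs_le_between in HX. unfold coX in HX. rewrite (pos_e _ _ _ _ _ H) in HX.
        replace (rho ^ 2) with (e ^ 2 - 3) in C by lra. nra.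
  (* On the axis [p, q, r] are [0, / t, t], so [t] is the larger root of [t + / t = e]; the product
     vanishes there, the least value for nonnegative [p, q, r]. *)
  - set (w := sqrt (e ^ 2 - 4)). set (t := (e + w) / 2).
    assert (Hw : w ^ 2 = e ^ 2 - 4) by (unfold w; apply pow2_sqrt; nra).
    assert (Hw0 : 0 <= w) by apply sqrt_pos.
    assert (Ht : t * (e - t) = 1) by (unfold t; nra).
    assert (Ht1 : 1 <= t) by (unfold t; lra).
    assert (F : / t = e - t) by (apply Rmult_eq_reg_l with t; [rewrite Rinv_r; lra|lra]).
    exists 0, t. split; [left; split; [reflexivity|assumption]|].
    assert (F1 : hp 0 t = 0) by (unfold hp; field; lra).
    assert (F2 : hq 0 t = / t) by (unfold hq; field; lra).
    assert (F3 : hr 0 t = t) by (unfold hr; field; lra).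
    apply (rotation_decrease e rho); try assumption; try lra; rewrite F1, F2, F3.
    + destruct H as [_ _ _ _ _ Hle _ _]. assert (0 < / t) by (apply Rinv_0_lt_compat; lra).
      constructor; try lra. replace (0 * / t + / t * t + t * 0) with (/ t * t) by ring. apply Rinv_l; lra.
    + destruct H. replace (0 * / t * t) with 0 by ring.
      apply Rmult_le_pos; [apply Rmult_le_pos|]; assumption.
Qed.

Lemma edge_dominates b x y : reduced x y ->
  exists x' y', edge x' y' /\ zs 6 x' y' - b * zs 3 x' y' <= zs 6 x y - b * zs 3 x y.
Proof.
  intro Hr. destruct (Hr) as (Hy & Hx & Hn). destruct (Rle_dec b (13 / 4)) as [Hb|Hb].
  - assert (G : exists x' y', edge x' y' /\ shape_move x y x' y').
    { destruct (Rle_dec y (3 / 2)) as [Hy2|Hy2]; [apply move_to_edge; assumption|].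
      destruct (move_to_edge x (3 / 2)) as (x' & y' & E & M1 & M2); [repeat split; nra|lra|].
      destruct (vertical_decrease x y Hx ltac:(lra)) as [V1 V2].
      exists x', y'. split; [assumption|]. split; lra. }
    destruct G as (x' & y' & E & M1 & M2). exists x', y'. split; [assumption|].
    pose proof (Rmult_le_compat_l (13 / 4 - b) _ _ ltac:(lra) M1). lra.
  - assert (G : exists x', 0 <= x' <= x /\ edge x' y).
    { destruct (Rle_dec 1 y) as [H1|H1]; [exists 0; split; [lra|left; auto]|].
      exists (sqrt (1 - y ^ 2)). assert (S : sqrt (1 - y ^ 2) ^ 2 = 1 - y ^ 2) by (apply pow2_sqrt; nra).
      pose proof (sqrt_pos (1 - y ^ 2)) as S0.
      assert (sqrt (1 - y ^ 2) <= x) by (apply Rnot_lt_le; intro; nra).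
      split; [lra|right]. split; [lra|]. split; [assumption|lra]. }
    destruct G as (x' & Hx' & E). exists x', y. split; [assumption|].
    assert (Hr' : reduced x' y).
    { split; [assumption|]. split; [lra|]. destruct E as [[-> E]|(_ & _ & E)]; nra. }
    destruct (horizontal_monotone x' x y) as [M1 M2]; try assumption; try lra.
    pose proof (Rmult_le_compat_l (b - 13 / 4) _ _ ltac:(lra) M1). lra.
Qed.

(** * Existence of the minimum on [Gamma] and conclusion *)

Lemma zs_continuity_pt s (u w : R -> R) t : continuity_pt u t -> continuity_pt w t -> 0 < w t ->
  continuity_pt (fun t => zs (S (S s)) (u t) (w t)) t.
Proof.
  intros Hu Hw H0. apply continuity_pt_locally. intro eps.
  destruct (zs_continuous s (u t) (w t) eps H0 (cond_pos eps)) as (d & Hd & H).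
  rewrite continuity_pt_locally in Hu. rewrite continuity_pt_locally in Hw.
  eapply filter_imp; [|apply filter_and; [apply (Hu (mkposreal d Hd))|apply (Hw (mkposreal d Hd))]].
  intros t' [H1 H2]. apply H; assumption.
Qed.

Lemma gap_continuity_pt b (u w : R -> R) t : continuity_pt u t -> continuity_pt w t -> 0 < w t ->
  continuity_pt (fun t => zs 6 (u t) (w t) - b * zs 3 (u t) (w t)) t.
Proof.
  intros Hu Hw H0. apply continuity_pt_minus; [apply (zs_continuity_pt 4); assumption|].
  apply continuity_pt_scal, (zs_continuity_pt 1); assumption.
Qed.

(** The single term of [(0, 1)] gives the lower bound; the upper one holds termwise, because [qf]
    increases with [y]. *)
Lemma zs_axis_growth y : 1 <= y -> y ^ 6 <= zs 6 0 y /\ zs 3 0 y <= y ^ 3 * zs 3 0 1.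
Proof.
  intro Hy. split.
  - apply (has_sum_ge _ _ _ [(0, 1)%Z] (zs_sum 4 0 y ltac:(lra))). intros L HL Hi.
    rewrite (lsum_perm _ _ _ (Permutation_join L [(0, 1)%Z] HL ltac:(constructor; [simpl; tauto|constructor]) Hi)), lsum_app.
    assert (0 <= lsum (tm 6 0 y) (lminus L [(0, 1)%Z])).
    { apply lsum_nonneg. intros; apply tm_nonneg; lra. }
    assert (E : lsum (tm 6 0 y) [(0, 1)%Z] = y ^ 6).
    { unfold lsum; cbn [map fold_right]. unfold tm, qf; cbn [fst snd]. field. }
    lra.
  - apply (has_sum_le (tm 3 0 y) (fun v => y ^ 3 * tm 3 0 1 v)); [|apply (zs_sum 1); lra|].
    2: apply has_sum_scal, (zs_sum 1); lra.
    intro v. destruct (pair_eq_dec v (0, 0)%Z) as [->|Hv]; [rewrite !tm_zero; lra|].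
    pose proof (qf_pos 0 1 v ltac:(lra) Hv) as Q. unfold tm. rewrite <- Rpow_mult_distr.
    assert (Q2 : qf 0 1 v <= qf 0 y v).
    { unfold qf. apply Rplus_le_compat_l. rewrite !Rpow_mult_distr.
      apply Rmult_le_compat_l; [apply pow2_ge_0|apply pow_incr; lra]. }
    apply pow_incr. split; [apply Rdiv_le_0_compat; lra|].
    unfold Rdiv; rewrite Rmult_1_l. apply Rmult_le_compat_l; [lra|]. apply Rinv_le_contravar; assumption.
Qed.

Lemma edge_minimum b : exists x0 y0, edge x0 y0 /\ forall x y, edge x y ->
  zs 6 x0 y0 - b * zs 3 x0 y0 <= zs 6 x y - b * zs 3 x y.
Proof.
  set (f := fun x y => zs 6 x y - b * zs 3 x y).
  set (Z := Rabs b * zs 3 0 1). assert (HZ : 0 <= Z).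
  { apply Rmult_le_pos; [apply Rabs_pos|]. apply (zs_nonneg 1); lra. }
  (* Beyond this height [y^3 (y^3 - Z)] exceeds the value at [i], which leaves a compact piece of
     the axis. *)
  set (Y := 1 + Z + Rabs (f 0 1)). assert (HY : 1 <= Y) by (unfold Y; pose proof (Rabs_pos (f 0 1)); lra).
  destruct (continuity_ab_min (fun y => f 0 y) 1 Y HY) as (y1 & M1 & B1).
  { intros y Hy. apply (gap_continuity_pt b (fun _ => 0) (fun y => y)); [|apply continuity_pt_id|lra].
    apply continuity_pt_const. intros ? ?; reflexivity. }
  destruct (continuity_ab_min (fun x => f x (sqrt (1 - x ^ 2))) 0 (1 / 2) ltac:(lra)) as (x2 & M2 & B2).
  { intros x Hx. assert (P : 0 < 1 - x ^ 2) by nra.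
    apply (gap_continuity_pt b (fun x => x) (fun x => sqrt (1 - x ^ 2))).
    - apply continuity_pt_id.
    - apply derivable_continuous_pt, ex_derive_Reals_0. auto_derive. simpl in P. lra.
    - apply sqrt_lt_R0, P. }
  assert (T1 : forall y, 1 <= y -> f 0 y1 <= f 0 y).
  { intros y Hy. destruct (Rle_dec y Y) as [H|H]; [apply M1; lra|].
    apply Rle_trans with (f 0 1); [apply M1; lra|].
    destruct (zs_axis_growth y Hy) as [G1 G2].
    assert (A : b * zs 3 0 y <= Z * y ^ 3).
    { apply Rle_trans with (Rabs b * zs 3 0 y).
      - apply Rmult_le_compat_r; [apply (zs_nonneg 1); lra|apply Rle_abs].
      - unfold Z. pose proof (Rmult_le_compat_l (Rabs b) _ _ (Rabs_pos b) G2). lra. }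
    assert (y3 : y <= y ^ 3) by nra.
    assert (1 * (1 + Rabs (f 0 1)) <= y ^ 3 * (y ^ 3 - Z)).
    { apply Rmult_le_compat; unfold Y in H; pose proof (Rabs_pos (f 0 1)); lra. }
    replace (y ^ 6) with (y ^ 3 * y ^ 3) in G1 by ring.
    pose proof (Rle_abs (f 0 1)). unfold f at 2. lra. }
  assert (T2 : forall x y, 0 <= x <= 1 / 2 /\ 0 < y /\ x ^ 2 + y ^ 2 = 1 ->
    f x2 (sqrt (1 - x2 ^ 2)) <= f x y).
  { intros x y (Hx & Hy & E). replace y with (sqrt (1 - x ^ 2)); [apply M2; assumption|].
    replace (1 - x ^ 2) with (y ^ 2) by lra. apply sqrt_pow2; lra. }
  assert (E2 : edge x2 (sqrt (1 - x2 ^ 2))).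
  { assert (P : 0 < 1 - x2 ^ 2) by nra. right; split; [assumption|]. split; [apply sqrt_lt_R0, P|].
    rewrite pow2_sqrt; lra. }
  destruct (Rle_dec (f 0 y1) (f x2 (sqrt (1 - x2 ^ 2)))) as [H|H].
  - exists 0, y1. split; [left; split; [reflexivity|apply B1]|].
    intros x y [[-> Hy]|Hxy]; [apply T1, Hy|]. specialize (T2 x y Hxy). fold (f x y) (f 0 y1). lra.
  - exists x2, (sqrt (1 - x2 ^ 2)). split; [assumption|].
    intros x y [[-> Hy]|Hxy]; [|apply T2, Hxy]. specialize (T1 y Hy).
    fold (f 0 y) (f x2 (sqrt (1 - x2 ^ 2))). lra.
Qed.

Lemma gap_zs b z : upper_half z ->
  zeta 6 z - b * zeta 3 z = zs 6 (Re z) (Im z) - b * zs 3 (Re z) (Im z).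
Proof.
  intro Hz. rewrite <- (zeta_zs 4 z Hz), <- (zeta_zs 1 z Hz).
  replace (INR 6) with 6 by (simpl; ring). replace (INR 3) with 3 by (simpl; ring). reflexivity.
Qed.

Lemma Gamma_upper_half z : Gamma z -> upper_half z.
Proof. intros [[_ H]|[H _]]; [unfold upper_half; lra|assumption]. Qed.

Theorem theorem5p3 (b : R) :
  exists m : R,
    is_min_on upper_half (fun z => zeta 6 z - b * zeta 3 z) m /\
    is_min_on Gamma (fun z => zeta 6 z - b * zeta 3 z) m.
Proof.
  destruct (edge_minimum b) as (x0 & y0 & E0 & M). pose proof (edge_Gamma x0 y0 E0) as G0.
  assert (L : forall z, upper_half z ->
    zs 6 x0 y0 - b * zs 3 x0 y0 <= zeta 6 z - b * zeta 3 z).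
  { intros z Hz. rewrite (gap_zs b z Hz).
    destruct (equivalent_reduced (Re z) (Im z) Hz) as (x & y & Hr & Heq).
    destruct (edge_dominates b x y Hr) as (x' & y' & E & D).
    rewrite <- (zs_equivalent 4 _ _ _ _ Hz Heq), <- (zs_equivalent 1 _ _ _ _ Hz Heq).
    exact (Rle_trans _ _ _ (M x' y' E) D). }
  assert (V : zeta 6 (x0, y0) - b * zeta 3 (x0, y0) = zs 6 x0 y0 - b * zs 3 x0 y0)
    by exact (gap_zs b (x0, y0) (Gamma_upper_half _ G0)).
  exists (zs 6 x0 y0 - b * zs 3 x0 y0); split; split.
  - exists (x0, y0); split; [apply Gamma_upper_half, G0|exact V].
  - exact L.
  - exists (x0, y0); split; [exact G0|exact V].
  - intros z Hz; apply L, Gamma_upper_half, Hz.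
Qed.
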